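(* Let $\mathcal L$ be a simple complex Lie algebra with root system $\Phi$ of type $A_n$ ($n\ge3$), $D_n$ ($n\ge4$) or $E_n$ ($n\in\{6,7,8\}$). Let $\mathfrak A$ be the vector space defined in the context, equipped with the $\mathcal L$-action defined there. The bilinear maps $\ast\colon\mathfrak J\times\mathfrak A\to\mathfrak A$ and $\mathcal B\colon\mathfrak J\times\mathfrak A\to\mathbb C$ defined in the context extend uniquely to $\mathfrak A\times\mathfrak A$ in such a way that $(\mathfrak A,\ast,\mathcal B)$ is a Frobenius algebra for $\mathcal L$. Moreover, the linear isomorphism $\theta\colon\mathfrak A\to\mathcal A$ of the context is an isomorphism of Frobenius algebras for $\mathcal L$ from $(\mathfrak A,\ast,\mathcal B)$ to $(\mathcal A,\ast,\mathcal B)$.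
   Context: **Setting.** Let $\mathcal H$ be a Cartan subalgebra, $\Phi\subset\mathcal H^*$ the roots, $\omega$ the highest root with respect to a base, and $\kappa$ the rescaled Killing form with $\kappa(h_\alpha,h_\alpha)=2$ for all coroots $h_\alpha$. Via $\kappa$ identify $\mathcal H^*=\mathcal H$, so that $\alpha=h_\alpha$. Fix a Chevalley basis with root vectors $e_\alpha$: $[e_\alpha,e_{-\alpha}]=h_\alpha$, $[h_\alpha,e_\beta]=\kappa(\alpha,\beta)e_\beta$, $[e_\alpha,e_\beta]=c_{\alpha,\beta}e_{\alpha+\beta}$ with $c_{\alpha,\beta}=\pm1$ if $\alpha+\beta\in\Phi$, and $c_{\alpha,\beta}=-c_{-\alpha,-\beta}$. **Frobenius algebras.** A Frobenius algebra $(V,\ast,\langle,\rangle)$ is a vector space with a commutative bilinear product and a non-degenerate symmetric bilinear form such that $\langle u\ast v,w\rangle=\langle u,v\ast w\rangle$. It is a Frobenius algebra for $\mathcal L$ if $V$ is an $\mathcal L$-module, $\ell\cdot(v\ast w)=(\ell\cdot v)\ast w+v\ast(\ell\cdot w)$ and $\langle\ell\cdot v,w\rangle+\langle v,\ell\cdot w\rangle=0$. Isomorphisms are $\mathcal L$-equivariant linear isomorphisms preserving product and form. **The algebra $\mathcal A$.** On the $\mathcal L$-module $S^2(\mathcal L)$ put $$\ell_1\ell_2\bullet\ell_3\ell_4=\tfrac14(\kappa(\ell_1,\ell_3)\ell_2\ell_4+\kappa(\ell_1,\ell_4)\ell_2\ell_3+\kappa(\ell_2,\ell_3)\ell_1\ell_4+\kappa(\ell_2,\ell_4)\ell_1\ell_3),$$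 $$B(\ell_1\ell_2,\ell_3\ell_4)=\tfrac12(\kappa(\ell_1,\ell_3)\kappa(\ell_2,\ell_4)+\kappa(\ell_1,\ell_4)\kappa(\ell_2,\ell_3)).$$ $\mathcal V$ is the submodule generated by $e_\omega e_\omega$, $\mathcal A$ its $B$-orthogonal complement, $v\mapsto\overline v$ the orthogonal projection onto $\mathcal A$; $a\ast b=\overline{a\bullet b}$ and $\mathcal B=B|_{\mathcal A\times\mathcal A}$. **The algebra $(\mathfrak J,\diamond,B_A)$.** On $\mathrm{End}(\mathcal L)$ use the Jordan product $f\bullet g=\frac12(fg+gf)$ and the form $B(f,g)=\mathrm{tr}(fg)$. Put $j_\alpha(\ell)=\kappa(\ell,h_\alpha)h_\alpha$, $z_\alpha(\ell)=\frac12(\kappa(\ell,e_\alpha)e_{-\alpha}+\kappa(\ell,e_{-\alpha})e_\alpha)$, $\mathfrak J=\langle j_\alpha\mid\alpha\in\Phi\rangle$, $\mathfrak Z=\langle z_\alpha\mid\alpha\in\Phi\rangle$, $\mathfrak S_0=\mathfrak J\oplus\mathfrak Z$ (closed under $\bullet$). Let $\mathfrak A_0$ be the $B$-orthogonal complement in $\mathfrak S_0$ of $\langle2z_\alpha-j_\alpha\mid\alpha\in\Phi\rangle$ and $\pi\colon\mathfrak S_0\to\mathfrak A_0$ the orthogonal projection. Its restriction $\pi_J\colon\mathfrak J\to\mathfrak A_0$ is a linear isomorphism. For $a,b\in\mathfrak J$ put $a\diamond b=\pi_J^{-1}(\pi(\pi_J(a)\bullet\pi_J(b)))$ and $B_A(a,b)=B(\pi_J(a),\pi_J(b))$.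 **The space $\mathfrak A$.** Let $\Lambda_0=\{\alpha+\beta\mid\alpha,\beta\in\Phi,\kappa(\alpha,\beta)=0\}$. For $\lambda\in\Lambda_0$ fix $\alpha_\lambda,\beta_\lambda\in\Phi$ with $\alpha_\lambda+\beta_\lambda=\lambda$, and let $n_\lambda$ be the number of unordered pairs $\{\alpha,\beta\}\subset\Phi$ with $\alpha+\beta=\lambda$. Then $$\mathfrak A=\mathfrak J\oplus\bigoplus_{\alpha\in\Phi}\mathfrak H_\alpha\oplus\bigoplus_{\lambda\in\Lambda_0}\mathbb Cx_\lambda,$$ where $\mathfrak H_\alpha$ is a copy of $\alpha^\perp=\{h\in\mathcal H\mid\kappa(h,\alpha)=0\}$; for $h\in\mathcal H$, $[h]_\alpha\in\mathfrak H_\alpha$ is its orthogonal projection. The linear map $\theta\colon\mathfrak A\to\mathcal A$ with $j_\alpha\mapsto\overline{h_\alpha h_\alpha}$, $[h]_\alpha\mapsto\overline{e_\alpha h}$, $x_\lambda\mapsto\overline{e_{\alpha_\lambda}e_{\beta_\lambda}}$ is well defined and an isomorphism of vector spaces. The $\mathcal L$-action on $\mathfrak A$ is $\ell\cdot v=\theta^{-1}(\ell\cdot\theta(v))$. **The partial maps.** Put $\mathfrak e_\lambda=\frac1{4n_\lambda}\sum_{\alpha\in\Phi,\,\kappa(\alpha,\lambda)=2}j_\alpha\in\mathfrak J$. For $v\in\mathfrak J$: - $v\ast w=v\diamond w$ if $w\in\mathfrak J$; - $v\ast w=\frac12e_\alpha\cdot(v\diamond(e_{-\alpha}\cdot w))$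 if $w\in\mathfrak H_\alpha$ (here $e_{-\alpha}\cdot w\in\mathfrak J$); - $v\ast w=B_A(v,\mathfrak e_\lambda)w$ if $w\in\mathbb Cx_\lambda$; - $\mathcal B(v,w)=B_A(v,w)$ if $w\in\mathfrak J$, and $\mathcal B(v,w)=0$ if $w\in\mathfrak H_\alpha$ or $w\in\mathbb Cx_\lambda$. *)

(* Defs.v *)
From HB Require Import structures.
From mathcomp Require Import all_boot all_order all_algebra ring.

Set Implicit Arguments.
Unset Strict Implicit.
Unset Printing Implicit Defensive.

Import Order.TTheory GRing.Theory Num.Theory passmx.

Local Open Scope ring_scope.

Section LinearAlgebra.
Variables (F : fieldType) (V : vectType F).

Definition lftrace (f : 'End(V)) : F :=
  \tr (mxof (vbasis {:V}) (vbasis {:V}) f).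

(* The [b]-orthogonal complement of [W] in [U]. *)
Definition orthc (b : V -> V -> F) (U W : {vspace V}) : {vspace V} :=
  (U :&: \bigcap_(i < \dim W) lker (linfun (b (vbasis W)`_i : V -> F^o)))%VS.

(* The projection onto [orthc b U W] along [W]; it is meaningful on [U], when
   [U] is the direct sum of [W] and [orthc b U W]. *)
Definition orthproj (b : V -> V -> F) (U W : {vspace V}) : 'End(V) :=
  daddv_pi (orthc b U W) W.

Lemma orthcP (b : V -> V -> F) (U W : {vspace V}) v :
    bilinear_for *%R *%R b ->
  reflect (v \in U /\ {in W, forall w, b w v = 0}) (v \in orthc b U W).
Proof.
move=> [bl br]; have bE u : linfun (b u : V -> F^o) =1 b u.
  have bu : linear (b u : V -> F^o) by exact: br.
  pose B := GRing.isLinear.Build F V F^o *:%R (b u) bu.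
  pose f : {linear V -> F^o} := HB.pack (b u : V -> F^o) B.
  exact: (lfunE f).
rewrite memv_cap; apply: (iffP andP) => -[vU vW]; split=> //; last first.
  rewrite memvE; apply/subv_bigcapP => i _; rewrite -memvE memv_ker bE vW //.
  by rewrite vbasis_mem // mem_nth // size_tuple.
move=> w wW; rewrite (coord_vbasis wW).
have bv : linear (b^~ v : V -> F^o) by exact: bl.
pose B := GRing.isLinear.Build F V F^o *:%R (b^~ v) bv.
pose f : {linear V -> F^o} := HB.pack (b^~ v : V -> F^o) B.
rewrite -[LHS]/(f _) linear_sum big1 // => i _; rewrite linearZ /=.
move: vW; rewrite memvE => /subv_bigcapP/(_ i isT).
by rewrite -memvE memv_ker bE => /eqP ->; rewrite scaler0.
Qed.

End LinearAlgebra.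

(* [symsq V] consists of the symmetric matrices of size [\dim V], the product
   [smul u v] of two vectors being their symmetrized tensor product in the
   coordinates given by [vbasis {:V}]; [slift f] is the linear map on [symsq V]
   induced by a symmetric bilinear map [f]. The universal property is given by
   [smulC], [smul_bilinear], [slift_linear], [slift_smul] and [symsq_ext]. *)

Section SymmetricSquare.
Variables (F : numFieldType) (V : vectType F).
Local Notation n := (\dim {:V}).

Definition symmx : {vspace 'M[F]_n} :=
  lker (linfun (fun A : 'M[F]_n => A - A^T)).

Definition symsq : vectType F := subvs_of symmx.

Definition smul (u v : V) : symsq :=
  let x := rVof (vbasis {:V}) u in
  let y := rVof (vbasis {:V}) v in
  vsproj symmx (2^-1 *: (x^T *m y + y^T *m x)).

Definition slift (W : lmodType F) (f : V -> V -> W) (s : symsq) : W :=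
  \sum_(i < n) \sum_(j < n)
    vsval s i j *: f (vbasis {:V})`_i (vbasis {:V})`_j.

Lemma mem_symmx (A : 'M[F]_n) : (A \in symmx) = (A == A^T).
Proof.
pose g (A : 'M[F]_n) := A - A^T.
have gl : linear g.
  move=> a B C; rewrite /g linearP /= scalerBr opprD !addrA.
  by congr (_ - _); rewrite -!addrA; congr (_ + _); rewrite addrC.
pose B := GRing.isLinear.Build F _ _ *:%R g gl.
pose f : {linear 'M[F]_n -> 'M[F]_n} := HB.pack g B.
by rewrite memv_ker -[X in linfun X]/(f : _ -> _) lfunE /= subr_eq0.
Qed.

Lemma smulE (u v : V) :
  vsval (smul u v) = 2^-1 *:
    ((rVof (vbasis {:V}) u)^T *m rVof (vbasis {:V}) v +
     (rVof (vbasis {:V}) v)^T *m rVof (vbasis {:V}) u).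
Proof.
rewrite vsprojK // mem_symmx; apply/eqP/matrixP => i j; rewrite !mxE addrC.
by congr (_ * (_ + _)); apply: eq_bigr => k _; rewrite !mxE mulrC.
Qed.

Lemma smulC u v : smul u v = smul v u.
Proof. by apply: val_inj; rewrite /= !smulE addrC. Qed.

Lemma smul_bilinear : bilinear_for *:%R *:%R smul.
Proof.
have smulr u : linear (smul u).
  move=> a v w; apply: val_inj; rewrite /= !smulE. rewrite rVof_linear.
  have trD (A B : 'rV[F]_n) : (a *: A + B)^T = a *: A^T + B^T by rewrite linearP.
  rewrite trD mulmxDr mulmxDl -scalemxAr -scalemxAl.
  rewrite !scalerDr !scalerA [a * _]mulrC -!addrA; congr (_ + _).
  by rewrite addrCA.
by split=> // v a u w; rewrite /= ![smul _ v]smulC smulr.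
Qed.

Lemma slift_linear (W : lmodType F) (f : V -> V -> W) : linear (slift f).
Proof.
move=> a s t; rewrite /slift scaler_sumr -big_split; apply: eq_bigr => i _.
rewrite scaler_sumr -big_split; apply: eq_bigr => j _ /=.
by rewrite !mxE scalerDl scalerA.
Qed.

Lemma eq_slift (W : lmodType F) (f g : V -> V -> W) (s : symsq) :
  (forall u v, f u v = g u v) -> slift f s = slift g s.
Proof.
by move=> fg; apply: eq_bigr => i _; apply: eq_bigr => j _; rewrite fg.
Qed.

Lemma slift_smul (W : lmodType F) (f : V -> V -> W) u v :
    bilinear_for *:%R *:%R f -> (forall x y, f x y = f y x) ->
  slift f (smul u v) = f u v.
Proof.
move=> [fl fr] fC.
have expand x y : f x y = \sum_(i < n) \sum_(j < n)
    (coord (vbasis {:V}) i x * coord (vbasis {:V}) j y) *: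
      f (vbasis {:V})`_i (vbasis {:V})`_j.
  pose Bl z := GRing.isLinear.Build F V W *:%R (f^~ z) (fl z).
  pose Fl z : {linear V -> W} := HB.pack (f^~ z) (Bl z).
  pose Br z := GRing.isLinear.Build F V W *:%R (f z) (fr z).
  pose Fr z : {linear V -> W} := HB.pack (f z) (Br z).
  rewrite [in LHS](coord_vbasis (memvf x)) -[LHS]/(Fl y _) linear_sum.
  apply: eq_bigr => i _; rewrite linearZ /=.
  rewrite [in LHS](coord_vbasis (memvf y)) -[f _ _]/(Fr _ _) linear_sum.
  rewrite scaler_sumr; apply: eq_bigr => j _.
  by rewrite linearZ /= scalerA.
rewrite /slift; under eq_bigr => i _.
  under eq_bigr => j _.
    rewrite smulE mxE mxE !mxE !big_ord1 !mxE -scalerA scalerDl.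
    over.
  rewrite -scaler_sumr big_split; over.
rewrite -scaler_sumr big_split /= -expand.
under [X in _ + X]eq_bigr => i _ do
  under eq_bigr => j _ do rewrite mulrC.
rewrite -[X in _ + X]/(\sum_i \sum_j _) exchange_big /=.
under [X in _ + X]eq_bigr => i _ do
  under eq_bigr => j _ do rewrite [X in _ *: X]fC [_ * _]mulrC.
under [X in _ + X]eq_bigr => i _ do
  under eq_bigr => j _ do rewrite [_ * _]mulrC.
rewrite -expand -mulr2n -scaler_nat scalerA mulVf ?scale1r //.
by rewrite pnatr_eq0.
Qed.

Lemma symsq_ext (W : lmodType F) (f g : symsq -> W) :
    linear f -> linear g -> (forall u v, f (smul u v) = g (smul u v)) ->
  f =1 g.
Proof.
move=> fl gl fg s.
have sE : s = slift smul s.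
  apply: val_inj; rewrite /= /slift linear_sum.
  have st : vsval s = (vsval s)^T.
    by apply/eqP; rewrite -mem_symmx subvsP.
  under eq_bigr => i _.
    rewrite linear_sum; under eq_bigr => j _.
      rewrite linearZ /= smulE !rVofE ?vbasisP // !trmx_delta.
      rewrite !mul_delta_mx scalerA [_ * 2^-1]mulrC -scalerA scalerDr; over.
    rewrite -scaler_sumr big_split; over.
  rewrite -scaler_sumr big_split /= -matrix_sum_delta.
  have -> : \sum_(i < n) \sum_(j < n) vsval s i j *: delta_mx j i = vsval s.
    rewrite exchange_big /= {2}st [RHS]matrix_sum_delta.
    by apply: eq_bigr => i _; apply: eq_bigr => j _; rewrite mxE.
  by rewrite -mulr2n -scaler_nat scalerA mulVf ?scale1r ?pnatr_eq0.
pose Bf := GRing.isLinear.Build F symsq W *:%R f fl.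
pose lf : {linear symsq -> W} := HB.pack f Bf.
pose Bg := GRing.isLinear.Build F symsq W *:%R g gl.
pose lg : {linear symsq -> W} := HB.pack g Bg.
rewrite sE -[f _]/(lf _) -[g _]/(lg _) /slift !linear_sum.
apply: eq_bigr => i _; rewrite !linear_sum; apply: eq_bigr => j _.
by rewrite !linearZ /= fg.
Qed.

End SymmetricSquare.

Section GeneratedSubmodule.
Variables (F : fieldType) (L V : vectType F) (act : L -> V -> V).

Definition stable_subspace (U : {vspace V}) : Prop :=
  forall x u, u \in U -> act x u \in U.

(* The increasing chain of subspaces obtained from [<[v]>] by repeatedly
   adding the images under a basis of [L] is stationary after [\dim V] steps;
   see [gen_submoduleP]. *)
Definition gen_submodule (v : V) : {vspace V} :=
  iter (\dim {:V})
    (fun U => U + \sum_(i < \dim {:L}) linfun (act (vbasis {:L})`_i) @: U)%VS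
    <[v]>%VS.

Lemma gen_submoduleP (v : V) : bilinear_for *:%R *:%R act ->
  [/\ v \in gen_submodule v, stable_subspace (gen_submodule v) &
      forall U : {vspace V}, v \in U -> stable_subspace U ->
        (gen_submodule v <= U)%VS].
Proof.
move=> [al ar]; pose Br x := GRing.isLinear.Build F V V *:%R (act x) (ar x).
pose ax x : {linear V -> V} := HB.pack (act x) (Br x).
pose Bl u := GRing.isLinear.Build F L V *:%R (act^~ u) (al u).
pose au u : {linear L -> V} := HB.pack (act^~ u) (Bl u).
have axE x u : linfun (act x) u = act x u.
  by rewrite -[act x in LHS]/(ax x : _ -> _) lfunE.
rewrite /gen_submodule; set st := (fun U : {vspace V} => _).
have stS U : (U <= st U)%VS by exact: addvSl.
have stM (U W : {vspace V}) : (U <= W)%VS -> (st U <= st W)%VS.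
  move=> UW; apply: addvS => //; apply/subv_sumP => i _.
  by apply: subv_trans (limgS _ UW) _; rewrite (sumv_sup i).
have fixst U : stable_subspace U <-> (st U <= U)%VS.
  split=> [sU | ].
    rewrite subv_add subvv; apply/subv_sumP => i _.
    by apply/subvP => _ /memv_imgP[u uU ->]; rewrite axE sU.
  rewrite subv_add => /andP[_ /subv_sumP sU] x u uU.
  rewrite (coord_vbasis (memvf x)) -[act _ u]/(au u _) linear_sum.
  apply: memv_suml => i _; rewrite linearZ memvZ //= -axE.
  by apply: (subvP (sU i isT)); apply: memv_img.
split.
- elim: (\dim _) => [|k IHk] /=; first exact: memv_line.
  exact: subvP (stS _) _ IHk.
- apply/fixst; rewrite -iterS.
  have grow k : (iter k.+1 st <[v]> <= iter k st <[v]>)%VS \/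
      (k < \dim (iter k.+1 st <[v]>%VS))%N.
    elim: k => [|k [IHk|IHk]].
    + case: (eqVneq v 0) => [->|v0]; last first.
        by right; apply: leq_trans (dimvS (stS _)); rewrite dim_vline v0.
      left; apply/fixst => x u /vlineP[t ->].
      by rewrite scaler0 -[act _ _]/(ax x 0) linear0 mem0v.
    + by left; apply: stM.
    + case: (boolP (iter k.+2 st <[v]> <= iter k.+1 st <[v]>)%VS) => [|h].
        by left.
      right; apply: leq_ltn_trans IHk _; rewrite ltnNge.
      apply: contra h => h.
      suff /eqP <- : iter k.+1 st <[v]>%VS == iter k.+2 st <[v]>%VS by [].
      by rewrite eqEdim h andbT; apply: stS.
  case: (grow (\dim {:V})) => [//|].
  by rewrite ltnNge dimvS ?subvf.
- move=> U vU /fixst sU; elim: (\dim _) => [|k IHk] /=; first by rewrite -memvE.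
  exact: subv_trans (stM _ _ IHk) sU.
Qed.

End GeneratedSubmodule.

HB.mixin Record isLieAlgebra (F : fieldType) (L : Type) of Vector F L := {
  lie : L -> L -> L;
  lie_bilinear : bilinear_for *:%R *:%R lie;
  lie_alt : forall x, lie x x = 0;
  lie_jacobi : forall x y z,
    lie x (lie y z) + lie y (lie z x) + lie z (lie x y) = 0
}.

#[short(type="lieAlgType")]
HB.structure Definition LieAlgebra (F : fieldType) :=
  {L of isLieAlgebra F L & Vector F L}.

Section LieAlgebras.
Variables (F : fieldType) (L : lieAlgType F).
Implicit Types (U I H : {vspace L}) (kap : L -> L -> F).
Implicit Types (Phi Delta : seq L).

Definition simple_lie : Prop :=
  (exists x y : L, lie x y != 0) /\
  forall I, (forall x y, y \in I -> lie x y \in I) -> I = 0%VS \/ I = {:L}%VS.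

Definition killing (x y : L) : F :=
  lftrace (linfun (lie x) \o linfun (lie y))%VF.

Definition lie_span U I : {vspace L} :=
  <<[seq lie x y | x <- vbasis U, y <- vbasis I]>>%VS.

Definition lie_nilpotent H : Prop :=
  exists k, iter k (lie_span H) H = 0%VS.

Definition cartan_subalgebra H : Prop :=
  [/\ {in H &, forall x y, lie x y \in H},
      lie_nilpotent H &
      forall x, {in H, forall h, lie x h \in H} -> x \in H].

(* Roots are vectors of [H]: the functional on [H] given by the root [a] is
   [kap a]. *)
Definition is_root H kap (a : L) : Prop :=
  [/\ a \in H, a != 0 &
      exists2 x, x != 0 & {in H, forall h, lie h x = kap a h *: x}].

Definition coroot kap (a : L) : L := (2 / kap a a) *: a.

Definition rescaled_killing H kap : Prop :=
  (exists c, forall x y, kap x y = c * killing x y) /\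
  (forall a, is_root H kap a -> kap (coroot kap a) (coroot kap a) = 2).

Definition root_system H kap Phi : Prop :=
  uniq Phi /\ (forall a, a \in Phi <-> is_root H kap a).

Definition nat_comb Delta (v : L) : Prop :=
  exists m : 'I_(size Delta) -> nat, v = \sum_(i < size Delta) Delta`_i *+ m i.

Definition is_base Phi Delta : Prop :=
  [/\ free Delta, {subset Delta <= Phi} &
      {in Phi, forall a, nat_comb Delta a \/ nat_comb Delta (- a)}].

Definition highest_root Phi Delta (w : L) : Prop :=
  w \in Phi /\ {in Phi, forall a, nat_comb Delta (w - a)}.

End LieAlgebras.

Inductive simply_laced := TypeA of nat | TypeD of nat | TypeE of nat.

Definition admissible (T : simply_laced) : bool :=
  match T with
  | TypeA n => 3 <= n
  | TypeD n => 4 <= n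
  | TypeE n => n \in [:: 6; 7; 8]
  end%N.

Definition lie_rank (T : simply_laced) : nat :=
  match T with TypeA n | TypeD n | TypeE n => n end.

(* The Dynkin diagram is the path [0 - 1 - ... - (n - 2)], the last node
   [n - 1] being joined to the node [branch_node T] of this path. *)
Definition branch_node (T : simply_laced) : nat :=
  match T with TypeA n => n - 2 | TypeD n => n - 3 | TypeE _ => 2 end%N.

Definition dynkin_edge (T : simply_laced) (i j : nat) : bool :=
  (i < j)%N &&
  (if j == (lie_rank T).-1 then i == branch_node T else j == i.+1).

Definition cartan_matrix (T : simply_laced) (i j : nat) : int :=
  if i == j then 2
  else if dynkin_edge T i j || dynkin_edge T j i then -1 else 0.

Definition has_type (F : fieldType) (L : lieAlgType F) (kap : L -> L -> F)
    (Phi : seq L) (T : simply_laced) : Prop :=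
  exists2 b : (lie_rank T).-tuple L, is_base Phi b &
    forall i j : 'I_(lie_rank T),
      kap (tnth b i) (coroot kap (tnth b j)) = (cartan_matrix T i j)%:~R.

Section Chevalley.
Variables (F : numFieldType) (L : lieAlgType F).

(* Under the identification of the dual of [H] with [H], roots and coroots
   coincide; the root [a] is therefore used for [h_a] below. *)
Lemma coroot_id (H : {vspace L}) (kap : L -> L -> F) (a : L) :
  rescaled_killing H kap -> is_root H kap a -> coroot kap a = a.
Proof.
move=> [[c kapE] nrm] ra; have := nrm a ra; rewrite /coroot.
have kl t : kap (t *: a) (t *: a) = t ^+ 2 * kap a a.
  have lZ (u : F) : linfun (lie (u *: a)) = u *: linfun (lie a) :> 'End(L).
    have adE (x : L) : linfun (lie x) =1 lie x.
      have xl : linear (lie x) by exact: lie_bilinear.2.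
      pose B := GRing.isLinear.Build F L L *:%R (lie x) xl.
      pose f : {linear L -> L} := HB.pack (lie x) B.
      exact: (lfunE f).
    apply/lfunP => y; rewrite scale_lfunE !adE.
    have yl : linear (lie^~ y) by exact: lie_bilinear.1.
    pose B := GRing.isLinear.Build F L L *:%R (lie^~ y) yl.
    pose f : {linear L -> L} := HB.pack (lie^~ y) B.
    by rewrite -[LHS]/(f _) linearZ.
  rewrite !kapE /killing lZ -comp_lfunZl -comp_lfunZr scalerA /lftrace.
  by rewrite linearZ /= mxtraceZ mulrCA -expr2.
rewrite kl; case: (eqVneq (kap a a) 0) => [->|k0].
  by rewrite mulr0 => /eqP; rewrite eq_sym pnatr_eq0.
rewrite expr2 -mulrA divfK // => h.
suff -> : 2 / kap a a = 1 by rewrite scale1r.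
have two0 : 2 != 0 :> F by rewrite pnatr_eq0.
by apply: (mulIf two0); rewrite mul1r.
Qed.

Record chevalley_basis (kap : L -> L -> F) (Phi Delta : seq L)
    (e : L -> L) (c : L -> L -> F) : Prop := {
  chev_basis : basis_of {:L} (Delta ++ [seq e a | a <- Phi]);
  chev_opp : {in Phi, forall a, lie (e a) (e (- a)) = a};
  chev_cartan : {in Phi &, forall a b, lie a (e b) = kap a b *: e b};
  chev_add : {in Phi &, forall a b, a + b \in Phi ->
    lie (e a) (e b) = c a b *: e (a + b)};
  chev_sign : {in Phi &, forall a b, a + b \in Phi -> c a b = 1 \/ c a b = -1};
  chev_symm : {in Phi &, forall a b, a + b \in Phi -> c a b = - c (- a) (- b)}
}.

End Chevalley.

Section Frobenius.
Variables (F : fieldType).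

Record frobenius_algebra (V : lmodType F) (m : V -> V -> V)
    (b : V -> V -> F) : Prop := {
  frob_mul_bilinear : bilinear_for *:%R *:%R m;
  frob_mulC : forall u v, m u v = m v u;
  frob_form_bilinear : bilinear_for *%R *%R b;
  frob_formC : forall u v, b u v = b v u;
  frob_nondeg : forall u, (forall v, b u v = 0) -> u = 0;
  frob_assoc : forall u v w, b (m u v) w = b u (m v w)
}.

Variable L : lieAlgType F.

Record lie_module (V : lmodType F) (act : L -> V -> V) : Prop := {
  lie_act_bilinear : bilinear_for *:%R *:%R act;
  lie_act_lie : forall x y v, act (lie x y) v = act x (act y v) - act y (act x v)
}.

Record frobenius_algebra_for (V : lmodType F) (act : L -> V -> V)
    (m : V -> V -> V) (b : V -> V -> F) : Prop := {
  frob_module : lie_module act;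
  frob_algebra : frobenius_algebra m b;
  frob_der : forall x v w, act x (m v w) = m (act x v) w + m v (act x w);
  frob_inv : forall x v w, b (act x v) w + b v (act x w) = 0
}.

Record frobenius_iso_for (V W : lmodType F)
    (actV : L -> V -> V) (mV : V -> V -> V) (bV : V -> V -> F)
    (actW : L -> W -> W) (mW : W -> W -> W) (bW : W -> W -> F)
    (f : V -> W) : Prop := {
  frob_iso_linear : linear f;
  frob_iso_bij : bijective f;
  frob_iso_act : forall x v, f (actV x v) = actW x (f v);
  frob_iso_mul : forall u v, f (mV u v) = mW (f u) (f v);
  frob_iso_form : forall u v, bW (f u) (f v) = bV u v
}.

End Frobenius.

Section CalA.
Variables (F : numFieldType) (L : lieAlgType F) (kap : L -> L -> F).

Definition s2act (l : L) (s : symsq L) : symsq L :=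
  slift (fun a b => smul (lie l a) b + smul a (lie l b)) s.

Definition s2mul (s t : symsq L) : symsq L :=
  slift (fun l1 l2 => slift (fun l3 l4 =>
    4^-1 *: (kap l1 l3 *: smul l2 l4 + kap l1 l4 *: smul l2 l3 +
             kap l2 l3 *: smul l1 l4 + kap l2 l4 *: smul l1 l3)) t) s.

Definition s2form (s t : symsq L) : F :=
  slift (fun l1 l2 => slift (fun l3 l4 =>
    2^-1 * (kap l1 l3 * kap l2 l4 + kap l1 l4 * kap l2 l3) : F^o) t) s.

Lemma s2actE l a b :
  s2act l (smul a b) = smul (lie l a) b + smul a (lie l b).
Proof.
have [ml mr] := smul_bilinear L; have [_ lr] := @lie_bilinear _ L.
apply: slift_smul; last by move=> x y; rewrite addrC ![smul (lie _ _) _]smulC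
  ![smul _ (lie _ _)]smulC.
split=> [v a1 u w | v a1 u w] /=.
  by rewrite (lr l) !(ml _ a1) scalerDr addrACA.
by rewrite (lr l) !(mr _ a1) scalerDr addrACA.
Qed.

Lemma s2mulE l1 l2 l3 l4 :
    bilinear_for *%R *%R kap -> (forall x y, kap x y = kap y x) ->
  s2mul (smul l1 l2) (smul l3 l4) =
  4^-1 *: (kap l1 l3 *: smul l2 l4 + kap l1 l4 *: smul l2 l3 +
           kap l2 l3 *: smul l1 l4 + kap l2 l4 *: smul l1 l3).
Proof.
move=> [kl kr] kC; have [ml mr] := smul_bilinear L.
have kl' a (x y z : L) : kap (a *: x + y) z = a * kap x z + kap y z.
  exact: (kl z a x y).
have kr' a (x y z : L) : kap z (a *: x + y) = a * kap z x + kap z y.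
  exact: (kr z a x y).
have ml' a (x y z : L) : smul (a *: x + y) z = a *: smul x z + smul y z.
  exact: (ml z a x y).
have mr' a (x y z : L) : smul z (a *: x + y) = a *: smul z x + smul z y.
  exact: (mr z a x y).
rewrite /s2mul; under [LHS]eq_slift => x y.
  rewrite slift_smul; first over.
  - by split=> [z a u w|z a u w] /=; rewrite ?kr' ?mr'; apply: val_inj;
      apply/matrixP => p q; rewrite /= !mxE; ring.
  - by move=> u w; apply: val_inj; apply/matrixP => p q; rewrite /= !mxE; ring.
rewrite slift_smul //.
- by split=> [z a u w|z a u w] /=; rewrite ?kl' ?ml'; apply: val_inj;
    apply/matrixP => p q; rewrite /= !mxE; ring.
- by move=> u w; apply: val_inj; apply/matrixP => p q; rewrite /= !mxE; ring.
Qed.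

Lemma s2formE l1 l2 l3 l4 :
    bilinear_for *%R *%R kap -> (forall x y, kap x y = kap y x) ->
  s2form (smul l1 l2) (smul l3 l4) =
  2^-1 * (kap l1 l3 * kap l2 l4 + kap l1 l4 * kap l2 l3).
Proof.
move=> [kl kr] kC.
have kl' a (x y z : L) : kap (a *: x + y) z = a * kap x z + kap y z.
  exact: (kl z a x y).
have kr' a (x y z : L) : kap z (a *: x + y) = a * kap z x + kap z y.
  exact: (kr z a x y).
rewrite /s2form; under [LHS]eq_slift => x y.
  rewrite slift_smul; first over.
  - by split=> [z a u w|z a u w] /=; rewrite !kr' -[_ *: _]/(_ * _);
      apply: (_ : _ = _ :> F); ring.
  - by move=> u w; apply: (_ : _ = _ :> F); ring.
rewrite slift_smul //.
- by split=> [z a u w|z a u w] /=; rewrite !kl' -[_ *: _]/(_ * _);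
    apply: (_ : _ = _ :> F); ring.
- by move=> u w; apply: (_ : _ = _ :> F); ring.
Qed.

Variables (e : L -> L) (omega : L).

Definition calV : {vspace symsq L} :=
  gen_submodule s2act (smul (e omega) (e omega)).

Definition calA : vectType F := subvs_of (orthc s2form fullv calV).

Definition bar (s : symsq L) : calA :=
  vsproj (orthc s2form fullv calV) (orthproj s2form fullv calV s).

Definition calA_act (l : L) (a : calA) : calA :=
  vsproj (orthc s2form fullv calV) (s2act l (vsval a)).

Definition calA_mul (a b : calA) : calA := bar (s2mul (vsval a) (vsval b)).

Definition calA_form (a b : calA) : F := s2form (vsval a) (vsval b).

End CalA.

Section Jordan.
Variables (F : numFieldType) (L : lieAlgType F) (kap : L -> L -> F).
Variables (Phi : seq L) (e : L -> L).

Definition jordan (f g : 'End(L)) : 'End(L) :=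
  2^-1 *: ((f \o g)%VF + (g \o f)%VF).

Definition trform (f g : 'End(L)) : F := lftrace (f \o g)%VF.

Definition jop (a : L) : 'End(L) := linfun (fun l => kap l a *: a).

Definition zop (a : L) : 'End(L) :=
  linfun (fun l => 2^-1 *: (kap l (e a) *: e (- a) + kap l (e (- a)) *: e a)).

Definition Jsp : {vspace 'End(L)} := <<[seq jop a | a <- Phi]>>%VS.

Definition Zsp : {vspace 'End(L)} := <<[seq zop a | a <- Phi]>>%VS.

Definition S0sp : {vspace 'End(L)} := (Jsp + Zsp)%VS.

Definition Wsp : {vspace 'End(L)} :=
  <<[seq 2 *: zop a - jop a | a <- Phi]>>%VS.

Definition piA0 : 'End('End(L)) := orthproj trform S0sp Wsp.

Definition frakJ : vectType F := subvs_of Jsp.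

Definition jelt (a : L) : frakJ := vsproj Jsp (jop a).

Definition piJ : 'Hom(frakJ, 'End(L)) := linfun (fun a : frakJ => piA0 (vsval a)).

(* [piJ] being injective, [piJ^-1] is its inverse on the image of [piJ]. *)
Definition diamond (a b : frakJ) : frakJ :=
  (piJ^-1)%VF (piA0 (jordan (piJ a) (piJ b))).

Definition formJ (a b : frakJ) : F := trform (piJ a) (piJ b).

End Jordan.

Section FrakA.
Variables (F : numFieldType) (L : lieAlgType F).
Variables (H : {vspace L}) (kap : L -> L -> F) (Phi : seq L).

Definition perp (a : L) : {vspace L} := orthc kap H <[a]>.

Definition Lambda0 : seq L :=
  undup [seq x.1 + x.2 | x <- [seq (a, b) | a <- Phi, b <- Phi]
                       & kap x.1 x.2 == 0].

(* The direct sum of the spaces [perp a] is encoded as the space of families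
   [h] with [h a] in [perp a] for all [a] in [Phi]. *)
Definition perp_sum : {vspace {ffun seq_sub Phi -> L}} :=
  (\bigcap_a linfun (fun h : {ffun seq_sub Phi -> L} => h a)
     @^-1: perp (val a))%VS.

Definition frakA : vectType F :=
  (frakJ kap Phi * subvs_of perp_sum * {ffun seq_sub Lambda0 -> F^o})%type.

Definition inJ (v : frakJ kap Phi) : frakA := (v, 0, 0).

(* The element [[h]_a]. *)
Definition inH (a : seq_sub Phi) (h : L) : frakA :=
  (0, vsproj perp_sum
        [ffun b => if b == a then orthproj kap H <[val a]> h else 0], 0).

Definition inX (lam : seq_sub Lambda0) : frakA :=
  (0, 0, [ffun mu => (mu == lam)%:R]).

Definition partJ (v : frakA) : frakJ kap Phi := v.1.1.

Definition num_pairs (lam : L) : nat :=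
  #|[set P : {set seq_sub Phi} |
      [exists a, exists b, (P == [set a; b]) && (val a + val b == lam)]]|.

Definition e_frak (lam : L) : frakJ kap Phi :=
  (4 * (num_pairs lam)%:R)^-1 *:
    \sum_(a <- Phi | kap a lam == 2) jelt kap Phi a.

Variables (e : L -> L) (omega : L).

Record theta_spec (pa pb : L -> L)
    (theta : 'Hom(frakA, calA kap e omega)) : Prop := {
  theta_J : {in Phi, forall a,
    theta (inJ (jelt kap Phi a)) = bar kap e omega (smul a a)};
  theta_H : forall a : seq_sub Phi, {in H, forall h,
    theta (inH a h) = bar kap e omega (smul (e (val a)) h)};
  theta_X : forall lam : seq_sub Lambda0,
    theta (inX lam) =
      bar kap e omega (smul (e (pa (val lam))) (e (pb (val lam))))
}.

Variable theta : 'Hom(frakA, calA kap e omega).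

(* [theta] being bijective, [theta^-1] is its inverse. *)
Definition frakA_act (l : L) (v : frakA) : frakA :=
  (theta^-1)%VF (calA_act l (theta v)).

Record extends_partial (m : frakA -> frakA -> frakA)
    (b : frakA -> frakA -> F) : Prop := {
  ext_mul_J : forall v w, m (inJ v) (inJ w) = inJ (diamond e v w);
  ext_mul_H : forall v (a : seq_sub Phi), {in perp (val a), forall h,
    m (inJ v) (inH a h) =
      2^-1 *: frakA_act (e (val a))
        (inJ (diamond e v (partJ (frakA_act (e (- val a)) (inH a h)))))};
  ext_mul_X : forall v (lam : seq_sub Lambda0) (t : F),
    m (inJ v) (t *: inX lam) =
      formJ e v (e_frak (val lam)) *: (t *: inX lam);
  ext_form_J : forall v w, b (inJ v) (inJ w) = formJ e v w;
  ext_form_H : forall v (a : seq_sub Phi), {in perp (val a), forall h,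
    b (inJ v) (inH a h) = 0};
  ext_form_X : forall v (lam : seq_sub Lambda0) (t : F),
    b (inJ v) (t *: inX lam) = 0
}.

End FrakA.

(* Main.v *)
(** The transported product and form satisfy everything, provided that [theta]
    is bijective and that the explicit formulas of the partial maps hold in
    [calA].

    A compact real form makes [B s (tau s)] positive definite on the symmetric
    square [S], where [tau] is the conjugate-linear Chevalley involution; the
    submodule [V] is [tau]-stable, so [S] is the orthogonal sum of [V] and [A].
    The extremal identity [[e, [e, x]] = -2 kap e x e] for the highest root
    vector propagates by invariance to the identity
    [kap [a, x] [b, y] + kap [a, y] [b, x] = 4 B (ab) (xy)] (linearized in [ab])
    on all of [V]. Its left hand side vanishes on the span [M] of the [h k], the
    [e_a h] with [h] orthogonal to [a], and the chosen [e_alpha e_beta] when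
    tested against opposite weights, which forces [M] to meet [V] trivially;
    root strings show that [M + V = S]. Hence [theta] is bijective.

    In weight zero, [S] embeds in the symmetric operators on [L], which turns
    the product of [S] into the Jordan product and identifies [diamond] with the
    product of [calA]. The formula on [e_a h] reduces to
    [(e_a v) * (e_-a w) = 0], which is an [sl_2] computation combined with the
    fact that the Chevalley involution fixes weight zero. The weight space of
    [calA] for a sum of two orthogonal roots is a line, and the eigenvalue of
    [v * -] on it is read off by pairing with the opposite weight.

    Uniqueness: by invariance, two products (or forms) that agree on [J] agree
    on the [L]-submodule generated by [J], which is everything. *)

Require Import Defs.
From HB Require Import structures.
From mathcomp Require Import all_boot all_order all_algebra.
From mathcomp Require Import ring.
From mathcomp Require Import reals complex.

Set Implicit Arguments.
Unset Strict Implicit.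
Unset Printing Implicit Defensive.

Import Order.TTheory GRing.Theory Num.Theory passmx.

Local Open Scope ring_scope.

(** * Bilinear maps, linear functions and traces *)

(** [V] is known only through a generator and its stability under [L], so neither a basis nor the
    dimension of it is at hand. The identity on [V] replaces them: it is a linear test, and a
    combination of the spanning vectors of [M] on which its left hand side vanishes is orthogonal to
    the test products as soon as it lies in [V]. Injectivity and surjectivity of [theta] are thus
    proved separately, without counting dimensions. A second obstacle is that a subspace of a
    complex space may be degenerate for [B]. The semilinear involution restores positivity; it
    respects the bracket because conjugation fixes the structure constants, which are integers. The
    root combinatorics is derived from the Chevalley relations: on [H], [kap] is a positive multiple
    of a trace form which is a sum of squares at sums of roots, so two roots pair to 0, 1, -1, 2 or
    -2. Every later case distinction rests on these five values. *)

Lemma bilinear_mapP (F : fieldType) (U V W : lmodType F) (f : U -> V -> W) :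
    (forall a x y z, f (a *: x + y) z = a *: f x z + f y z) ->
    (forall a x y z, f z (a *: x + y) = a *: f z x + f z y) ->
  bilinear_for *:%R *:%R f.
Proof. by move=> fl fr; split=> [z a x y|z a x y]; [apply: fl|apply: fr]. Qed.

Lemma bilinear_formP (F : fieldType) (U V : lmodType F) (f : U -> V -> F) :
    (forall a x y z, f (a *: x + y) z = a * f x z + f y z) ->
    (forall a x y z, f z (a *: x + y) = a * f z x + f z y) ->
  bilinear_for *%R *%R f.
Proof. by move=> fl fr; split=> [z a x y|z a x y]; [apply: fl|apply: fr]. Qed.

Section BilinearMaps.
Variables (F : fieldType) (U V W : lmodType F) (f : U -> V -> W).
Hypothesis fB : bilinear_for *:%R *:%R f.

Lemma bilPl a x y z : f (a *: x + y) z = a *: f x z + f y z.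
Proof. exact: fB.1 z a x y. Qed.

Lemma bilPr a x y z : f z (a *: x + y) = a *: f z x + f z y.
Proof. exact: fB.2 z a x y. Qed.

Lemma bilDl x y z : f (x + y) z = f x z + f y z.
Proof. by rewrite -[x]scale1r bilPl !scale1r. Qed.

Lemma bilDr x y z : f z (x + y) = f z x + f z y.
Proof. by rewrite -[x]scale1r bilPr !scale1r. Qed.

Lemma bil0l z : f 0 z = 0.
Proof. by apply: (addrI (f 0 z)); rewrite -bilDl !addr0. Qed.

Lemma bil0r z : f z 0 = 0.
Proof. by apply: (addrI (f z 0)); rewrite -bilDr !addr0. Qed.

Lemma bilZl a x z : f (a *: x) z = a *: f x z.
Proof. by rewrite -[a *: x]addr0 bilPl bil0l addr0. Qed.

Lemma bilZr a x z : f z (a *: x) = a *: f z x.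
Proof. by rewrite -[a *: x]addr0 bilPr bil0r addr0. Qed.

Lemma bilNl x z : f (- x) z = - f x z.
Proof. by rewrite -scaleN1r bilZl scaleN1r. Qed.

Lemma bilNr x z : f z (- x) = - f z x.
Proof. by rewrite -scaleN1r bilZr scaleN1r. Qed.

Lemma bilBl x y z : f (x - y) z = f x z - f y z.
Proof. by rewrite bilDl bilNl. Qed.

Lemma bilBr x y z : f z (x - y) = f z x - f z y.
Proof. by rewrite bilDr bilNr. Qed.

Lemma bil_suml I (r : seq I) (P : pred I) (x : I -> U) z :
  f (\sum_(i <- r | P i) x i) z = \sum_(i <- r | P i) f (x i) z.
Proof.
by apply: (big_morph (f^~ z)) => [x1 x2|]; rewrite ?bilDl ?bil0l.
Qed.

Lemma bil_sumr I (r : seq I) (P : pred I) (x : I -> V) z :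
  f z (\sum_(i <- r | P i) x i) = \sum_(i <- r | P i) f z (x i).
Proof.
by apply: (big_morph (f z)) => [x1 x2|]; rewrite ?bilDr ?bil0r.
Qed.

End BilinearMaps.

Section BilinearForms.
Variables (F : fieldType) (U V : lmodType F) (f : U -> V -> F).
Hypothesis fB : bilinear_for *%R *%R f.

Let fB' : bilinear_for *:%R *:%R (f : U -> V -> F^o).
Proof. by split=> [z a x y|z a x y]; [apply: fB.1|apply: fB.2]. Qed.

Lemma formPl a x y z : f (a *: x + y) z = a * f x z + f y z.
Proof. exact: bilPl fB' a x y z. Qed.

Lemma formPr a x y z : f z (a *: x + y) = a * f z x + f z y.
Proof. exact: bilPr fB' a x y z. Qed.

Lemma formDl x y z : f (x + y) z = f x z + f y z.
Proof. exact: bilDl fB' x y z. Qed.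

Lemma formDr x y z : f z (x + y) = f z x + f z y.
Proof. exact: bilDr fB' x y z. Qed.

Lemma form0l z : f 0 z = 0.
Proof. exact: bil0l fB' z. Qed.

Lemma form0r z : f z 0 = 0.
Proof. exact: bil0r fB' z. Qed.

Lemma formZl a x z : f (a *: x) z = a * f x z.
Proof. exact: bilZl fB' a x z. Qed.

Lemma formZr a x z : f z (a *: x) = a * f z x.
Proof. exact: bilZr fB' a x z. Qed.

Lemma formNl x z : f (- x) z = - f x z.
Proof. exact: bilNl fB' x z. Qed.

Lemma formNr x z : f z (- x) = - f z x.
Proof. exact: bilNr fB' x z. Qed.

Lemma formBl x y z : f (x - y) z = f x z - f y z.
Proof. exact: bilBl fB' x y z. Qed.

Lemma formBr x y z : f z (x - y) = f z x - f z y.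
Proof. exact: bilBr fB' x y z. Qed.

Lemma form_suml I (r : seq I) (P : pred I) (x : I -> U) z :
  f (\sum_(i <- r | P i) x i) z = \sum_(i <- r | P i) f (x i) z.
Proof. exact: bil_suml fB' I r P x z. Qed.

Lemma form_sumr I (r : seq I) (P : pred I) (x : I -> V) z :
  f z (\sum_(i <- r | P i) x i) = \sum_(i <- r | P i) f z (x i).
Proof. exact: bil_sumr fB' I r P x z. Qed.

Definition formE :=
  (formDl, formDr, formBl, formBr, formNl, formNr, formZl, formZr,
   form0l, form0r).

End BilinearForms.

Lemma span_ind (F : fieldType) (V : vectType F) (P : V -> Prop) (X : seq V) :
    P 0 -> (forall a x y, P x -> P y -> P (a *: x + y)) ->
    {in X, forall x, P x} -> {in <<X>>%VS, forall x, P x}.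
Proof.
move=> P0 PD PX v vX; rewrite (@coord_span _ _ _ (in_tuple X) v vX).
apply: (big_ind P) => // [x y Px Py|i _]; first by rewrite -[x]scale1r; apply: PD.
by rewrite -[_ *: _]addr0; apply: PD => //; apply/PX/mem_nth.
Qed.

Lemma linfunE (F : fieldType) (U V : vectType F) (f : U -> V) :
  linear f -> linfun f =1 f.
Proof.
move=> fl; pose B := GRing.isLinear.Build F U V *:%R f fl.
pose g : {linear U -> V} := HB.pack f B.
exact: (lfunE g).
Qed.

Section Trace.
Variables (F : fieldType) (V : vectType F).

Lemma lftrace_coord (f : 'End(V)) :
  lftrace f = \sum_i coord (vbasis {:V}) i (f (vbasis {:V})`_i).
Proof.
rewrite /lftrace /mxtrace; apply: eq_bigr => i _.
by rewrite /mxof !mxE /= vecof_delta.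
Qed.

Lemma lftrace_linear a (f g : 'End(V)) :
  lftrace (a *: f + g) = a * lftrace f + lftrace g.
Proof. by rewrite /lftrace linearP /= mxtraceD mxtraceZ. Qed.

Lemma lftraceC (f g : 'End(V)) : lftrace (f \o g)%VF = lftrace (g \o f)%VF.
Proof.
have bas := vbasisP {:V}.
by rewrite /lftrace !(mxof_comp (vbasis {:V}) (vbasis {:V}) bas) mxtrace_mulC.
Qed.

Lemma lftrace_rank1 (p : V -> F^o) (v : V) : linear p ->
  lftrace (linfun (fun x => p x *: v)) = p v.
Proof.
move=> pl; have fl : linear (fun x => p x *: v).
  by move=> a x y; rewrite pl scalerDl scalerA.
rewrite lftrace_coord.
pose B := GRing.isLinear.Build F V F^o *:%R p pl.
pose q : {linear V -> F^o} := HB.pack p B.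
rewrite [in RHS](coord_vbasis (memvf v)) -[RHS]/(q _) linear_sum.
apply: eq_bigr => i _; rewrite linfunE // linearZ linearZ /=.
by rewrite mulrC.
Qed.

Lemma lftrace_sum I (r : seq I) (P : pred I) (f : I -> 'End(V)) :
  lftrace (\sum_(i <- r | P i) f i) = \sum_(i <- r | P i) lftrace (f i).
Proof.
have lf0 : lftrace (0 : 'End(V)) = 0 by rewrite /lftrace linear0 mxtrace0.
apply: (big_morph (@lftrace F V)) => // f1 f2.
by rewrite -[f1]scale1r lftrace_linear scale1r mul1r.
Qed.

(** Splitting [f] into rank-one maps along [X] reduces this to [lftrace_rank1], without a
    change-of-basis matrix. *)
Lemma lftrace_basis n (X : n.-tuple V) (f : 'End(V)) : basis_of {:V} X ->
  lftrace f = \sum_i coord X i (f X`_i).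
Proof.
move=> bX; have fE : f = \sum_i linfun (fun x => coord X i x *: f X`_i).
  apply/lfunP => x; rewrite sum_lfunE [in LHS](coord_basis bX (memvf x)).
  rewrite linear_sum; apply: eq_bigr => i _; rewrite linfunE ?linearZ //.
  by move=> a y z; rewrite linearP scalerDl scalerA.
rewrite [in LHS]fE lftrace_sum; apply: eq_bigr => i _.
by rewrite lftrace_rank1 //; apply: linearP.
Qed.

End Trace.

(** * Orthogonal projection along a nondegenerate subspace *)

Section OrthogonalComplement.
Variables (F : fieldType) (V : vectType F) (b : V -> V -> F).
Variables (U W : {vspace V}).
Hypothesis bB : bilinear_for *%R *%R b.
Hypothesis WU : (W <= U)%VS.
Hypothesis bW : {in W, forall w, {in W, forall w', b w' w = 0} -> w = 0}.

Lemma orthc_cap : (orthc b U W :&: W = 0)%VS.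
Proof.
apply/eqP; rewrite -subv0; apply/subvP => w; rewrite memv_cap memv0.
by move=> /andP[/(orthcP _ _ _ bB)[_ w0] wW]; apply/eqP/bW.
Qed.

(** The complement is cut out of [U] by [\dim W] linear equations, so its dimension is at least
    [\dim U - \dim W]; since it meets [W] trivially, the sum fills [U]. *)
Lemma orthc_add : (orthc b U W + W = U)%VS.
Proof.
have sub : (orthc b U W + W <= U)%VS.
  by rewrite subv_add WU andbT; apply/subvP => w /(orthcP _ _ _ bB)[].
apply/eqP; rewrite eqEdim sub /=.
pose k := \dim W; pose fr x : 'rV[F]_k := \row_i b (vbasis W)`_i x.
have frl : linear fr.
  by move=> a x y; apply/rowP => i; rewrite !mxE (formPr bB).
rewrite (dimv_disjoint_sum orthc_cap) -(limg_ker_dim (linfun fr) U) leq_add //.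
  apply/dimvS/subvP => x; rewrite memv_cap memv_ker linfunE // => /andP[xU /eqP x0].
  apply/(orthcP _ _ _ bB); split=> // w wW.
  rewrite (coord_vbasis wW) (form_suml bB) big1 // => i _.
  by rewrite (formZl bB); have /rowP/(_ i) := x0; rewrite !mxE => ->; rewrite mulr0.
by rewrite (leq_trans (dimvS (subvf _))) // dimvf /dim /= mul1n.
Qed.

Lemma orthproj_eq a w : a \in orthc b U W -> w \in W -> orthproj b U W (a + w) = a.
Proof.
move=> aO wW; rewrite /orthproj linearD /= daddv_pi_id ?orthc_cap //.
have wS : w \in (orthc b U W + W)%VS by apply: subvP wW; apply: addvSr.
have := daddv_pi_add orthc_cap wS.
rewrite (daddv_pi_id (U := W)) // 1?capvC ?orthc_cap // => /(canRL (addrK w)).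
by rewrite subrr => ->; rewrite addr0.
Qed.

Lemma orthproj_mem u : orthproj b U W u \in orthc b U W.
Proof. exact: memv_pi. Qed.

Lemma orthproj_sub u : u \in U -> u - orthproj b U W u \in W.
Proof.
rewrite -{1}orthc_add => /memv_addP[a aO [w wW ->]].
by rewrite orthproj_eq // addrC addKr.
Qed.

End OrthogonalComplement.

(** * The symmetric square *)

Section SymmetricSquareTheory.
Variables (F : numFieldType) (V : vectType F).
Local Notation n := (\dim {:V}).

Lemma symsq_decomp (s : symsq V) : s = \sum_(i < n) \sum_(j < n)
  vsval s i j *: smul (vbasis {:V})`_i (vbasis {:V})`_j.
Proof.
apply: (@symsq_ext F V (symsq V) idfun (slift (@smul F V))) s => //.
  exact: slift_linear.
move=> u v; rewrite slift_smul //; first exact: smul_bilinear.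
exact: smulC.
Qed.

Lemma symsq_ind (P : symsq V -> Prop) :
    P 0 -> (forall a s t, P s -> P t -> P (a *: s + t)) ->
  (forall u v, P (smul u v)) -> forall s, P s.
Proof.
move=> P0 PD Ps s; rewrite (symsq_decomp s).
have PA s1 s2 : P s1 -> P s2 -> P (s1 + s2).
  by move=> h1 h2; rewrite -[s1]scale1r; apply: PD.
apply: (big_ind P) => // i _; apply: (big_ind P) => // j _.
by rewrite -[_ *: _]addr0; apply: PD.
Qed.

Lemma slift_funP (W : lmodType F) (f g h : V -> V -> W) a (s : symsq V) :
  (forall u v, h u v = a *: f u v + g u v) ->
  slift h s = a *: slift f s + slift g s.
Proof.
move=> hE; rewrite /slift scaler_sumr -big_split; apply: eq_bigr => i _ /=.
rewrite scaler_sumr -big_split; apply: eq_bigr => j _ /=.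
by rewrite hE scalerDr scalerA mulrC -scalerA.
Qed.

End SymmetricSquareTheory.

Section SymmetricSquareAlgebra.
Variables (F : numFieldType) (L : lieAlgType F) (kap : L -> L -> F).
Hypotheses (kB : bilinear_for *%R *%R kap) (kC : forall x y, kap x y = kap y x).
Hypothesis kI : forall x y z, kap (lie x y) z = - kap y (lie x z).
Hypothesis kN : forall x, (forall y, kap x y = 0) -> x = 0.

Local Notation S := (symsq L).
Local Notation act := (@s2act F L).
Local Notation mul := (@s2mul F L kap).
Local Notation B := (@s2form F L kap).

Lemma s2act_bilinear : bilinear_for *:%R *:%R act.
Proof.
apply: bilinear_mapP => [a x y s|a s t x]; last by apply: slift_linear.
rewrite /s2act; refine (@slift_funP F L _ _ _ _ a s _) => u v.
have lB := @lie_bilinear F L; have sB := smul_bilinear L.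
by rewrite !(bilPl lB) (bilPl sB) (bilPr sB) scalerDr addrACA.
Qed.

Lemma s2form_bilinear : bilinear_for *%R *%R B.
Proof.
apply: bilinear_formP => [a r s t|a r t s]; first by rewrite /s2form slift_linear.
by rewrite /s2form; refine (@slift_funP F L F^o _ _ _ a s _) => u v; rewrite slift_linear.
Qed.

Lemma s2mul_bilinear : bilinear_for *:%R *:%R mul.
Proof.
apply: bilinear_mapP => [a r s t|a r t s]; first by rewrite /s2mul slift_linear.
by rewrite /s2mul; refine (@slift_funP F L _ _ _ _ a s _) => u v; rewrite slift_linear.
Qed.

Let aB := s2act_bilinear.
Let mB := s2mul_bilinear.
Let bB := s2form_bilinear.

Lemma s2formC s t : B s t = B t s.
Proof.
elim/symsq_ind: s => [|a s1 s2 h1 h2|x y]; rewrite ?(formE bB) ?h1 ?h2 //.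
elim/symsq_ind: t => [|a s1 s2 h1 h2|z w]; rewrite ?(formE bB) ?h1 ?h2 //.
by rewrite !s2formE // ![kap z _]kC ![kap w _]kC; ring.
Qed.

Lemma s2mulC s t : mul s t = mul t s.
Proof.
elim/symsq_ind: s => [|a s1 s2 h1 h2|x y]; first by rewrite bil0l // bil0r.
  by rewrite bilPl // bilPr // h1 h2.
elim/symsq_ind: t => [|a s1 s2 h1 h2|z w]; first by rewrite bil0l // bil0r.
  by rewrite bilPl // bilPr // h1 h2.
rewrite !s2mulE //; congr (_ *: _).
rewrite ![kap z _]kC ![kap w _]kC ![smul w _]smulC ![smul z _]smulC.
by rewrite -!addrA; congr (_ + _); rewrite addrCA.
Qed.

(** As the matrix of [s] is symmetric, the two terms of [B] agree after exchanging the indices, and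
    [B s (smul x y)] is the contraction of that matrix with [y] and then with [x]. Nondegeneracy of
    [kap] and freeness of the basis strip off one index at a time. *)
Lemma s2form_nondeg s : (forall x y, B s (smul x y) = 0) -> s = 0.
Proof.
move=> sB; set b := vbasis {:L}.
have symm i j : vsval s i j = vsval s j i.
  have /eqP sT : vsval s == (vsval s)^T by rewrite -mem_symmx subvsP.
  by rewrite {1}sT mxE.
have BE x y : B s (smul x y) =
    kap (\sum_i kap (\sum_j vsval s i j *: b`_j) y *: b`_i) x.
  rewrite {1}(symsq_decomp s) (form_suml bB) (form_suml kB).
  under eq_bigr => i _ do rewrite (form_suml bB).
  under [RHS]eq_bigr => i _ do
    rewrite (formZl kB) (form_suml kB) mulr_suml.
  under eq_bigr => i _.
    under eq_bigr => j _.
      rewrite (formZl bB) s2formE //.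
      rewrite (_ : _ * _ = 2^-1 * (vsval s i j * kap b`_j y * kap b`_i x) +
        2^-1 * (vsval s j i * kap b`_i y * kap b`_j x)); last first.
        by rewrite [vsval s j i]symm; ring.
      over.
    rewrite big_split; over.
  rewrite big_split /= [X in _ + X]exchange_big /=.
  rewrite -big_split; apply: eq_bigr => i _ /=.
  rewrite -big_split; apply: eq_bigr => j _ /=.
  by rewrite (formZl kB); field.
have fb : free b by apply: basis_free (vbasisP _).
have z0 i y : kap (\sum_j vsval s i j *: b`_j) y = 0.
  have /kN : forall x, kap (\sum_i kap (\sum_j vsval s i j *: b`_j) y *: b`_i) x = 0.
    by move=> x; rewrite -BE.
  by move/freeP: fb => fb /fb.
apply: val_inj; apply/matrixP => i j; rewrite !mxE.
by have /kN := z0 i; move/freeP: fb => fb /fb.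
Qed.

Lemma s2form_ext s t : (forall x y, B s (smul x y) = B t (smul x y)) -> s = t.
Proof.
move=> st; apply/eqP; rewrite -subr_eq0; apply/eqP/s2form_nondeg => x y.
by rewrite (formBl bB) st subrr.
Qed.

(** This trilinear expression is symmetric in the three products and invariant under [L];
    associativity of the form and the Leibniz rule for [s2mul] are both read off from it. *)
Lemma s2mul_formE u v z w p q :
  B (mul (smul u v) (smul z w)) (smul p q) = 8^-1 *
    (kap u z * (kap v p * kap w q + kap v q * kap w p) +
     kap u w * (kap v p * kap z q + kap v q * kap z p) +
     kap v z * (kap u p * kap w q + kap u q * kap w p) +
     kap v w * (kap u p * kap z q + kap u q * kap z p)).
Proof.
rewrite s2mulE // (formZl bB) !(formDl bB) !(formZl bB) !s2formE //.
by field.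
Qed.

Lemma s2form_assoc s t u : B (mul s t) u = B s (mul t u).
Proof.
elim/symsq_ind: s => [|a s1 s2 h1 h2|x y].
- by rewrite (bil0l mB) !(form0l bB).
- by rewrite (bilPl mB) !(formPl bB) h1 h2.
elim/symsq_ind: t => [|a s1 s2 h1 h2|z w].
- by rewrite (bil0r mB) (bil0l mB) (form0l bB) (form0r bB).
- by rewrite (bilPr mB) (bilPl mB) (formPl bB) (formPr bB) h1 h2.
elim/symsq_ind: u => [|a s1 s2 h1 h2|p q].
- by rewrite (bil0r mB) !(form0r bB).
- by rewrite (bilPr mB) !(formPr bB) h1 h2.
rewrite [RHS]s2formC !s2mul_formE ![kap y _]kC ![kap x _]kC.
by rewrite ![kap w _]kC ![kap z _]kC; ring.
Qed.

Lemma s2form_inv x s t : B (act x s) t = - B s (act x t).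
Proof.
elim/symsq_ind: s => [|a s1 s2 h1 h2|u v].
- by rewrite (bil0r aB) !(form0l bB) oppr0.
- by rewrite (bilPr aB) !(formPl bB) h1 h2; ring.
elim/symsq_ind: t => [|a s1 s2 h1 h2|z w].
- by rewrite (bil0r aB) !(form0r bB) oppr0.
- by rewrite (bilPr aB) !(formPr bB) h1 h2; ring.
by rewrite !s2actE (formDl bB) (formDr bB) !s2formE // !kI; ring.
Qed.

Lemma lieC (x y : L) : lie x y = - lie y x.
Proof.
have lB := @lie_bilinear F L.
apply/eqP; rewrite -addr_eq0; have := lie_alt (x + y).
by rewrite (bilDl lB) !(bilDr lB) !lie_alt add0r addr0 => ->.
Qed.

Lemma lie_lie (x y z : L) : lie (lie x y) z = lie x (lie y z) - lie y (lie x z).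
Proof.
have lB := @lie_bilinear F L.
have := lie_jacobi x y z => /eqP; rewrite addrC addr_eq0 lieC => /eqP/oppr_inj ->.
by rewrite [lie z x]lieC (bilNr lB).
Qed.

Lemma s2act_lie x y s : act (lie x y) s = act x (act y s) - act y (act x s).
Proof.
have sB := smul_bilinear L.
elim/symsq_ind: s => [|a s1 s2 h1 h2|u v].
- by rewrite !(bil0r aB) subrr.
- by rewrite !(bilPr aB) h1 h2 scalerBr opprD addrACA.
rewrite !s2actE !(bilDr aB) !s2actE !lie_lie (bilBl sB) (bilBr sB).
have swap (a b c d m k : S) : a - b + (c - d) = a + m + (k + c) - (b + k + (m + d)).
  rewrite [k + c]addrC [a + m + _]addrACA [m + d]addrC [b + k + _]addrACA [k + m]addrC.
  by rewrite opprD [RHS]addrACA subrr addr0 opprD addrACA.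
exact: swap.
Qed.

Lemma s2mul_der x s t : act x (mul s t) = mul (act x s) t + mul s (act x t).
Proof.
elim/symsq_ind: s => [|a s1 s2 h1 h2|u v].
- by rewrite (bil0r aB) !(bil0l mB) (bil0r aB) addr0.
- rewrite (bilPr aB) !(bilPl mB) (bilPr aB) h1 h2 scalerDr.
  by rewrite addrACA.
elim/symsq_ind: t => [|a s1 s2 h1 h2|z w].
- by rewrite (bil0r aB) !(bil0r mB) (bil0r aB) addr0.
- by rewrite (bilPr aB) !(bilPr mB) (bilPr aB) h1 h2 scalerDr addrACA.
apply: s2form_ext => p q.
rewrite s2form_inv !s2actE (bilDl mB) (bilDr mB) !(formDl bB) (formDr bB).
by rewrite !s2mul_formE !kI; ring.
Qed.

End SymmetricSquareAlgebra.

(** * Roots and the Chevalley basis *)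

Section Killing.
Variables (F : fieldType) (L : lieAlgType F).
Let lB := @lie_bilinear F L.

Lemma adE (x : L) : linfun (lie x) =1 lie x.
Proof. by apply: linfunE => a y z; apply: (bilPr lB). Qed.

Lemma ad_lin a (x y : L) :
  linfun (lie (a *: x + y)) = a *: linfun (lie x) + linfun (lie y) :> 'End(L).
Proof.
by apply/lfunP => z; rewrite add_lfunE scale_lfunE !adE (bilPl lB).
Qed.

Lemma killingC (x y : L) : killing x y = killing y x.
Proof. exact: lftraceC. Qed.

Lemma killing_bilinear : bilinear_for *%R *%R (@killing F L).
Proof.
have kl a (x y z : L) : killing (a *: x + y) z = a * killing x z + killing y z.
  by rewrite /killing ad_lin comp_lfunDl -comp_lfunZl lftrace_linear.
apply: bilinear_formP => // a x y z.
by rewrite killingC kl ![killing _ z]killingC.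
Qed.

End Killing.

Section KillingInvariance.
Variables (F : numFieldType) (L : lieAlgType F).

Lemma killing_inv (x y z : L) : killing (lie x y) z = - killing y (lie x z).
Proof.
have adL (u v : L) : linfun (lie (lie u v)) =
    (linfun (lie u) \o linfun (lie v))%VF - (linfun (lie v) \o linfun (lie u))%VF :> 'End(L).
  by apply/lfunP => w; rewrite add_lfunE opp_lfunE !comp_lfunE !adE lie_lie.
have trB (f g : 'End(L)) : lftrace (f - g) = lftrace f - lftrace g.
  by rewrite addrC -scaleN1r lftrace_linear mulN1r addrC.
rewrite /killing !adL comp_lfunDl comp_lfunNl comp_lfunDr comp_lfunNr !trB.
by rewrite opprB -!comp_lfunA (lftraceC (linfun (lie x))) -comp_lfunA.
Qed.

End KillingInvariance.

Section Roots.
Variables (F : numClosedFieldType) (L : lieAlgType F).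
Variables (H : {vspace L}) (kap : L -> L -> F) (Phi Delta : seq L).
Variables (T : simply_laced) (omega : L) (e : L -> L) (c : L -> L -> F).
Hypothesis simpleL : simple_lie L.
Hypothesis cartanH : cartan_subalgebra H.
Hypothesis kapK : rescaled_killing H kap.
Hypothesis PhiR : root_system H kap Phi.
Hypothesis PhiT : has_type kap Phi T.
Hypothesis DeltaB : is_base Phi Delta.
Hypothesis omegaP : highest_root Phi Delta omega.
Hypothesis chev : chevalley_basis kap Phi Delta e c.

Let lB := @lie_bilinear F L.

Lemma kap_bilinear : bilinear_for *%R *%R kap.
Proof.
case: kapK => -[c0 kE] _; have kB := killing_bilinear L.
by apply: bilinear_formP => a x y z; rewrite !kE ?(formPl kB) ?(formPr kB); ring.
Qed.

Let kB := kap_bilinear.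

Lemma kapC x y : kap x y = kap y x.
Proof. by case: kapK => -[c0 kE] _; rewrite !kE killingC. Qed.

Lemma kap_inv x y z : kap (lie x y) z = - kap y (lie x z).
Proof. by case: kapK => -[c0 kE] _; rewrite !kE killing_inv mulrN. Qed.

Lemma uniqPhi : uniq Phi. Proof. by case: PhiR. Qed.

Lemma rootP a : a \in Phi <-> is_root H kap a. Proof. by case: PhiR. Qed.

Lemma omega_root : omega \in Phi. Proof. by case: omegaP. Qed.

Lemma root_H a : a \in Phi -> a \in H. Proof. by move=> /rootP[]. Qed.

Lemma root_neq0 a : a \in Phi -> a != 0. Proof. by move=> /rootP[]. Qed.

Lemma kap_root a : a \in Phi -> kap a a = 2.
Proof.
move=> /rootP ra; case: kapK => _ /(_ a ra).
by rewrite (coroot_id kapK ra).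
Qed.

Lemma Delta_sub : {subset Delta <= Phi}. Proof. by case: DeltaB. Qed.

(** The radical of [kap] is an ideal, and it is not all of [L] because [kap omega omega = 2]. *)
Lemma kap_nondeg x : (forall y, kap x y = 0) -> x = 0.
Proof.
move=> x0; have xI : x \in orthc kap fullv fullv.
  by apply/(orthcP _ _ _ kB); split=> [|y _]; rewrite ?memvf // kapC.
have [_ /(_ (orthc kap fullv fullv))] := simpleL; case.
- move=> y z /(orthcP _ _ _ kB)[_ z0]; apply/(orthcP _ _ _ kB); rewrite memvf.
  split=> // w _; rewrite kapC kap_inv [kap z _]kapC.
  by rewrite z0 ?oppr0 ?memvf.
- by move=> I0; move: xI; rewrite I0 memv0 => /eqP.
move=> If; have: omega \in orthc kap fullv fullv by rewrite If memvf.
move=> /(orthcP _ _ _ kB)[_ /(_ omega (memvf _))].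
by rewrite kap_root ?omega_root // => /eqP; rewrite pnatr_eq0.
Qed.

Lemma chev_ind (P : L -> Prop) :
    P 0 -> (forall a x y, P x -> P y -> P (a *: x + y)) ->
    {in Phi, forall a, P a} -> {in Phi, forall a, P (e a)} ->
  forall x, P x.
Proof.
move=> P0 PD Pa Pe x; apply: (span_ind P0 PD _ (X := Delta ++ [seq e a | a <- Phi])).
  move=> y; rewrite mem_cat => /orP[/Delta_sub/Pa //|].
  by move=> /mapP[a aP ->]; apply: Pe.
by rewrite (span_basis (chev_basis chev)) memvf.
Qed.

Lemma e_free (s : L -> F) : \sum_(a <- Phi) s a *: e a = 0 ->
  {in Phi, forall a, s a = 0}.
Proof.
have := catr_free (basis_free (chev_basis chev)).
rewrite -[X in free X]/(tval (in_tuple _)) => /freeP fe s0 a aP.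
have ilt : (index a Phi < size [seq e a | a <- Phi])%N by rewrite size_map index_mem.
have := fe (fun i => s (Phi`_i)) _ (Ordinal ilt); rewrite /= nth_index //; apply.
rewrite -[RHS]s0 (big_nth 0) big_mkord size_map; apply: eq_bigr => i _.
by rewrite (nth_map 0).
Qed.

Lemma lie_e_opp a : a \in Phi -> lie (e a) (e (- a)) = a.
Proof. exact: chev_opp chev a. Qed.

Lemma lie_root_e a b : a \in Phi -> b \in Phi -> lie a (e b) = kap a b *: e b.
Proof. by move=> aP bP; apply: (chev_cartan chev). Qed.

Lemma sum_pick (t : L -> L) b : b \in Phi ->
  \sum_(a <- Phi) (a == b)%:R *: t a = t b.
Proof.
move=> bP; rewrite (bigD1_seq b) ?uniqPhi //= eqxx scale1r big1 ?addr0 // => a ab.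
by rewrite (negPf ab) scale0r.
Qed.

Lemma chev_decomp x : exists2 d, d \in <<Delta>>%VS &
  exists t, x = d + \sum_(a <- Phi) t a *: e a.
Proof.
have: x \in fullv by apply: memvf.
rewrite -(span_basis (chev_basis chev)) span_cat => /memv_addP[d dD [u uE ->]].
exists d => //; suff [t ->] : exists t, u = \sum_(a <- Phi) t a *: e a by exists t.
apply: (span_ind (P := fun u => exists t, u = \sum_(a <- Phi) t a *: e a) _ _ _ uE).
- by exists (fun _ => 0); rewrite big1 // => a _; rewrite scale0r.
- move=> a _ _ [t1 ->] [t2 ->]; exists (fun b => a * t1 b + t2 b).
  by rewrite scaler_sumr -big_split; apply: eq_bigr => b _; rewrite scalerDl scalerA.
by move=> _ /mapP[b bP ->]; exists (fun a => (a == b)%:R); rewrite sum_pick.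
Qed.

Lemma lie_spanP (U I : {vspace L}) x y : x \in U -> y \in I -> lie x y \in lie_span U I.
Proof.
move=> xU yI; rewrite (coord_vbasis xU) (bil_suml lB) memv_suml // => i _.
rewrite (bilZl lB) memvZ // (coord_vbasis yI) (bil_sumr lB) memv_suml // => j _.
rewrite (bilZr lB) memvZ // memv_span //; apply/allpairsP.
by exists ((vbasis U)`_i, (vbasis I)`_j); rewrite /= !mem_nth ?size_tuple.
Qed.

(** The part [u] of [x] along the root vectors lies in [H], and a root [b] acts on it diagonally.
    Nilpotency of [H] makes a power of this action vanish on [u], while the eigenvalue on [e b] is
    2, so the coefficient of [e b] is zero. *)
Lemma H_span : H = <<Delta>>%VS.
Proof.
apply/eqP; rewrite eqEsubv andbC; apply/andP; split.
  by apply/span_subvP => a /Delta_sub/root_H.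
apply/subvP => x xH; have [d dD [t xE]] := chev_decomp x.
suff t0 : {in Phi, forall b, t b = 0}.
  rewrite xE big_seq big1 ?addr0 // => b bP; by rewrite t0 // scale0r.
set u := \sum_(a <- Phi) _ in xE.
have uH : u \in H.
  have -> : u = x - d by rewrite xE addrC addKr.
  rewrite rpredB //; apply: subvP dD; apply/span_subvP => a /Delta_sub/root_H //.
move=> b bP; have [_ [k nil] _] := cartanH.
have: iter k (lie b) u \in iter k (lie_span H) H.
  elim: (k) => [//|m IHm]; rewrite !iterS; apply: lie_spanP => //; exact: root_H.
have -> : iter k (lie b) u = \sum_(a <- Phi) (kap b a ^+ k * t a) *: e a.
  elim: (k) => [|m IHm]; first by apply: eq_bigr => a _; rewrite mul1r.
  rewrite iterS IHm (bil_sumr lB) big_seq [RHS]big_seq; apply: eq_bigr => a aP.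
  by rewrite (bilZr lB) lie_root_e // scalerA exprSr mulrAC.
rewrite nil memv0 => /eqP/e_free/(_ b bP)/eqP; rewrite mulf_eq0 kap_root //.
by rewrite expf_eq0 pnatr_eq0 andbF => /eqP.
Qed.

Lemma H_ind (P : L -> Prop) :
    P 0 -> (forall a x y, P x -> P y -> P (a *: x + y)) ->
    {in Phi, forall a, P a} -> {in H, forall x, P x}.
Proof.
move=> P0 PD Pa x; rewrite H_span; apply: span_ind => // a /Delta_sub; exact: Pa.
Qed.

(* The root vectors provided by [is_root] show that [kap z] vanishes on [Phi];
   by invariance it vanishes on the vectors [e a] as well. *)
Lemma root_comm a b : a \in Phi -> b \in Phi -> lie a b = 0.
Proof.
move=> aP bP; apply: kap_nondeg; set z := lie a b.
have zH : z \in H by case: cartanH => + _ _; apply; apply: root_H.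
have ze d : d \in Phi -> lie z (e d) = 0.
  move=> dP; rewrite lie_lie !lie_root_e // !(bilZr lB) !lie_root_e //.
  by rewrite !scalerA mulrC subrr.
apply: chev_ind => [|t x y x0 y0|d dP|d dP].
- by rewrite (form0r kB).
- by rewrite (formPr kB) x0 y0 mulr0 addr0.
- have /rootP[dH _ [x x0 xE]] := dP; apply/eqP.
  have : kap d z *: x = 0.
    rewrite -xE // lie_lie !xE ?root_H // !(bilZr lB) !xE ?root_H //.
    by rewrite !scalerA mulrC subrr.
  by move=> /eqP; rewrite scaler_eq0 (negPf x0) orbF kapC.
have : kap z (lie d (e d)) = 0.
  by rewrite kapC kap_inv lieC (formNr kB) opprK kapC kap_inv ze // (form0r kB) oppr0.
rewrite lie_root_e // (formZr kB) kap_root // => /eqP.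
by rewrite mulf_eq0 pnatr_eq0 => /eqP.
Qed.

Lemma H_comm : {in H &, forall h k, lie h k = 0}.
Proof.
move=> h k hH kH; move: h hH; apply: H_ind => [|t x y x0 y0|a aP].
- by rewrite (bil0l lB).
- by rewrite (bilPl lB) x0 y0 scaler0 addr0.
move: k kH; apply: H_ind => [|t x y x0 y0|b bP].
- by rewrite (bil0r lB).
- by rewrite (bilPr lB) x0 y0 scaler0 addr0.
exact: root_comm.
Qed.

Lemma H_e h a : h \in H -> a \in Phi -> lie h (e a) = kap a h *: e a.
Proof.
move=> hH aP; move: h hH; apply: H_ind => [|t x y xE yE|b bP].
- by rewrite (bil0l lB) (form0r kB) scale0r.
- by rewrite (bilPl lB) xE yE (formPr kB) scalerDl scalerA.
by rewrite lie_root_e // kapC.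
Qed.

Lemma kap_He h a : h \in H -> a \in Phi -> kap h (e a) = 0.
Proof.
move=> hH aP; have : kap h (lie a (e a)) = 0.
  by rewrite kapC kap_inv H_comm ?(form0r kB) ?oppr0 // root_H.
rewrite lie_root_e // (formZr kB) kap_root // => /eqP.
by rewrite mulf_eq0 pnatr_eq0 => /eqP.
Qed.

Lemma kapH_nondeg h : h \in H -> (forall a, a \in Phi -> kap a h = 0) -> h = 0.
Proof.
move=> hH h0; apply: kap_nondeg; apply: chev_ind => [|t x y x0 y0|a aP|a aP].
- by rewrite (form0r kB).
- by rewrite (formPr kB) x0 y0 mulr0 addr0.
- by rewrite kapC h0.
exact: kap_He.
Qed.

Lemma kap_ee a b : a \in Phi -> b \in Phi -> a + b != 0 -> kap (e a) (e b) = 0.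
Proof.
move=> aP bP ab0; apply/eqP; apply: contraNT ab0 => eab; apply/eqP.
apply: kapH_nondeg => [|d dP]; first by rewrite memvD // root_H.
have : kap (lie d (e a)) (e b) + kap (e a) (lie d (e b)) = 0.
  by rewrite kap_inv addrC subrr.
rewrite !lie_root_e // (formZl kB) (formZr kB) -mulrDl => /eqP.
by rewrite mulf_eq0 (negPf eab) orbF (formDr kB) => /eqP.
Qed.

Lemma e_neq0 a : a \in Phi -> e a != 0.
Proof.
move=> aP; apply: (basis_not0 (chev_basis chev)).
by rewrite mem_cat map_f ?orbT.
Qed.

(** Otherwise [e a] would pair to zero with every vector of the Chevalley basis. *)
Lemma rootN a : a \in Phi -> - a \in Phi.
Proof.
move=> aP; apply/negPn/negP => naP; have /negP := e_neq0 aP; apply; apply/eqP.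
apply: kap_nondeg; apply: chev_ind => [|t x y x0 y0|b bP|b bP].
- by rewrite (form0r kB).
- by rewrite (formPr kB) x0 y0 mulr0 addr0.
- by rewrite kapC kap_He // root_H.
apply: kap_ee => //; apply: contra naP; rewrite addrC addr_eq0 => /eqP bE.
by rewrite -bE.
Qed.

Lemma kap_eN a : a \in Phi -> kap (e a) (e (- a)) = 1.
Proof.
move=> aP; have two0 : 2 != 0 :> F by rewrite pnatr_eq0.
have := kap_root aP; rewrite -{1}(lie_e_opp aP) kap_inv lieC lie_root_e //.
rewrite (formNr kB) opprK (formZr kB) kap_root // kapC => h.
by apply: (mulfI two0); rewrite h mulr1.
Qed.

(** The two adjoint maps are diagonal in the Chevalley basis; [m] lists the eigenvalues of their
    composite, which are zero on [Delta]. *)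
Lemma killing_H : {in H &, forall h k,
  killing h k = \sum_(a <- Phi) kap a h * kap a k}.
Proof.
move=> h k hH kH; pose X := in_tuple (Delta ++ [seq e a | a <- Phi]).
pose m := [seq (0 : F) | a <- Delta] ++ [seq kap a h * kap a k | a <- Phi].
have DH d : d \in Delta -> d \in H by move=> /Delta_sub/root_H.
have sm : size m = size X by rewrite !size_cat !size_map.
have XE (i : 'I_(size X)) : lie h (lie k X`_i) = m`_i *: X`_i.
  rewrite /m !nth_cat size_map; case: ltnP => iD.
    rewrite (nth_map 0) // scale0r (H_comm kH) ?(bil0r lB) //.
    exact/DH/mem_nth.
  have iP : (i - size Delta < size Phi)%N.
    by rewrite ltn_subLR //; move: (ltn_ord i); rewrite [X in (_ < X)%N]size_cat size_map.
  rewrite !(nth_map 0) //; have aP := mem_nth 0 iP.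
  by rewrite H_e // (bilZr lB) H_e // scalerA mulrC.
have bX : basis_of {:L} X := chev_basis chev.
rewrite /killing (lftrace_basis _ bX).
transitivity (\sum_(i < size X) m`_i).
  apply: eq_bigr => i _; rewrite comp_lfunE !adE XE linearZ /=.
  by rewrite coord_free ?(basis_free bX) // eqxx mulr1.
transitivity (\sum_(x <- m) x); first by rewrite [RHS](big_nth 0) big_mkord sm.
by rewrite big_cat !big_map big1 //= add0r.
Qed.

Lemma kap_Phi : exists c0 : F, {in H &, forall h k,
  kap h k = c0 * \sum_(a <- Phi) kap a h * kap a k}.
Proof.
by case: kapK => -[c0 kE] _; exists c0 => h k hH kH; rewrite kE killing_H.
Qed.

(** The base [D] that comes with the type need not be [Delta]. Its Cartan matrix has integer
    entries, and roots are integer combinations of [D]. *)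
Lemma kap_int a b : a \in Phi -> b \in Phi -> exists z : int, kap a b = z%:~R.
Proof.
have [D [freeD subD ncD] DT] := PhiT.
have Dint (i j : 'I_(size D)) : exists z : int, kap D`_i D`_j = z%:~R.
  move: i j; rewrite [size _]size_tuple => i j; exists (cartan_matrix T i j).
  by rewrite -DT !(tnth_nth 0) (coroot_id kapK) //; apply/rootP/subD/mem_nth; rewrite size_tuple.
have intD (x y : F) : (exists z : int, x = z%:~R) -> (exists z : int, y = z%:~R) ->
    exists z : int, x + y = z%:~R.
  by move=> [z1 ->] [z2 ->]; exists (z1 + z2); rewrite intrD.
have intsum n (f : 'I_n -> F) : (forall i, exists z : int, f i = z%:~R) ->
    exists z : int, \sum_i f i = z%:~R.
  move=> fz; apply: (big_ind (fun x => exists z : int, x = z%:~R)) => //.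
  by exists 0.
have intM n (x : F) : (exists z : int, x = z%:~R) -> exists z : int, x *+ n = z%:~R.
  by move=> [z ->]; exists (z * n%:Z); rewrite intrM -pmulrn mulr_natr.
have nc (x y : L) : nat_comb D x -> nat_comb D y -> exists z : int, kap x y = z%:~R.
  move=> [m ->] [n ->]; rewrite (form_suml kB); apply/intsum => i.
  rewrite (form_sumr kB); apply: intsum => j.
  by rewrite -!scaler_nat (formZl kB) (formZr kB) mulrA mulrC -natrM mulr_natr; apply: intM.
have intN (x : F) : (exists z : int, - x = z%:~R) -> exists z : int, x = z%:~R.
  by move=> [z zE]; exists (- z); rewrite mulrNz -zE opprK.
move=> /ncD aP /ncD bP; case: aP bP => aP [bP|bP].
- exact: nc.
- by apply: intN; rewrite -(formNr kB); apply: nc.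
- by apply: intN; rewrite -(formNl kB); apply: nc.
- by rewrite -[kap a b]opprK -(formNr kB) -(formNl kB); apply: nc.
Qed.

(** At [omega] the trace formula says that 2 is [c0] times a sum of squares of integers, which fixes
    the sign of [c0]. *)
Lemma kap_Phi_pos : exists2 c0 : F, 0 < c0 & {in H &, forall h k,
  kap h k = c0 * \sum_(a <- Phi) kap a h * kap a k}.
Proof.
have [c0 kE] := kap_Phi; exists c0 => //.
have := kap_root omega_root; rewrite kE ?root_H ?omega_root //.
set s := \sum_(a <- Phi) _ => cs.
have s0 : 0 <= s.
  rewrite /s big_seq sumr_ge0 // => a aP.
  have [z ->] := kap_int aP omega_root.
  by rewrite -intrM ler0z -expr2 sqr_ge0.
have sn0 : s != 0.
  by apply/eqP => sE; move/eqP: cs; rewrite sE mulr0 eq_sym pnatr_eq0.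
have sp : 0 < s by rewrite lt_def sn0.
by rewrite -(pmulr_lgt0 _ sp) cs ltr0n.
Qed.

(* Positivity of [kap] on the root lattice comes from the trace formula. *)
Lemma root_cases a b : a \in Phi -> b \in Phi ->
  a = b \/ b = - a \/ kap a b = 1 \/ kap a b = 0 \/ kap a b = -1.
Proof.
move=> aP bP; have [c0 c0gt0 kE] := kap_Phi_pos.
have pos x y : x \in Phi -> y \in Phi -> 0 <= kap (x + y) (x + y) /\
    (kap (x + y) (x + y) = 0 -> x + y = 0).
  move=> xP yP; have xyH : x + y \in H by rewrite memvD // root_H.
  have sq d : d \in Phi -> 0 <= kap d (x + y) * kap d (x + y).
    move=> dP; rewrite (formDr kB).
    have [z1 ->] := kap_int dP xP; have [z2 ->] := kap_int dP yP.
    by rewrite -intrD -intrM ler0z -expr2 sqr_ge0.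
  rewrite kE //; split.
    by apply: mulr_ge0; [apply: ltW|rewrite big_seq sumr_ge0].
  move=> /eqP; rewrite mulf_eq0 gt_eqF //= big_seq psumr_eq0 // => /allP s0.
  apply: kapH_nondeg => // d dP; have := s0 d dP.
  by rewrite dP /= mulf_eq0 orbb => /eqP.
have kD x y : x \in Phi -> y \in Phi -> kap (x + y) (x + y) = 4 + 2 * kap x y.
  move=> xP yP; rewrite !(formE kB) !kap_root // [kap y x]kapC; ring.
have [z zE] := kap_int aP bP.
have [] := pos a b aP bP; rewrite kD // zE => h1 e1.
have [] := pos a (- b) aP (rootN bP); rewrite kD ?rootN // (formNr kB) zE => h2 e2.
have zl : (-2 <= z)%R.
  rewrite -(ler_int F) -subr_ge0 -(pmulr_rge0 _ (ltr0n F 2)).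
  by rewrite (_ : _ * _ = 4 + 2 * z%:~R) //; ring.
have zu : (z <= 2)%R.
  rewrite -(ler_int F) -subr_ge0 -(pmulr_rge0 _ (ltr0n F 2)).
  by rewrite (_ : _ * _ = 4 + 2 * - z%:~R) //; ring.
have : z \in [:: 2; 1; 0; -1; -2].
  move: zl zu {zE h1 e1 h2 e2}; case: z => [[|[|[|?]]]|[|[|?]]] //=.
rewrite !inE => /or4P[/eqP zz|/eqP zz|/eqP zz|/orP[/eqP zz|/eqP zz]].
- by left; apply/eqP; rewrite -subr_eq0; apply/eqP/e2; rewrite zz; ring.
- by right; right; left; rewrite zz.
- by right; right; right; left; rewrite zz.
- by right; right; right; right; rewrite zz.
- right; left; apply/eqP; rewrite -addr_eq0 addrC; apply/eqP/e1; rewrite zz; ring.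
Qed.

Lemma root_vec x y : x \in H -> x != 0 -> y != 0 ->
  {in H, forall h, lie h y = kap x h *: y} -> x \in Phi.
Proof. by move=> xH x0 y0 yE; apply/rootP; split=> //; exists y. Qed.

Lemma lie_ee_vec a b h : a \in Phi -> b \in Phi -> h \in H ->
  lie h (lie (e a) (e b)) = kap (a + b) h *: lie (e a) (e b).
Proof.
move=> aP bP hH; have /eqP := lie_lie h (e a) (e b); rewrite eq_sym subr_eq => /eqP ->.
by rewrite (H_e hH aP) (H_e hH bP) (bilZl lB) (bilZr lB) -scalerDl (formDl kB).
Qed.

(** If the bracket of [e a] and [e b] is nonzero, it is a weight vector for [a + b]. If it is zero,
    then the bracket of [e (- a)] and [e b] is not, since [lie (e a) (e (- a)) = a] acts on [e b] by
    -1; so [b - a] would be a root, but its square length is 6 instead of 2. *)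
Lemma rootD a b : a \in Phi -> b \in Phi -> kap a b = -1 -> a + b \in Phi.
Proof.
move=> aP bP ab.
have abH x y : x \in Phi -> y \in Phi -> x + y \in H by move=> xP yP; rewrite memvD // root_H.
have ab0 : a + b != 0.
  rewrite addr_eq0; apply/eqP => aE; move/eqP: ab; rewrite aE (formNl kB) kap_root //.
  by rewrite eqr_opp (eqr_nat F 2 1).
have [ab_e|ab_e] := eqVneq (lie (e a) (e b)) 0; last first.
  by apply: (root_vec _ ab0 ab_e) => [|h hH]; [apply: abH|apply: lie_ee_vec].
have aNP := rootN aP.
have f0 : lie (e (- a)) (e b) != 0.
  apply/eqP => f0; have := lie_lie (e a) (e (- a)) (e b).
  rewrite ab_e f0 !(bil0r lB) subrr lie_e_opp // H_e ?root_H // kapC ab => /eqP.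
  by rewrite scaler_eq0 oppr_eq0 oner_eq0 (negPf (e_neq0 bP)).
have ba0 : - a + b != 0.
  rewrite addrC subr_eq0; apply/eqP => aE; move/eqP: ab; rewrite aE kap_root //.
  by rewrite -addr_eq0 -(natrD F 2 1) pnatr_eq0.
have /kap_root : - a + b \in Phi.
  by apply: (root_vec _ ba0 f0) => [|h hH]; [apply: abH|apply: lie_ee_vec].
rewrite !(formE kB) !kap_root // [kap b a]kapC ab => /eqP.
rewrite -subr_eq0 (_ : _ - _ = 4%:R); last by ring.
by rewrite pnatr_eq0.
Qed.

Lemma rootB a b : a \in Phi -> b \in Phi -> kap a b = 1 -> a - b \in Phi.
Proof. by move=> aP bP ab; apply: rootD => //; rewrite ?rootN // (formNr kB) ab. Qed.

Lemma rootD_kap a b : a \in Phi -> b \in Phi -> a + b \in Phi -> kap a b = -1.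
Proof.
move=> aP bP /kap_root; rewrite !(formE kB) !kap_root // [kap b a]kapC => h.
have two0 : 2 != 0 :> F by rewrite pnatr_eq0.
by apply: (mulfI two0); apply: (addrI 4); transitivity (2 : F); [rewrite -[RHS]h|]; ring.
Qed.

Lemma lie_ee0 a b : a \in Phi -> b \in Phi -> a + b != 0 -> a + b \notin Phi ->
  lie (e a) (e b) = 0.
Proof.
move=> aP bP ab0 abP; apply/eqP; apply: contraR abP => ee0.
apply: (root_vec _ ab0 ee0) => [|h hH]; first by rewrite memvD // root_H.
exact: lie_ee_vec.
Qed.

Lemma lie_ee a b : a \in Phi -> b \in Phi -> kap a b = -1 ->
  exists2 s, s != 0 & lie (e a) (e b) = s *: e (a + b).
Proof.
move=> aP bP ab; exists (c a b); last exact: (chev_add chev) (rootD _ _ _).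
case: (chev_sign chev aP bP (rootD aP bP ab)) => ->; rewrite ?oppr_eq0 oner_eq0 //.
Qed.

Lemma lie_ee_ge0 a b : a \in Phi -> b \in Phi -> 0 <= kap a b -> lie (e a) (e b) = 0.
Proof.
move=> aP bP ab; apply: lie_ee0 => //.
  apply/eqP => /eqP; rewrite addr_eq0 => /eqP aE; move: ab.
  by rewrite aE (formNl kB) kap_root // oppr_ge0 lern0.
by apply/negP => /(rootD_kap aP bP) abE; move: ab; rewrite abE oppr_ge0 ler10.
Qed.

(** Applying [e a] twice shifts weights by [2a]. Among the root vectors only [e (- a)] survives,
    where the [sl_2] relations give the factor -2; on [H] the first step already lands in the line
    of [e a]. *)
Lemma extremal a x : a \in Phi -> lie (e a) (lie (e a) x) = (-2 * kap (e a) x) *: e a.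
Proof.
move=> aP; move: x; apply: chev_ind => [|t x y xE yE|b bP|b bP].
- by rewrite !(bil0r lB) (form0r kB) mulr0 scale0r.
- rewrite !(bilPr lB) xE yE (formPr kB) scalerA -scalerDl; congr (_ *: _); ring.
- rewrite kapC kap_He ?root_H // mulr0 scale0r [lie (e a) b]lieC (bilNr lB).
  by rewrite H_e ?root_H // (bilZr lB) lie_alt scaler0 oppr0.
have [<-|[bE|]] := root_cases aP bP.
- rewrite lie_alt (bil0r lB) kap_ee ?mulr0 ?scale0r //.
  by rewrite -mulr2n -scaler_nat scaler_eq0 pnatr_eq0 root_neq0.
- rewrite bE lie_e_opp // kap_eN // mulr1 lieC H_e ?root_H // kap_root //.
  by rewrite scaleNr.
move=> ab; have ab0 : a + b != 0.
  apply/eqP => /eqP; rewrite addr_eq0 => /eqP aE; move: ab.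
  rewrite aE (formNl kB) kap_root // => -[|[|]] /eqP.
  - by rewrite -subr_eq0 -opprD oppr_eq0 -(natrD F 2 1) pnatr_eq0.
  - by rewrite oppr_eq0 pnatr_eq0.
  - by rewrite eqr_opp (eqr_nat F 2 1).
rewrite kap_ee // mulr0 scale0r.
case: ab => [ab|[ab|ab]]; try by rewrite [lie _ (e b)]lie_ee_ge0 ?ab ?ler01 ?(bil0r lB).
have [s _ ->] := lie_ee aP bP ab; rewrite (bilZr lB) lie_ee_ge0 ?scaler0 //.
  exact: rootD.
by rewrite (formDr kB) kap_root // ab -natr1 addrK ler01.
Qed.

(** Distance at most two in the graph on [Phi] that joins non-orthogonal roots (take [g = a] for
    neighbours). [linked_step] shows that longer chains can always be shortened to this length. *)
Definition linked (a b : L) : bool :=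
  has (fun g => (kap a g != 0) && (kap g b != 0)) Phi.

Lemma linkedP a b :
  reflect (exists g, [/\ g \in Phi, kap a g != 0 & kap g b != 0]) (linked a b).
Proof.
apply: (iffP hasP) => [[g gP /andP[ag gb]]|[g [gP ag gb]]]; first by exists g.
by exists g => //; rewrite ag.
Qed.

Lemma kap_root_neq0 a : a \in Phi -> kap a a != 0.
Proof. by move=> aP; rewrite kap_root // pnatr_eq0. Qed.

(* If [a - g - b - d] is a chain without shortcut then [g + b] or [g - b] is a
   root linked to both ends. *)
Lemma linked_step a b d : a \in Phi -> b \in Phi -> d \in Phi ->
  linked a b -> kap b d != 0 -> linked a d.
Proof.
move=> aP bP dP /linkedP[g [gP ag gb]] bd; apply/linkedP.
have [ab|ab] := eqVneq (kap a b) 0; last by exists b.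
have [gd|gd] := eqVneq (kap g d) 0; last by exists g.
have bg : kap b g != 0 by rewrite kapC.
have [bE|[gE|[bg1|[bg0|bg1]]]] := root_cases bP gP.
- by rewrite bE gd eqxx in bd.
- by rewrite -[b]opprK -gE (formNl kB) gd oppr0 eqxx in bd.
- exists (g - b); split; first by apply: rootB; rewrite // kapC.
    by rewrite (formBr kB) ab subr0.
  by rewrite (formBl kB) gd sub0r oppr_eq0.
- by rewrite bg0 eqxx in bg.
- exists (g + b); split; first by apply: rootD; rewrite // kapC.
    by rewrite (formDr kB) ab addr0.
  by rewrite (formDl kB) gd add0r.
Qed.

(** The roots linked to [a], together with their root vectors, span an ideal, which is [L] by
    simplicity. If [d] were not linked to [a], this ideal would be orthogonal to [e (- d)], although
    [e d] is not. *)
Lemma roots_linked a d : a \in Phi -> d \in Phi -> linked a d.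
Proof.
move=> aP dP; pose C := [seq b <- Phi | linked a b].
have CP b : (b \in C) = linked a b && (b \in Phi) by rewrite mem_filter.
have aC : a \in C.
  by rewrite CP aP andbT; apply/linkedP; exists a; rewrite !kap_root_neq0.
have Cstep b b' : b \in C -> b' \in Phi -> kap b b' != 0 -> b' \in C.
  by rewrite !CP => /andP[ab bP] b'P bb'; rewrite b'P (linked_step aP bP).
pose I := <<C ++ [seq e b | b <- C]>>%VS.
have CI b : b \in C -> b \in I by move=> bC; rewrite memv_span // mem_cat bC.
have eI b : b \in C -> e b \in I.
  by move=> bC; rewrite memv_span // mem_cat map_f ?orbT.
have ideal x y : y \in I -> lie x y \in I.
  move=> yI; move: y yI; apply: span_ind => [|t y z yE zE|y].
  - by rewrite (bil0r lB) mem0v.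
  - by rewrite (bilPr lB) memvD ?memvZ.
  move=> yC; move: x; apply: chev_ind => [|t x z xE zE|r rP|r rP].
  - by rewrite (bil0l lB) mem0v.
  - by rewrite (bilPl lB) memvD ?memvZ.
  - move: yC; rewrite mem_cat => /orP[|/mapP[b]]; rewrite ?CP => /andP[ab bP].
      by rewrite root_comm // mem0v.
    by move=> ->; rewrite lie_root_e // memvZ // eI // CP ab.
  - move: yC; rewrite mem_cat => /orP[bC|/mapP[b bC ->]].
      have bP : y \in Phi by move: bC; rewrite CP => /andP[].
      rewrite lieC memvN lie_root_e //; have [->|br] := eqVneq (kap y r) 0.
        by rewrite scale0r mem0v.
      by rewrite memvZ // eI // (Cstep y).
    have bP : b \in Phi by move: bC; rewrite CP => /andP[].
    have [->|[bE|rb]] := root_cases rP bP; first by rewrite lie_alt mem0v.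
      rewrite {1}bE lie_e_opp // CI // (Cstep b) // bE (formNl kB) oppr_eq0; exact: kap_root_neq0.
    have [rb0|rb1] : 0 <= kap r b \/ kap r b = -1.
      by case: rb => [->|[->|->]]; [left; rewrite ler01|left|right].
      by rewrite lie_ee_ge0 // mem0v.
    have [s _ ->] := lie_ee rP bP rb1; rewrite memvZ // eI // (Cstep b) ?rootD //.
    by rewrite (formDr kB) kapC rb1 kap_root // addrC -[X in X - 1]/(1 + 1) addrK oner_eq0.
have [_ /(_ I ideal)[I0|If]] := simpleL.
  by have := eI a aC; rewrite I0 memv0 (negPf (e_neq0 aP)).
apply/negPn/negP => ad; have : e d \in I by rewrite If memvf.
suff h : {in I, forall x, kap x (e (- d)) = 0}.
  by move=> /h; rewrite kap_eN // => /eqP; rewrite oner_eq0.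
apply: span_ind => [|t x y x0 y0|x].
- by rewrite (form0l kB).
- by rewrite (formPl kB) x0 y0 mulr0 addr0.
rewrite mem_cat => /orP[|/mapP[b]]; rewrite CP => /andP[ab bP].
  by rewrite kap_He ?rootN ?root_H.
move=> ->; apply: kap_ee => //; first exact: rootN.
by rewrite subr_eq0; apply: contraNneq ad => <-.
Qed.

(** The middle root of a link, with its sign chosen so that [a + g] is a root; this is what lets
    orthogonal pairs be polarized in [smul_HSJ]. *)
Lemma orth_link a b : a \in Phi -> b \in Phi -> kap a b = 0 ->
  exists g, [/\ g \in Phi, kap a g = -1 & kap g b = 1 \/ kap g b = -1].
Proof.
move=> aP bP ab; have /linkedP[g [gP ag gb]] := roots_linked aP bP.
have gb1 : kap g b = 1 \/ kap g b = -1.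
  have [gE|[gE|[->|[g0|->]]]] := root_cases gP bP; [| |by left| |by right].
  - by rewrite gE ab eqxx in ag.
  - by move: ag; rewrite -[g]opprK -gE (formNr kB) ab oppr0 eqxx.
  - by rewrite g0 eqxx in gb.
have [gE|[gE|[ag1|[a0|ag1]]]] := root_cases aP gP.
- by rewrite -gE ab eqxx in gb.
- by rewrite gE (formNl kB) ab oppr0 eqxx in gb.
- exists (- g); rewrite rootN // (formNr kB) ag1 (formNl kB); split=> //.
  by case: gb1 => ->; [right|left; rewrite opprK].
- by rewrite a0 eqxx in ag.
- by exists g.
Qed.

(** * The Chevalley involution and the compact real form *)

Local Notation S := (symsq L).
Local Notation act := (@s2act F L).
Local Notation mul := (@s2mul F L kap).
Local Notation B := (@s2form F L kap).
Let sB := smul_bilinear L.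
Let aB := s2act_bilinear L.
Let mB := s2mul_bilinear kap.
Let bB := s2form_bilinear kap.

Section ChevalleyInvolution.
Variable g : {rmorphism F -> F}.

Definition chevX := in_tuple (Delta ++ [seq e a | a <- Phi]).

(* The [g]-semilinear map sending [h_a] to [- h_a] and [e a] to [- e (- a)]; [g]
   will be the identity or the complex conjugation. *)
Definition cinv (x : L) : L :=
  \sum_(i < size chevX) g (coord chevX i x) *:
     ([seq - d | d <- Delta] ++ [seq - e (- a) | a <- Phi])`_i.

Lemma cinvP a x y : cinv (a *: x + y) = g a *: cinv x + cinv y.
Proof.
rewrite /cinv scaler_sumr -big_split; apply: eq_bigr => i _ /=.
by rewrite linearP rmorphD rmorphM scalerDl scalerA.
Qed.

Lemma cinv0 : cinv 0 = 0.
Proof. by have := cinvP (-1) 0 0; rewrite scaler0 addr0 rmorphN1 scaleN1r addNr. Qed.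

Lemma cinvZ a x : cinv (a *: x) = g a *: cinv x.
Proof. by rewrite -[a *: x]addr0 cinvP cinv0 addr0. Qed.

Lemma cinvD x y : cinv (x + y) = cinv x + cinv y.
Proof. by rewrite -[x]scale1r cinvP rmorph1 !scale1r. Qed.

Lemma cinvN x : cinv (- x) = - cinv x.
Proof. by rewrite -scaleN1r cinvZ rmorphN1 scaleN1r. Qed.

Lemma cinv_sum I (r : seq I) (P : pred I) (f : I -> L) :
  cinv (\sum_(i <- r | P i) f i) = \sum_(i <- r | P i) cinv (f i).
Proof. by apply: (big_morph cinv) => [x y|]; rewrite ?cinvD ?cinv0. Qed.

Lemma cinvX (i : 'I_(size chevX)) : cinv chevX`_i =
  ([seq - d | d <- Delta] ++ [seq - e (- a) | a <- Phi])`_i.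
Proof.
rewrite /cinv (bigD1 i) //= big1 ?addr0 => [|j ji].
  by rewrite coord_free ?eqxx ?rmorph1 ?scale1r // (basis_free (chev_basis chev)).
rewrite coord_free ?(basis_free (chev_basis chev)) // eq_sym (negPf ji).
by rewrite rmorph0 scale0r.
Qed.

Lemma cinv_e a : a \in Phi -> cinv (e a) = - e (- a).
Proof.
move=> aP; have ilt : (size Delta + index a Phi < size chevX)%N.
  by rewrite size_cat size_map ltn_add2l index_mem.
have := cinvX (Ordinal ilt); rewrite /= !nth_cat !size_map ltnNge leq_addr /= addKn.
by rewrite !(nth_map 0) ?index_mem // nth_index.
Qed.

Lemma cinv_Delta d : d \in Delta -> cinv d = - d.
Proof.
move=> dD; have ilt : (index d Delta < size chevX)%N.
  by rewrite size_cat ltn_addr ?index_mem.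
have := cinvX (Ordinal ilt); rewrite /= !nth_cat !size_map index_mem dD.
by rewrite !(nth_map 0) ?index_mem // nth_index.
Qed.

Lemma cinv_root a : a \in Phi -> cinv a = - a.
Proof.
have nc v : nat_comb Delta v -> cinv v = - v.
  move=> [m ->]; rewrite cinv_sum -sumrN; apply: eq_bigr => i _.
  by rewrite -scaler_nat cinvZ rmorph_nat cinv_Delta ?mem_nth // scalerN.
have [_ _ ncD] := DeltaB; move=> /ncD[/nc //|/nc aE].
by apply: oppr_inj; rewrite -cinvN.
Qed.

Lemma g_kap a b : a \in Phi -> b \in Phi -> g (kap a b) = kap a b.
Proof. by move=> aP bP; have [z ->] := kap_int aP bP; rewrite rmorph_int. Qed.

Lemma cinvK : involutive g -> involutive cinv.
Proof.
move=> gK; apply: chev_ind => [|t x y xE yE|a aP|a aP].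
- by rewrite !cinv0.
- by rewrite !cinvP gK xE yE.
- by rewrite (cinv_root aP) cinvN (cinv_root aP) opprK.
- by rewrite (cinv_e aP) cinvN (cinv_e (rootN aP)) !opprK.
Qed.

Lemma kap_cinv x y : kap (cinv x) (cinv y) = g (kap x y).
Proof.
move: x y; apply: chev_ind => [y|t x1 x2 x1E x2E y|a aP|a aP].
- by rewrite cinv0 !(form0l kB) rmorph0.
- by rewrite cinvP !(formPl kB) x1E x2E rmorphD rmorphM.
- apply: chev_ind => [|t y1 y2 y1E y2E|b bP|b bP].
  + by rewrite cinv0 !(form0r kB) rmorph0.
  + by rewrite cinvP !(formPr kB) y1E y2E rmorphD rmorphM.
  + by rewrite (cinv_root aP) (cinv_root bP) (formNl kB) (formNr kB) opprK g_kap.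
  + rewrite (cinv_root aP) (cinv_e bP) (formNl kB) (formNr kB) opprK.
    by rewrite !kap_He ?rootN ?root_H // rmorph0.
- apply: chev_ind => [|t y1 y2 y1E y2E|b bP|b bP].
  + by rewrite cinv0 !(form0r kB) rmorph0.
  + by rewrite cinvP !(formPr kB) y1E y2E rmorphD rmorphM.
  + rewrite (cinv_root bP) (cinv_e aP) (formNl kB) (formNr kB) opprK.
    by rewrite ![kap (e _) _]kapC !kap_He ?rootN ?root_H // rmorph0.
  rewrite (cinv_e aP) (cinv_e bP) (formNl kB) (formNr kB) opprK.
  have [ab|ab] := eqVneq (a + b) 0.
    have -> : b = - a by apply/eqP; rewrite -addr_eq0 addrC ab.
    by rewrite opprK kapC kap_eN // rmorph1.
  by rewrite !kap_ee ?rootN ?rmorph0 // -opprD oppr_eq0.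
Qed.

(** Checked on pairs of basis vectors. For two root vectors whose roots add up to a root, the
    relation [c a b = - c (- a) (- b)] compensates the extra sign of [e a -> - e (- a)]. *)
Lemma cinv_lie x y : cinv (lie x y) = lie (cinv x) (cinv y).
Proof.
have ae a b : a \in Phi -> b \in Phi -> cinv (lie a (e b)) = lie (cinv a) (cinv (e b)).
  move=> aP bP; rewrite lie_root_e // cinvZ (cinv_root aP) (cinv_e bP) g_kap //.
  rewrite (bilNl lB) (bilNr lB) opprK H_e ?root_H ?rootN //.
  by rewrite (formNl kB) scaleNr kapC scalerN.
move: x y; apply: chev_ind => [y|t x1 x2 x1E x2E y|a aP|a aP].
- by rewrite (bil0l lB) cinv0 (bil0l lB).
- by rewrite (bilPl lB) !cinvP (bilPl lB) x1E x2E.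
- apply: chev_ind => [|t y1 y2 y1E y2E|b bP|b bP].
  + by rewrite (bil0r lB) cinv0 (bil0r lB).
  + by rewrite (bilPr lB) !cinvP (bilPr lB) y1E y2E.
  + by rewrite root_comm // cinv0 (cinv_root aP) (cinv_root bP) H_comm // memvN root_H.
  + exact: ae.
- apply: chev_ind => [|t y1 y2 y1E y2E|b bP|b bP].
  + by rewrite (bil0r lB) cinv0 (bil0r lB).
  + by rewrite (bilPr lB) !cinvP (bilPr lB) y1E y2E.
  + by rewrite lieC cinvN ae // lieC opprK.
  rewrite (cinv_e aP) (cinv_e bP) (bilNl lB) (bilNr lB) opprK.
  have naP := rootN aP; have nbP := rootN bP.
  have nk : kap (- a) (- b) = kap a b by rewrite (formNl kB) (formNr kB) opprK.
  have [<-|[->|ab]] := root_cases aP bP; first by rewrite !lie_alt cinv0.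
    by rewrite (lie_e_opp naP) lie_e_opp // cinv_root.
  have [ab0|ab1] : 0 <= kap a b \/ kap a b = -1.
    by case: ab => [->|[->|->]]; [left; rewrite ler01|left|right].
  - by rewrite !lie_ee_ge0 ?nk // cinv0.
  have abP := rootD aP bP ab1; have nabP := rootD naP nbP; rewrite nk in nabP.
  rewrite !(chev_add chev) ?nabP // cinvZ cinv_e // opprD.
  rewrite (chev_symm chev) ?rmorphN //.
  have [->|->] := chev_sign chev naP nbP (nabP ab1).
    by rewrite rmorph1 scaleN1r opprK scale1r.
  by rewrite rmorphN1 opprK scale1r scaleN1r.
Qed.

(** [slift] induces linear maps only; the semilinear map induced by [cinv] has to be written in
    coordinates. *)
Definition cinv2 (s : S) : S :=
  \sum_i \sum_j g (vsval s i j) *: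
    smul (cinv (vbasis {:L})`_i) (cinv (vbasis {:L})`_j).

Lemma cinv2P a s t : cinv2 (a *: s + t) = g a *: cinv2 s + cinv2 t.
Proof.
rewrite /cinv2 scaler_sumr -big_split; apply: eq_bigr => i _ /=.
rewrite scaler_sumr -big_split; apply: eq_bigr => j _ /=.
by rewrite !mxE rmorphD rmorphM scalerDl scalerA.
Qed.

Lemma cinv2_0 : cinv2 0 = 0.
Proof. by have := cinv2P (-1) 0 0; rewrite scaler0 addr0 rmorphN1 scaleN1r addNr. Qed.

Lemma cinv2_smul x y : cinv2 (smul x y) = smul (cinv x) (cinv y).
Proof.
have sE u v : smul (cinv u) (cinv v) = \sum_i \sum_j
    (g (coord (vbasis {:L}) i u) * g (coord (vbasis {:L}) j v)) *:
      smul (cinv (vbasis {:L})`_i) (cinv (vbasis {:L})`_j).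
  rewrite [in LHS](coord_vbasis (memvf u)) cinv_sum (bil_suml sB).
  apply: eq_bigr => i _; rewrite cinvZ (bilZl sB).
  rewrite [in LHS](coord_vbasis (memvf v)) cinv_sum (bil_sumr sB) scaler_sumr.
  by apply: eq_bigr => j _; rewrite cinvZ (bilZr sB) scalerA.
have two0 : 2 != 0 :> F by rewrite pnatr_eq0.
(* The entries of [smul x y] are symmetrized products of coordinates, so they match term by term
   only the sum of the expansions of [smul (cinv x) (cinv y)] in its two orders. *)
apply: (scalerI two0); rewrite [RHS]scaler_nat mulr2n [X in _ = _ + X]smulC !sE.
rewrite -big_split /= scaler_sumr; apply: eq_bigr => i _.
rewrite -big_split /= scaler_sumr; apply: eq_bigr => j _.
rewrite smulE !mxE !big_ord1 !mxE -scalerDl scalerA; congr (_ *: _).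
rewrite rmorphM rmorphD !rmorphM fmorphV rmorph_nat mulrA mulfV // mul1r.
by rewrite [X in _ + X]mulrC.
Qed.

Lemma cinv2_act x s : cinv2 (act x s) = act (cinv x) (cinv2 s).
Proof.
elim/symsq_ind: s => [|a s t sE tE|u v].
- by rewrite cinv2_0 !(bil0r aB) cinv2_0.
- by rewrite cinv2P !(bilPr aB) cinv2P sE tE.
rewrite s2actE cinv2_smul s2actE -[X in X + _]scale1r cinv2P rmorph1 scale1r.
by rewrite !cinv2_smul !cinv_lie.
Qed.

Lemma cinv2_form s t : B (cinv2 s) (cinv2 t) = g (B s t).
Proof.
elim/symsq_ind: s => [|a s1 s2 h1 h2|u v].
- by rewrite cinv2_0 !(form0l bB) rmorph0.
- by rewrite cinv2P !(formPl bB) h1 h2 rmorphD rmorphM.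
elim/symsq_ind: t => [|a s1 s2 h1 h2|z w].
- by rewrite cinv2_0 !(form0r bB) rmorph0.
- by rewrite cinv2P !(formPr bB) h1 h2 rmorphD rmorphM.
rewrite !cinv2_smul !s2formE //; try exact: kapC.
by rewrite !kap_cinv rmorphM rmorphD !rmorphM fmorphV rmorph_nat.
Qed.

Lemma cinv2_mul s t : cinv2 (mul s t) = mul (cinv2 s) (cinv2 t).
Proof.
elim/symsq_ind: s => [|a s1 s2 h1 h2|u v].
- by rewrite cinv2_0 !(bil0l mB) cinv2_0.
- by rewrite cinv2P !(bilPl mB) cinv2P h1 h2.
elim/symsq_ind: t => [|a s1 s2 h1 h2|z w].
- by rewrite cinv2_0 !(bil0r mB) cinv2_0.
- by rewrite cinv2P !(bilPr mB) cinv2P h1 h2.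
have addE x y : cinv2 (x + y) = cinv2 x + cinv2 y.
  by rewrite -[x]scale1r cinv2P rmorph1 !scale1r.
have scaleE k x : cinv2 (k *: x) = g k *: cinv2 x.
  by rewrite -[k *: x]addr0 cinv2P cinv2_0 addr0.
rewrite !cinv2_smul !s2mulE //; try exact: kapC.
by rewrite scaleE !addE !scaleE !cinv2_smul !kap_cinv fmorphV rmorph_nat.
Qed.

Lemma cinv2K : involutive g -> involutive cinv2.
Proof.
move=> gK; elim/symsq_ind => [|a s1 s2 h1 h2|u v]; first by rewrite !cinv2_0.
  by rewrite !cinv2P gK h1 h2.
by rewrite !cinv2_smul !(cinvK gK).
Qed.

End ChevalleyInvolution.

Local Notation conjF := (Num.conj : {rmorphism F -> F}).
Local Notation tau := (cinv conjF).
Local Notation tau2 := (cinv2 conjF).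

Lemma conjF_K : involutive conjF. Proof. exact: conjCK. Qed.

(** Expansion in dual families for [kap]: [e a] is dual to [e (- a)], and the trace formula says
    that the roots, although linearly dependent, resolve the identity of [H] up to the factor
    [c0]. *)
Lemma chev_frame : exists2 c0 : F, 0 < c0 & forall z,
  z = \sum_(a <- Phi) (c0 * kap z a) *: a + \sum_(a <- Phi) kap z (e (- a)) *: e a.
Proof.
have [c0 c0gt0 kE] := kap_Phi_pos; exists c0 => //.
apply: chev_ind => [|t x y xE yE|b bP|b bP].
- by rewrite !big1 ?addr0 // => a _; rewrite (form0l kB) ?mulr0 scale0r.
- rewrite {1}xE {1}yE scalerDr !scaler_sumr addrACA -!big_split /=.
  apply: eq_bigr => a _; rewrite !(formPl kB) !scalerA -!scalerDl.
  by congr (_ *: _ + _); ring.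
- rewrite [X in _ + X]big_seq [X in _ + X]big1 ?addr0 => [|a aP]; last first.
    by rewrite kap_He ?rootN ?root_H // scale0r.
  apply/eqP; rewrite -subr_eq0; apply/eqP/kapH_nondeg => [|d dP].
    apply: memvB; first exact: root_H.
    rewrite big_seq; apply: memv_suml => a aP; by rewrite memvZ // root_H.
  rewrite (formBr kB) (form_sumr kB) kE ?root_H // mulr_sumr -sumrB.
  rewrite big_seq big1 // => a aP.
  by rewrite (formZr kB) ![kap _ a]kapC; ring.
rewrite [X in X + _]big_seq [X in X + _]big1 ?add0r => [|a aP]; last first.
  by rewrite kapC kap_He ?root_H // mulr0 scale0r.
rewrite -[LHS](sum_pick e bP) big_seq [RHS]big_seq; apply: eq_bigr => a aP.
congr (_ *: _); have [->|ab] := eqVneq a b; first by rewrite kap_eN.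
by rewrite kap_ee ?rootN // subr_eq0 eq_sym.
Qed.

(* [L] is a tight frame for the Hermitian form [- kap x (tau y)]. *)
Lemma frame : exists2 fr : seq (F * L), {in fr, forall p, 0 <= p.1} &
  forall z, z = \sum_(p <- fr) (p.1 * - kap z (tau p.2)) *: p.2.
Proof.
have [c0 c0gt0 fE] := chev_frame.
exists ([seq (c0, a) | a <- Phi] ++ [seq (1, e a) | a <- Phi]) => [p|z].
  rewrite mem_cat => /orP[] /mapP[a aP ->] /=; first exact: ltW.
  exact: ler01.
rewrite big_cat !big_map /= {1}(fE z).
congr (_ + _); rewrite big_seq [RHS]big_seq; apply: eq_bigr => a aP.
  by rewrite cinv_root // (formNr kB) opprK.
by rewrite cinv_e // (formNr kB) opprK mul1r.
Qed.

(** The pairwise products of the vectors of a frame of [L] are a frame of the symmetric square; as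
    [B] is symmetrized, the expansion is proved after doubling. *)
Lemma symsq_frame : exists2 fr : seq (F * L), {in fr, forall p, 0 <= p.1} &
  forall t : S, t = \sum_(p <- fr) \sum_(q <- fr)
    (p.1 * q.1 * B t (smul (tau p.2) (tau q.2))) *: smul p.2 q.2.
Proof.
have [fr fr0 frE] := frame; exists fr => //.
apply: symsq_ind => [|a s t sE tE|x y].
- by rewrite big1 // => p _; rewrite big1 // => q _; rewrite (form0l bB) mulr0 scale0r.
- rewrite {1}sE {1}tE scaler_sumr -big_split; apply: eq_bigr => p _ /=.
  rewrite scaler_sumr -big_split; apply: eq_bigr => q _ /=.
  by rewrite scalerA -scalerDl (formPl bB); congr (_ *: _); ring.
have sE u v : smul u v = \sum_(p <- fr) \sum_(q <- fr)
    (p.1 * q.1 * (kap u (tau p.2) * kap v (tau q.2))) *: smul p.2 q.2.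
  rewrite {1}(frE u) (bil_suml sB); apply: eq_bigr => p _.
  rewrite (bilZl sB) {1}(frE v) (bil_sumr sB) scaler_sumr; apply: eq_bigr => q _.
  by rewrite (bilZr sB) scalerA; congr (_ *: _); ring.
have two0 : 2 != 0 :> F by rewrite pnatr_eq0.
apply: (scalerI two0); rewrite [LHS]scaler_nat mulr2n [X in _ + X = _]smulC.
rewrite [X in X + _ = _]sE [X in _ + X = _]sE.
rewrite -big_split scaler_sumr; apply: eq_bigr => p _ /=.
rewrite -big_split scaler_sumr; apply: eq_bigr => q _ /=.
rewrite -scalerDl scalerA; congr (_ *: _).
by rewrite s2formE //; [field|exact: kapC].
Qed.

(** Expanding one copy of [s] in the frame turns [B s (tau2 s)] into a sum of nonnegative multiples
    of squared moduli, those of the coefficients of [s]. If the sum is zero, every term of the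
    expansion of [s] vanishes. *)
Lemma tau2_anisotropic (s : S) : B s (tau2 s) = 0 -> s = 0.
Proof.
have [fr fr0 frE] := symsq_frame.
pose w (x : (F * L) * (F * L)) := x.1.1 * x.2.1 * `|B s (smul (tau x.1.2) (tau x.2.2))| ^+ 2.
have -> : B s (tau2 s) = \sum_(x <- [seq (p, q) | p <- fr, q <- fr]) w x.
  rewrite {1}[s in B s _]frE (form_suml bB) big_allpairs_dep; apply: eq_bigr => p _.
  rewrite (form_suml bB); apply: eq_bigr => q _ /=.
  rewrite (formZl bB) /w /= -[LHS]mulrA; congr (_ * _).
  rewrite -[smul p.2 q.2](cinv2K conjF_K) cinv2_form cinv2_smul normCK.
  by rewrite (s2formC kB kapC s).
move=> /eqP; rewrite big_seq psumr_eq0 => [/allP s0|x]; last first.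
  move=> /allpairsP[[p q] [/= pf qf ->]]; rewrite /w /=.
  by rewrite mulr_ge0 ?exprn_ge0 // mulr_ge0 ?fr0.
rewrite (frE s) big_seq big1 // => p pf; rewrite big_seq big1 // => q qf.
have pqf : (p, q) \in [seq (p, q) | p <- fr, q <- fr] by apply: allpairs_f.
have := s0 _ pqf; rewrite pqf /w /= mulf_eq0 expf_eq0 /= normr_eq0 => /orP[] /eqP ->.
  by rewrite mul0r scale0r.
by rewrite mulr0 scale0r.
Qed.

(** * The submodule generated by the square of the highest root vector *)

Local Notation V := (calV e omega).

Lemma calV_stable x s : s \in V -> act x s \in V.
Proof. by have [_ + _] := gen_submoduleP (smul (e omega) (e omega)) aB; apply. Qed.

Lemma calV_gen : smul (e omega) (e omega) \in V.
Proof. by have [+ _ _] := gen_submoduleP (smul (e omega) (e omega)) aB. Qed.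

Lemma calV_ind (P : S -> Prop) :
    P 0 -> (forall a s t, P s -> P t -> P (a *: s + t)) ->
    (forall x s, P s -> P (act x s)) -> P (smul (e omega) (e omega)) ->
  {in V, forall s, P s}.
Proof.
move=> P0 PD Pa Pe.
have PA s t : P s -> P t -> P (s + t) by rewrite -[s in s + _]scale1r; apply: PD.
rewrite /calV /gen_submodule; elim: (\dim _) => [|k IHk] s /=.
  by move=> /vlineP[a ->]; rewrite -[_ *: _]addr0; apply: PD.
move=> /memv_addP[u /IHk Pu [v /memv_sumP[f fE ->] ->]]; apply/PA => //.
apply: (big_ind P) => [||i _]; [exact: P0|exact: PA|].
have /memv_imgP[w wU ->] := fE i isT.
have Pw := IHk w wU.
rewrite linfunE => [|a x y]; last exact: (bilPr aB).
exact: Pa.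
Qed.

(** Applying [e (- a)] repeatedly to [e_a e_a] gives, up to nonzero factors, [e_a a],
    [2 e_a e_-a - a a], [e_-a a] and [e_-a e_-a]. *)
Lemma smul_lower a : a \in Phi -> smul (e a) (e a) \in V ->
  [/\ smul (e a) a \in V, 2 *: smul (e a) (e (- a)) - smul a a \in V &
      smul (e (- a)) (e (- a)) \in V].
Proof.
move=> aP aV; have naP := rootN aP.
have ea : lie (e (- a)) (e a) = - a by rewrite lieC lie_e_opp.
have ha : lie (e (- a)) a = 2 *: e (- a).
  by rewrite lieC H_e ?root_H // (formNl kB) kap_root // scaleNr opprK.
have two0 : 2 != 0 :> F by rewrite pnatr_eq0.
have V1 : smul (e a) a \in V.
  have := calV_stable (e (- a)) aV; rewrite s2actE ea (bilNl sB) (bilNr sB).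
  by rewrite smulC -opprD memvN -mulr2n -scaler_nat rpredZeq (negPf two0).
have V2 : 2 *: smul (e a) (e (- a)) - smul a a \in V.
  have := calV_stable (e (- a)) V1; rewrite s2actE ea ha (bilNl sB) (bilZr sB).
  by rewrite addrC.
have V3 : smul (e (- a)) a \in V.
  have := calV_stable (e (- a)) V2.
  have e0 : act (e (- a)) (smul a a) = 4 *: smul (e (- a)) a.
    rewrite s2actE ha [smul a _]smulC (bilZl sB) -scalerDl.
    by congr (_ *: _); ring.
  rewrite (bilBr aB) (bilZr aB) e0 s2actE ea lie_alt (bil0r sB) addr0 (bilNl sB).
  rewrite smulC scalerN -opprD memvN -scalerDl rpredZeq.
  by rewrite -natrD pnatr_eq0.
split; [exact: V1|exact: V2|have := calV_stable (e (- a)) V3].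
by rewrite s2actE lie_alt (bil0l sB) add0r ha (bilZr sB) rpredZeq (negPf two0).
Qed.

(** Applying [e b] twice to [e_a e_a] gives [2 s^2] times the square of [e (a + b)], with [s] the
    structure constant. *)
Lemma smul_shift a b : a \in Phi -> b \in Phi -> kap a b = -1 ->
  smul (e a) (e a) \in V -> smul (e (a + b)) (e (a + b)) \in V.
Proof.
move=> aP bP ab aV; have [s s0 eE] := lie_ee bP aP (etrans (kapC _ _) ab).
have abP := rootD aP bP ab.
have e0 : lie (e b) (e (a + b)) = 0.
  apply: lie_ee_ge0 => //; rewrite (formDr kB) kapC ab kap_root //.
  by rewrite -[2]natr1 addrC addrK ler01.
have := calV_stable (e b) (calV_stable (e b) aV).
rewrite s2actE eE addrC [b + a]addrC (bilZl sB) (bilZr sB) [smul (e a) _]smulC -scalerDl.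
rewrite (bilZr aB) s2actE e0 (bil0l sB) add0r eE [b + a]addrC (bilZr sB) scalerA.
by rewrite rpredZeq !mulf_eq0 -mulr2n -mulr_natr mulf_eq0 pnatr_eq0 (negPf s0).
Qed.

(** Membership spreads from a root to every root not orthogonal to it, and by [roots_linked] two
    such moves lead from [omega] to any root. When [kap b d = -1] the route is [b], [b + d], [d];
    the value 1 is reduced to this through [- b]. *)
Lemma calV_ee a : a \in Phi -> smul (e a) (e a) \in V.
Proof.
have V0 := calV_gen; have oP := omega_root.
have link : forall b d, b \in Phi -> d \in Phi -> kap b d != 0 ->
    smul (e b) (e b) \in V -> smul (e d) (e d) \in V.
  have neg : forall b d, b \in Phi -> d \in Phi -> kap b d = -1 ->
    smul (e b) (e b) \in V -> smul (e d) (e d) \in V.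
    move=> b d bP dP bd bV; have bdV := smul_shift bP dP bd bV.
    have bdP := rootD bP dP bd.
    have := smul_shift bdP (rootN bP); rewrite addrAC subrr add0r; apply=> //.
    rewrite (formDl kB) !(formNr kB) kap_root // [kap d b]kapC bd opprK.
    by rewrite -[2]natr1 opprD addrNK.
  move=> b d bP dP bd bV; have [<- //|[dE|[bd1|[bd0|bd1]]]] := root_cases bP dP.
  - by rewrite dE; have [_ _] := smul_lower bP bV.
  - apply: (neg (- b)) => //; first exact: rootN.
      by rewrite (formNl kB) bd1.
    by have [_ _] := smul_lower bP bV.
  - by rewrite bd0 eqxx in bd.
  - exact: (neg b).
move=> aP; have /linkedP[g [gP og ga]] := roots_linked oP aP.
by apply: (link g) => //; apply: (link omega).
Qed.

Lemma calV_cinv2 (g : {rmorphism F -> F}) s : s \in V -> cinv2 g s \in V.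
Proof.
move: s; apply: calV_ind => [|a s t sV tV|x s sV|].
- by rewrite cinv2_0 mem0v.
- by rewrite cinv2P memvD // memvZ.
- by rewrite cinv2_act calV_stable.
rewrite cinv2_smul cinv_e ?omega_root // (bilNl sB) (bilNr sB) opprK.
by rewrite calV_ee ?rootN ?omega_root.
Qed.

(** * The Frobenius algebra on the complement of the Cartan square *)

Local Notation A := (orthc B fullv V).
Local Notation calA := (calA kap e omega).
Local Notation bar := (bar kap e omega).
Local Notation actA := (@calA_act _ L kap e omega).
Local Notation mulA := (@calA_mul _ L kap e omega).
Local Notation formA := (@calA_form _ L kap e omega).

Lemma calV_nondeg : {in V, forall w, {in V, forall w', B w' w = 0} -> w = 0}.
Proof.
move=> w wV w0; apply: tau2_anisotropic.
by rewrite (s2formC kB kapC) w0 // calV_cinv2.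
Qed.

Lemma memA s : reflect {in V, forall v, B v s = 0} (s \in A).
Proof.
by apply: (iffP (orthcP _ _ _ bB)) => [[]//|s0]; split; rewrite ?memvf.
Qed.

Lemma calA_stable x s : s \in A -> act x s \in A.
Proof.
move=> /memA sA; apply/memA => v vV.
rewrite (s2formC kB kapC) (s2form_inv kB kapC kap_inv) (s2formC kB kapC).
by rewrite sA ?oppr0 // calV_stable.
Qed.

Lemma bar_linear : linear bar.
Proof. by move=> a s t; rewrite /bar !linearP. Qed.

HB.instance Definition _ := GRing.isLinear.Build F S calA *:%R bar bar_linear.

Lemma barZ a s : bar (a *: s) = a *: bar s. Proof. exact: linearZ. Qed.

Lemma barP a s t : bar (a *: s + t) = a *: bar s + bar t.
Proof. exact: linearP. Qed.

Lemma barD s t : bar (s + t) = bar s + bar t. Proof. exact: linearD. Qed.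

Lemma vsval_bar s : vsval (bar s) = orthproj B fullv V s.
Proof. by rewrite /bar vsprojK // orthproj_mem. Qed.

Lemma barB s : s - vsval (bar s) \in V.
Proof.
by rewrite vsval_bar; apply: orthproj_sub bB (subvf _) calV_nondeg _ (memvf _).
Qed.

Lemma bar_eq0 s : (bar s == 0) = (s \in V).
Proof.
apply/eqP/idP => [s0|sV]; first by have := barB s; rewrite s0 subr0.
apply: val_inj; rewrite /= vsval_bar -[s]add0r.
by rewrite (orthproj_eq bB calV_nondeg) // mem0v.
Qed.

Lemma bar_eq s t : s - t \in V -> bar s = bar t.
Proof.
by move=> st; apply/eqP; rewrite -subr_eq0 -linearB /= bar_eq0.
Qed.

Lemma bar_val (a : calA) : bar (vsval a) = a.
Proof.
apply: val_inj; rewrite /= vsval_bar -[vsval a]addr0.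
by rewrite (orthproj_eq bB calV_nondeg) ?mem0v ?addr0 // subvsP.
Qed.

Lemma vsval_act x (a : calA) : vsval (actA x a) = act x (vsval a).
Proof. by rewrite vsprojK // calA_stable // subvsP. Qed.

Lemma bar_act x s : bar (act x s) = actA x (bar s).
Proof.
rewrite -[RHS]bar_val vsval_act; apply: bar_eq.
by rewrite -(bilBr aB) calV_stable // barB.
Qed.

Lemma form_bar (a : calA) s : formA a (bar s) = B (vsval a) s.
Proof.
rewrite /calA_form -[s in RHS](subrK (vsval (bar s))) (formDr bB).
have /memA aA := subvsP a.
by rewrite [X in _ = X + _](s2formC kB kapC) aA ?add0r // barB.
Qed.

Lemma formA_bilinear : bilinear_for *%R *%R formA.
Proof.
by apply: bilinear_formP => a x y z; rewrite /calA_form linearP ?(formPl bB) ?(formPr bB).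
Qed.

Lemma formAC u v : formA u v = formA v u.
Proof. exact: s2formC kB kapC _ _. Qed.

Lemma formA_nondeg u : (forall v, formA u v = 0) -> u = 0.
Proof.
move=> u0; apply: val_inj; apply: (s2form_nondeg kB kapC kap_nondeg) => x y.
by rewrite -form_bar.
Qed.

Lemma mulA_bilinear : bilinear_for *:%R *:%R mulA.
Proof.
by apply: bilinear_mapP => a x y z;
  rewrite /calA_mul linearP ?(bilPl mB) ?(bilPr mB) linearP.
Qed.

Lemma mulAC u v : mulA u v = mulA v u.
Proof. by rewrite /calA_mul (s2mulC kB kapC). Qed.

Lemma formA_assoc u v w : formA (mulA u v) w = formA u (mulA v w).
Proof.
rewrite form_bar formAC form_bar (s2formC kB kapC).
by rewrite (s2form_assoc kB kapC).
Qed.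

Lemma vsvalP a (u v : calA) : vsval (a *: u + v) = a *: vsval u + vsval v.
Proof. by []. Qed.

Lemma actA_bilinear : bilinear_for *:%R *:%R actA.
Proof.
apply: bilinear_mapP => a x y z; apply: subvs_inj; apply: etrans (vsval_act _ _) _.
  by rewrite (bilPl aB) [RHS]vsvalP; congr (_ *: _ + _); rewrite vsval_act.
by rewrite [RHS]vsvalP vsvalP (bilPr aB); congr (_ *: _ + _); rewrite vsval_act.
Qed.

Lemma actA_lie x y v : actA (lie x y) v = actA x (actA y v) - actA y (actA x v).
Proof.
apply: subvs_inj; apply: etrans (vsval_act _ _) _.
rewrite s2act_lie -[RHS]/(vsval (actA x (actA y v)) - vsval (actA y (actA x v))).
by congr (_ - _); rewrite 2!vsval_act.
Qed.

Lemma actA_der x v w : actA x (mulA v w) = mulA (actA x v) w + mulA v (actA x w).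
Proof.
rewrite /calA_mul -bar_act -linearD /= !vsval_act.
by rewrite (s2mul_der kB kapC kap_inv kap_nondeg).
Qed.

Lemma formA_inv x v w : formA (actA x v) w + formA v (actA x w) = 0.
Proof. by rewrite /calA_form !vsval_act (s2form_inv kB kapC kap_inv) addNr. Qed.

Lemma calA_frobenius : frobenius_algebra_for actA mulA formA.
Proof.
split.
- by split; [apply: actA_bilinear|apply: actA_lie].
- split; [exact: mulA_bilinear|exact: mulAC|exact: formA_bilinear|exact: formAC|
          exact: formA_nondeg|exact: formA_assoc].
- exact: actA_der.
- exact: formA_inv.
Qed.

Local Notation idF := (idfun : {rmorphism F -> F}).
Local Notation sigma := (cinv idF).

Definition sigmaA (a : calA) : calA := bar (cinv2 idF (vsval a)).

Lemma sigmaA_bar s : sigmaA (bar s) = bar (cinv2 idF s).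
Proof.
apply: bar_eq; have cB u v : cinv2 idF (u - v) = cinv2 idF u - cinv2 idF v.
  by rewrite addrC -scaleN1r cinv2P rmorphN1 scaleN1r addrC.
by rewrite -cB calV_cinv2 // -opprB memvN barB.
Qed.

Lemma sigmaA_act x a : sigmaA (actA x a) = actA (sigma x) (sigmaA a).
Proof. by rewrite -[a]bar_val -bar_act !sigmaA_bar cinv2_act bar_act. Qed.

Lemma vsval_sigmaA a : vsval (sigmaA a) = cinv2 idF (vsval a).
Proof.
have idK : involutive idF by [].
rewrite vsval_bar -[cinv2 _ _]addr0 (orthproj_eq bB calV_nondeg) ?addr0 ?mem0v //.
apply/memA => v vV; rewrite -[v](cinv2K idK) cinv2_form.
by have /memA -> := subvsP a; rewrite ?rmorph0 // calV_cinv2.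
Qed.

Lemma sigmaA_mul a b : sigmaA (mulA a b) = mulA (sigmaA a) (sigmaA b).
Proof. by rewrite /calA_mul sigmaA_bar !vsval_sigmaA cinv2_mul. Qed.

(** Half of the linearized expression of the extremal identity; this is why the constant in
    [qform_calV] is 2 and not 4. *)
Definition qform (x y : L) (s : S) : F :=
  slift (fun a b => 2^-1 * (kap (lie a x) (lie b y) + kap (lie a y) (lie b x)) : F^o) s.

Lemma qform_lin x y a s t : qform x y (a *: s + t) = a * qform x y s + qform x y t.
Proof. exact: (@slift_linear F L F^o _ a s t). Qed.

Lemma qform0 x y : qform x y 0 = 0.
Proof. by have := qform_lin x y (-1) 0 0; rewrite scaler0 addr0 mulN1r addNr. Qed.

Lemma qform_smul x y a b : qform x y (smul a b) =
  2^-1 * (kap (lie a x) (lie b y) + kap (lie a y) (lie b x)).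
Proof.
apply: (@slift_smul F L F^o) => [|u v]; last first.
  by rewrite [kap (lie u x) _]kapC [kap (lie u y) _]kapC addrC.
apply: bilinear_mapP => t u v w;
  rewrite !(bilPl lB) ?(formPl kB) ?(formPr kB) -[_ *: _]/(_ * _);
  by apply: (_ : _ = _ :> F); ring.
Qed.

Lemma qform_act z x y s :
  qform x y (act z s) = - (qform (lie z x) y s + qform x (lie z y) s).
Proof.
elim/symsq_ind: s => [|a s t sE tE|u v].
- by rewrite (bil0r aB) !qform0 addr0 oppr0.
- by rewrite (bilPr aB) !qform_lin sE tE; ring.
rewrite s2actE -[smul (lie z u) v]scale1r qform_lin mul1r !qform_smul !lie_lie.
rewrite !(formBl kB) !(formBr kB) !kap_inv.
by ring.
Qed.

(* By the extremal identity, [qform] is twice the form [B] on the square of a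
   root vector; both sides being invariant, this extends to all of [V]. *)
Lemma qform_calV x y : {in V, forall s, qform x y s = 2 * B s (smul x y)}.
Proof.
move=> s sV; move: s sV x y; apply: calV_ind => [x y|a s t sE tE x y|z s sE x y|x y].
- by rewrite qform0 (form0l bB) mulr0.
- by rewrite qform_lin sE tE (formPl bB); ring.
- by rewrite qform_act !sE (s2form_inv kB kapC kap_inv) s2actE (formDr bB); ring.
rewrite qform_smul s2formE //; last exact: kapC.
rewrite !kap_inv !extremal ?omega_root // !(formZr kB) ![kap _ (e omega)]kapC.
by field.
Qed.

Lemma kap_weight u w p q : p \in H -> q \in H -> p + q != 0 ->
    {in H, forall h, lie h u = kap p h *: u} ->
    {in H, forall h, lie h w = kap q h *: w} -> kap u w = 0.
Proof.
move=> pH qH pq0 uE wE; apply/eqP; apply: contraNT pq0 => uw; apply/eqP.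
apply: kapH_nondeg => [|d dP]; first by rewrite memvD.
have dH := root_H dP.
have : kap (lie d u) w + kap u (lie d w) = 0 by rewrite kap_inv addrC subrr.
rewrite uE // wE // (formZl kB) (formZr kB) -mulrDl => /eqP.
by rewrite mulf_eq0 (negPf uw) orbF kapC [kap q d]kapC (formDr kB) => /eqP.
Qed.

Lemma lie_eH a k : a \in Phi -> k \in H -> lie (e a) k = - kap a k *: e a.
Proof. by move=> aP kH; rewrite lieC H_e // scaleNr. Qed.

(** The sum has square length 4, and two roots with such a sum must be orthogonal. *)
Lemma root_sum_kap0 a b c' d : a \in Phi -> b \in Phi -> c' \in Phi -> d \in Phi ->
  kap a b = 0 -> c' + d = a + b -> kap c' d = 0.
Proof.
move=> aP bP cP dP ab cd.
have : kap (c' + d) (c' + d) = 4.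
  rewrite cd !(formDl kB) !(formDr kB) !kap_root // [kap b a]kapC ab; ring.
rewrite !(formDl kB) !(formDr kB) !kap_root // [kap d c']kapC => h.
have two0 : 2 != 0 :> F by rewrite pnatr_eq0.
by apply: (mulfI two0); apply: (addrI 4); transitivity (4 : F); [rewrite -[RHS]h|]; ring.
Qed.

Lemma Lambda0P lam : reflect (exists a b, [/\ a \in Phi, b \in Phi, kap a b = 0 & lam = a + b])
  (lam \in Lambda0 kap Phi).
Proof.
rewrite mem_undup; apply: (iffP mapP) => [[[a b]]|[a [b [aP bP ab ->]]]].
  rewrite mem_filter /= => /andP[/eqP ab /allpairsP[[a' b'] [/= aP bP [aE bE]]]] ->.
  by exists a, b; split=> //; [rewrite aE|rewrite bE].
by exists (a, b) => //; rewrite mem_filter ab eqxx; apply/allpairsP; exists (a, b).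
Qed.

Lemma kap0_neq a b : a \in Phi -> b \in Phi -> kap a b = 0 -> (a != b) && (a != - b).
Proof.
move=> aP bP ab; apply/andP; split; apply/eqP => aE; move/eqP: ab; rewrite aE.
  by rewrite (negPf (kap_root_neq0 bP)).
by rewrite (formNl kB) oppr_eq0 (negPf (kap_root_neq0 bP)).
Qed.

(** By [smul_HSJ] this is the symmetric square of [H]; the map [Psi] below carries it onto [Jsp]. *)
Definition SJ : {vspace S} := <<[seq smul a a | a <- Phi]>>%VS.

Lemma smul_rootSJ a : a \in Phi -> smul a a \in SJ.
Proof. by move=> aP; apply/memv_span/mapP; exists a. Qed.

Lemma smulDD (x y : L) : smul (x + y) (x + y) = smul x x + 2 *: smul x y + smul y y.
Proof.
rewrite !(bilDl sB) !(bilDr sB) [smul y x]smulC scaler_nat mulr2n !addrA.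
by [].
Qed.

Lemma smul_HSJ h k : h \in H -> k \in H -> smul h k \in SJ.
Proof.
move=> hH kH; move: h hH; apply: H_ind => [|t x y xE yE|a aP].
- by rewrite (bil0l sB) mem0v.
- by rewrite (bilPl sB) memvD ?memvZ.
move: k kH; apply: H_ind => [|t x y xE yE|b bP].
- by rewrite (bil0r sB) mem0v.
- by rewrite (bilPr sB) memvD ?memvZ.
have two0 : 2 != 0 :> F by rewrite pnatr_eq0.
have half x y : x \in Phi -> y \in Phi -> smul (x + y) (x + y) \in SJ -> smul x y \in SJ.
  move=> xP yP; rewrite smulDD => h.
  have : 2 *: smul x y \in SJ.
    have -> : 2 *: smul x y = smul x x + 2 *: smul x y + smul y y - smul x x - smul y y.
      by rewrite addrAC addrK [smul x x + _]addrC addrK.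
    by rewrite memvB ?smul_rootSJ // memvB ?smul_rootSJ.
  by rewrite rpredZeq (negPf two0).
have neg x y : smul x (- y) \in SJ -> smul x y \in SJ by rewrite (bilNr sB) memvN.
have [<-|[bE|[ab|[ab|ab]]]] := root_cases aP bP.
- exact: smul_rootSJ.
- by rewrite bE (bilNr sB) memvN smul_rootSJ.
- by apply/neg/half; rewrite ?rootN // smul_rootSJ // rootB.
(* Along a chain [x], [d], [y] the sums [x + d], [d + y] and [x + d + y] are roots, and [2 x y = (x
   + d + y)^2 - (x + d)^2 - (d + y)^2 + d^2]. *)
- have orth x y d : x \in Phi -> y \in Phi -> d \in Phi -> kap x y = 0 ->
      kap x d = -1 -> kap d y = -1 -> smul x y \in SJ.
    move=> xP yP dP xy xd dy.
    have xdP := rootD xP dP xd; have dyP := rootD dP yP dy.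
    have : x + d + y \in Phi by rewrite rootD // (formDl kB) xy dy add0r.
    move=> /smul_rootSJ; rewrite smulDD (bilDl sB x d y) scalerDr => h.
    have xdS := smul_rootSJ xdP; have dyS := smul_rootSJ dyP.
    move: dyS; rewrite smulDD => dyS.
    have : 2 *: smul x y \in SJ.
      have -> : 2 *: smul x y =
          smul (x + d) (x + d) + (2 *: smul x y + 2 *: smul d y) + smul y y
          - smul (x + d) (x + d) - (smul d d + 2 *: smul d y + smul y y) + smul d d.
        rewrite -[X in X - smul (x + d) (x + d)]addrA [_ + (_ + _)]addrC addrK.
        by rewrite -[X in X - (_ + _)]addrA -[X in _ - X]addrA opprD addrACA subrr addr0 subrK.
      by rewrite memvD ?smul_rootSJ // memvB // memvB.
    by rewrite rpredZeq (negPf two0).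
  have [g [gP ag [gb|gb]]] := orth_link aP bP ab.
    apply/neg/(orth a (- b) g); rewrite ?rootN //; first by rewrite (formNr kB) ab oppr0.
    by rewrite (formNr kB) gb.
  exact: (orth a b g).
- by apply: half; rewrite // smul_rootSJ // rootD.
Qed.

(** * Bijectivity of theta *)

Lemma lie_ee1 a b : a \in Phi -> b \in Phi -> kap a b = -1 ->
  exists2 s, s * s = 1 & lie (e a) (e b) = s *: e (a + b).
Proof.
move=> aP bP ab; exists (c a b); last exact: (chev_add chev) (rootD _ _ _).
case: (chev_sign chev aP bP (rootD aP bP ab)) => ->; first exact: mulr1.
by rewrite mulrNN mulr1.
Qed.

Lemma sqr1_neq0 (s : F) : s * s = 1 -> s != 0.
Proof. by move=> ss; apply: contra_eq_neq ss => ->; rewrite mul0r eq_sym oner_eq0. Qed.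

(** [b - a] is a root, and its root vector sends [e_a e_a] to a nonzero multiple of [e_a e_b]. *)
Lemma calV_ee1 a b : a \in Phi -> b \in Phi -> kap a b = 1 -> smul (e a) (e b) \in V.
Proof.
move=> aP bP ab; have dP : b - a \in Phi by apply: rootB; rewrite // kapC.
have da : kap (b - a) a = -1.
  by rewrite (formBl kB) kapC ab kap_root // -[2]natr1 opprD addrA subrr add0r.
have [s ss eE] := lie_ee1 dP aP da; rewrite subrK in eE.
have := calV_stable (e (b - a)) (calV_ee aP).
rewrite s2actE eE (bilZl sB) (bilZr sB) [smul (e b) _]smulC -scalerDl.
by rewrite rpredZeq -mulr2n -mulr_natr mulf_eq0 pnatr_eq0 orbF (negPf (sqr1_neq0 ss)).
Qed.

Lemma calV_eN a : a \in Phi -> 2 *: smul (e a) (e (- a)) - smul a a \in V.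
Proof. by move=> aP; have [] := smul_lower aP (calV_ee aP). Qed.

Lemma kap_sum2 a b c' : a \in Phi -> b \in Phi -> c' \in Phi ->
  kap c' a + kap c' b = 2 -> c' != a -> c' != b -> kap c' a = 1.
Proof.
move=> aP bP cP cs ca cb.
have le1 x : x \in Phi -> c' != x -> exists2 z : int, kap c' x = z%:~R & (z <= 1)%R.
  move=> xP cx; have [cE|[->|[->|[->|->]]]] := root_cases cP xP.
  - by rewrite cE eqxx in cx.
  - by exists (-2) => //; rewrite (formNr kB) kap_root // mulrNz.
  - by exists 1.
  - by exists 0.
  - by exists (-1) => //; rewrite mulrNz.
have [z1 z1E z1le] := le1 a aP ca; have [z2 z2E z2le] := le1 b bP cb.
move: cs; rewrite z1E z2E -intrD => /eqP; rewrite -[2]/(2%:~R) eqr_int => /eqP zs.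
suff -> : z1 = 1 by [].
apply/eqP; rewrite eq_le z1le /= -(lerD2r z2) zs.
by rewrite (_ : 2 = 1 + 1) // lerD2l.
Qed.

Lemma root_pairs a b c' d : a \in Phi -> b \in Phi -> c' \in Phi -> d \in Phi ->
  kap a b = 0 -> c' + d = a + b -> c' != a -> c' != b -> kap c' a = 1.
Proof.
move=> aP bP cP dP ab cd; apply: kap_sum2 => //.
by rewrite -(formDr kB) -cd (formDr kB) kap_root // (root_sum_kap0 aP bP cP dP ab cd) addr0.
Qed.

(** Apart from the trivial coincidences, [kap a d = 1], so [e_a e_d] is in [V]; the root vector of
    [c' - a] sends it to a combination of [e_c' e_d] and [e_a e_b] with coefficients 1 or -1. Modulo
    [V] the product thus depends, up to sign, only on the sum of the two roots. *)
Lemma calV_ee0 a b c' d : a \in Phi -> b \in Phi -> c' \in Phi -> d \in Phi ->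
    kap a b = 0 -> c' + d = a + b ->
  exists2 s, s * s = 1 & smul (e a) (e b) - s *: smul (e c') (e d) \in V.
Proof.
move=> aP bP cP dP ab cd.
have [cE|ca] := eqVneq c' a.
  have -> : d = b by apply: (addrI c'); rewrite cd cE.
  by exists 1; rewrite ?mulr1 // cE scale1r subrr mem0v.
have [cE|cb] := eqVneq c' b.
  have -> : d = a by apply: (addrI c'); rewrite cd cE addrC.
  by exists 1; rewrite ?mulr1 // cE scale1r smulC subrr mem0v.
have ca1 := root_pairs aP bP cP dP ab cd ca cb.
have cd0 := root_sum_kap0 aP bP cP dP ab cd.
have dE : d = a + b - c' by rewrite -cd addrC addKr.
have ad1 : kap a d = 1.
  by rewrite dE (formBr kB) (formDr kB) kap_root // ab addr0 [kap a c']kapC ca1 -[2]natr1 addrK.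
have nP : c' - a \in Phi by apply: rootB.
have na : kap (c' - a) a = -1.
  by rewrite (formBl kB) ca1 kap_root // -[2]natr1 opprD addrA subrr add0r.
have nd : kap (c' - a) d = -1 by rewrite (formBl kB) cd0 ad1 sub0r.
have [s1 ss1 e1] := lie_ee1 nP aP na; have [s2 ss2 e2] := lie_ee1 nP dP nd.
rewrite subrK in e1; rewrite (_ : c' - a + d = b) in e2; last first.
  by rewrite addrAC cd addrC addKr.
exists (- (s1 * s2)); first by rewrite mulrNN mulrACA ss1 ss2 mulr1.
have := calV_stable (e (c' - a)) (calV_ee1 aP dP ad1).
rewrite s2actE e1 e2 (bilZl sB) (bilZr sB) => h.
have : s2 *: (s1 *: smul (e c') (e d) + s2 *: smul (e a) (e b)) \in V by apply: memvZ.
by rewrite scalerDr !scalerA ss2 scale1r scaleNr opprK addrC mulrC.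
Qed.

(** [e (a + b)] sends the element [2 e_-b e_b - b b] of [V] to [2 s e_a e_b + 2 e_(a+b) b], where
    [s] is 1 or -1. *)
Lemma calV_eD a b : a \in Phi -> b \in Phi -> kap a b = -1 ->
  exists t, smul (e a) (e b) - t *: smul (e (a + b)) b \in V.
Proof.
move=> aP bP ab; have abP := rootD aP bP ab; have nbP := rootN bP.
have k1 : kap (a + b) (- b) = -1.
  by rewrite (formNr kB) (formDl kB) ab kap_root // -[2]natr1 addrC addrK.
have [s ss eE] := lie_ee1 abP nbP k1; rewrite addrK in eE.
have eb : lie (e (a + b)) (e b) = 0.
  apply: lie_ee_ge0 => //.
  by rewrite (formDl kB) ab kap_root // -[2]natr1 addrC addrK ler01.
have hb : lie (e (a + b)) (- b) = e (a + b).
  by rewrite lie_eH // ?memvN ?root_H // kapC -kapC k1 opprK scale1r.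
exists (- s).
have := calV_stable (e (a + b)) (calV_eN nbP).
rewrite opprK (bilBr aB) (bilZr aB) !s2actE eE eb hb (bil0r sB) addr0 (bilZl sB).
rewrite [smul (- b) _]smulC -mulr2n -scaler_nat -scalerBr.
rewrite (bilNr sB) opprK rpredZeq pnatr_eq0 /= => h.
have : s *: (s *: smul (e a) (e b) + smul (e (a + b)) b) \in V by apply: memvZ.
by rewrite scalerDr scalerA ss scale1r scaleNr opprK.
Qed.

Section Theta.
Variables (pa pb : L -> L) (theta : 'Hom(frakA H kap Phi, calA)).
Hypothesis pP : {in Lambda0 kap Phi, forall lam,
  [/\ pa lam \in Phi, pb lam \in Phi & pa lam + pb lam = lam]}.
Hypothesis thetaP : theta_spec pa pb theta.

Lemma p_kap0 lam : lam \in Lambda0 kap Phi -> kap (pa lam) (pb lam) = 0.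
Proof.
move=> lP; have [paP pbP pab] := pP lP; have /Lambda0P[a [b [aP bP ab lE]]] := lP.
by apply: root_sum_kap0 ab _; rewrite // pab.
Qed.

(** Modulo [V], a product [e_a e_b] is zero if [a = b] or [kap a b = 1], half of [a a] if [b = - a],
    one of the [x_lam] up to sign if the roots are orthogonal, and a multiple of [e_(a+b) b] if
    [kap a b = -1]. In the last case [b] is not orthogonal to [a + b], but [theta_H] admits every
    element of [H]. *)
Lemma bar_limg s : bar s \in limg theta.
Proof.
have mt v : theta v \in limg theta by apply: memv_img; apply: memvf.
have barV s' t : s' - t \in V -> bar t \in limg theta -> bar s' \in limg theta.
  by move=> /bar_eq ->.
have barSJ t : t \in SJ -> bar t \in limg theta.
  move: t; apply: span_ind => [|a x y xE yE|_ /mapP[a aP ->]].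
  - by rewrite linear0 mem0v.
  - by rewrite barP memvD ?memvZ.
  by rewrite -(theta_J thetaP aP) mt.
have bareH a h : a \in Phi -> h \in H -> bar (smul (e a) h) \in limg theta.
  by move=> aP hH; rewrite -[a]/(val (SeqSub aP)) -(theta_H thetaP) ?mt.
have baree a b : a \in Phi -> b \in Phi -> bar (smul (e a) (e b)) \in limg theta.
  move=> aP bP; have abH : a + b \in H by rewrite memvD ?root_H.
  have [<-|[->|[ab|[ab|ab]]]] := root_cases aP bP.
  - have /eqP -> : bar (smul (e a) (e a)) == 0 by rewrite bar_eq0 calV_ee.
    exact: mem0v.
  - apply: (barV _ (2^-1 *: smul a a)); last by rewrite barSJ // memvZ // smul_rootSJ.
    rewrite -[smul (e a) _](scalerK (_ : 2 != 0)) ?pnatr_eq0 // -scalerBr memvZ //.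
    exact: calV_eN.
  - have /eqP -> : bar (smul (e a) (e b)) == 0 by rewrite bar_eq0 calV_ee1.
    exact: mem0v.
  - have lP : a + b \in Lambda0 kap Phi by apply/Lambda0P; exists a, b.
    have [paP pbP pab] := pP lP.
    have [s1 _ sE] := calV_ee0 aP bP paP pbP ab pab; apply: barV sE _.
    rewrite linearZ memvZ //.
    by have := mt (inX H (SeqSub lP)); rewrite (theta_X thetaP).
  - have [t tE] := calV_eD aP bP ab; apply: barV tE _.
    by rewrite linearZ memvZ // bareH ?rootD ?root_H.
elim/symsq_ind: s => [|a s t sE tE|u v]; first by rewrite linear0 mem0v.
  by rewrite barP memvD ?memvZ.
move: u v; apply: chev_ind => [v|a x y xE yE v|a aP|a aP].
- by rewrite (bil0l sB) linear0 mem0v.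
- by rewrite (bilPl sB) barP memvD ?memvZ // ?xE ?yE.
- apply: chev_ind => [|t x y xE yE|b bP|b bP].
  + by rewrite (bil0r sB) linear0 mem0v.
  + by rewrite (bilPr sB) barP memvD ?memvZ.
  + by rewrite barSJ // smul_HSJ ?root_H.
  + by rewrite smulC bareH ?root_H.
apply: chev_ind => [|t x y xE yE|b bP|b bP].
- by rewrite (bil0r sB) linear0 mem0v.
- by rewrite (bilPr sB) barP memvD ?memvZ.
- by rewrite bareH ?root_H.
exact: baree.
Qed.

Lemma limg_theta : limg theta = fullv.
Proof.
apply/eqP; rewrite eqEsubv subvf /=; apply/subvP => a _.
by rewrite -[a]bar_val bar_limg.
Qed.

(** The symmetric operator that represents the bilinear form [B s] with respect to [kap]
    ([kap_Psi]). It turns [s2mul] into the Jordan product ([Psi_mul]) and [B] into the trace form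
    ([Psi_form]), which connects [J] and [diamond] with the symmetric square. *)
Definition Psi (s : S) : 'End(L) := linfun (fun l =>
  slift (fun a b => 2^-1 *: (kap l a *: b + kap l b *: a)) s).

Lemma PsiE s l : Psi s l =
  slift (fun a b => 2^-1 *: (kap l a *: b + kap l b *: a)) s.
Proof.
rewrite linfunE // => t x y; refine (@slift_funP F L _ _ _ _ t s _) => a b.
rewrite !(formPl kB) !scalerDl !scalerDr !scalerA addrACA.
by congr (_ + _ + (_ + _)); congr (_ *: _); ring.
Qed.

Lemma Psi_linear : linear Psi.
Proof.
move=> t x y; apply/lfunP => l.
by rewrite add_lfunE scale_lfunE !PsiE slift_linear.
Qed.

HB.instance Definition _ := GRing.isLinear.Build F S 'End(L) *:%R Psi Psi_linear.

Lemma PsiP a s t : Psi (a *: s + t) = a *: Psi s + Psi t.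
Proof. exact: Psi_linear. Qed.

Lemma Psi0 : Psi 0 = 0. Proof. exact: linear0. Qed.

Lemma PsiZ a s : Psi (a *: s) = a *: Psi s. Proof. exact: linearZ. Qed.

Lemma PsiB s t : Psi (s - t) = Psi s - Psi t. Proof. exact: linearB. Qed.

Lemma Psi_smul a b l : Psi (smul a b) l = 2^-1 *: (kap l a *: b + kap l b *: a).
Proof.
rewrite PsiE slift_smul // => [|x y]; last by rewrite addrC.
apply: bilinear_mapP => t x y z; rewrite (formPr kB) scalerDl !scalerDr !scalerA addrACA;
  by congr (_ + _ + (_ + _)); congr (_ *: _); ring.
Qed.

Lemma Psi_jop a : Psi (smul a a) = jop kap a.
Proof.
apply/lfunP => l; rewrite Psi_smul linfunE => [|t x y].
  by rewrite -scalerDl scalerA -mulr2n -[kap l a *+ 2]mulr_natl mulKf ?pnatr_eq0.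
by rewrite (formPl kB) scalerDl scalerA.
Qed.

Lemma Psi_zop a : Psi (smul (e a) (e (- a))) = zop kap e a.
Proof.
apply/lfunP => l; rewrite Psi_smul linfunE // => t x y.
rewrite !(formPl kB) !scalerDl !scalerDr !scalerA addrACA.
by congr (_ + _ + (_ + _)); congr (_ *: _); ring.
Qed.

Lemma kap_Psi s x y : kap (Psi s x) y = B s (smul x y).
Proof.
elim/symsq_ind: s => [|t s s' sE sE'|a b].
- by rewrite Psi0 zero_lfunE (form0l kB) (form0l bB).
- by rewrite PsiP add_lfunE scale_lfunE (formPl kB) (formPl bB) sE sE'.
rewrite Psi_smul s2formE //; last exact: kapC.
by rewrite (formZl kB) (formDl kB) !(formZl kB) ![kap x _]kapC; ring.
Qed.

Lemma Psi_inj : injective Psi.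
Proof.
move=> s t st; apply: (s2form_ext kB kapC kap_nondeg) => x y.
by rewrite -!kap_Psi st.
Qed.

Lemma Psi_mul s t : Psi (mul s t) = jordan (Psi s) (Psi t).
Proof.
rewrite /jordan; elim/symsq_ind: s => [|k s s' sE sE'|a b].
- by rewrite (bil0l mB) !Psi0 comp_lfun0l comp_lfun0r addr0 scaler0.
- rewrite (bilPl mB) !PsiP sE sE' comp_lfunDl comp_lfunDr -comp_lfunZl -comp_lfunZr.
  by rewrite addrACA -scalerDr [RHS]scalerDr !scalerA mulrC.
elim/symsq_ind: t => [|k s s' sE sE'|c' d].
- by rewrite (bil0r mB) !Psi0 comp_lfun0l comp_lfun0r addr0 scaler0.
- rewrite (bilPr mB) !PsiP sE sE' comp_lfunDl comp_lfunDr -comp_lfunZl -comp_lfunZr.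
  by rewrite addrACA -scalerDr [RHS]scalerDr !scalerA mulrC.
apply/lfunP => l; apply/eqP; rewrite -subr_eq0; apply/eqP/kap_nondeg => y.
rewrite (formBl kB) kap_Psi (s2mul_formE kB kapC) scale_lfunE add_lfunE !comp_lfunE.
rewrite (formZl kB) (formDl kB) !kap_Psi !Psi_smul.
rewrite !(bilZl sB) !(bilDl sB) !(bilZl sB) !(formZr bB) !(formDr bB) !(formZr bB) !s2formE;
  try exact: kapC; try exact: kap_bilinear.
rewrite ![kap l _]kapC ![kap c' _]kapC ![kap d _]kapC.
by field.
Qed.

Lemma rank1E x (y l : L) : linfun (fun l => kap l x *: y) l = kap l x *: y.
Proof. by rewrite linfunE // => t u v; rewrite (formPl kB) scalerDl scalerA. Qed.

Lemma Psi_form s t : trform (Psi s) (Psi t) = B s t.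
Proof.
have tl a (f g h : 'End(L)) : trform f (a *: g + h) = a * trform f g + trform f h.
  by rewrite /trform comp_lfunDr -comp_lfunZr lftrace_linear.
elim/symsq_ind: t => [|k t t' tE tE'|a b].
- have := tl 0 (Psi s) 0 0; rewrite scale0r addr0 mul0r add0r => _.
  by rewrite Psi0 (form0r bB) /trform comp_lfun0r /lftrace linear0 mxtrace0.
- by rewrite PsiP tl tE tE' (formPr bB).
have -> : (Psi (smul a b)) = 2^-1 *: linfun (fun l => kap l a *: b) +
    (2^-1 *: linfun (fun l => kap l b *: a) + 0) :> 'End(L).
  apply/lfunP => l; rewrite Psi_smul addr0 add_lfunE !scale_lfunE scalerDr.
  by rewrite !linfunE // => t x y; rewrite (formPl kB) scalerDl scalerA.
rewrite !tl {3}/trform comp_lfun0r [lftrace 0]/lftrace linear0 mxtrace0 addr0 /trform.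
have r1 x y : lftrace (Psi s \o linfun (fun l => kap l x *: y))%VF = B s (smul x y).
  have -> : (Psi s \o linfun (fun l => kap l x *: y))%VF =
      linfun (fun l => (kap l x : F^o) *: Psi s y).
    apply/lfunP => l; by rewrite comp_lfunE !rank1E linearZ.
  rewrite (@lftrace_rank1 F L (fun l => kap l x)) ?kap_Psi 1?smulC // => t u v.
  by rewrite (formPl kB).
by rewrite !r1 [smul b a]smulC; field.
Qed.

(** * Coordinates on [frakA] and lifts to the symmetric square *)

Local Notation fA := (frakA H kap Phi).
Local Notation inJ := (@inJ F L H kap Phi).
Local Notation inH := (@inH F L H kap Phi).
Local Notation inX := (@inX F L H kap Phi).

Lemma inJ_linear : linear inJ.
Proof.
move=> t x y; rewrite -[RHS]/(t *: x + y, t *: 0 + 0, t *: 0 + 0).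
by rewrite !scaler0 !addr0.
Qed.

HB.instance Definition _ := GRing.isLinear.Build F (frakJ kap Phi) fA *:%R inJ inJ_linear.

Lemma perpP a h : a \in Phi -> reflect (h \in H /\ kap a h = 0) (h \in perp H kap a).
Proof.
move=> aP; apply: (iffP (orthcP _ _ _ kB)) => -[hH h0]; split=> //.
  by apply: h0; apply: memv_line.
by move=> _ /vlineP[t ->]; rewrite (formZl kB) h0 mulr0.
Qed.

Lemma line_nondeg a : a \in Phi ->
  {in <[a]>%VS, forall w, {in <[a]>%VS, forall w', kap w' w = 0} -> w = 0}.
Proof.
move=> aP _ /vlineP[t ->] /(_ a (memv_line a)); rewrite (formZr kB) => /eqP.
by rewrite mulf_eq0 (negPf (kap_root_neq0 aP)) orbF => /eqP ->; rewrite scale0r.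
Qed.

Lemma perp_proj a h : a \in Phi -> h \in perp H kap a -> orthproj kap H <[a]> h = h.
Proof.
move=> aP hP; rewrite -[h in LHS]addr0.
by rewrite (orthproj_eq kB (line_nondeg aP)) ?mem0v.
Qed.

Lemma perp_sumP (w : {ffun seq_sub Phi -> L}) :
  reflect (forall a, w a \in perp H kap (val a)) (w \in perp_sum H kap Phi).
Proof.
have evl (a : seq_sub Phi) : linear (fun h : {ffun seq_sub Phi -> L} => h a).
  by move=> t x y; rewrite !ffunE.
rewrite memvE; apply: (iffP subv_bigcapP) => [wP a|wP a _].
  by have := wP a isT; rewrite -memvE -memv_preim (linfunE (evl a)).
by rewrite -memvE -memv_preim (linfunE (evl a)).
Qed.

Lemma frakA_decomp (v : fA) : v = inJ v.1.1 +
  (\sum_(a : seq_sub Phi) inH a (vsval v.1.2 a) +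
   \sum_(lam : seq_sub (Lambda0 kap Phi)) v.2 lam *: inX lam).
Proof.
have /perp_sumP wP := subvsP v.1.2.
have f11 I (r : seq I) (G : I -> fA) : (\sum_(i <- r) G i).1.1 = \sum_(i <- r) (G i).1.1.
  by apply: (big_morph (fun x : fA => x.1.1)).
have f12 I (r : seq I) (G : I -> fA) : (\sum_(i <- r) G i).1.2 = \sum_(i <- r) (G i).1.2.
  by apply: (big_morph (fun x : fA => x.1.2)).
have f2 I (r : seq I) (G : I -> fA) : (\sum_(i <- r) G i).2 = \sum_(i <- r) (G i).2.
  by apply: (big_morph (fun x : fA => x.2)).
set rhs := (X in _ = X).
have e1 : rhs.1.1 = v.1.1.
  rewrite /rhs /= f11 f11 big1 // big1 ?addr0 // => i _.
  exact: scaler0.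
have e2 : rhs.1.2 = v.1.2.
  rewrite /rhs /= f12 f12 [X in _ + (_ + X)]big1 ?addr0 => [|i _]; last exact: scaler0.
  rewrite add0r; apply: val_inj => /=; rewrite linear_sum /=.
  have pE a : vsval (vsproj (perp_sum H kap Phi) [ffun b => if b == a
        then orthproj kap H <[val a]> (vsval v.1.2 a) else 0]) =
      [ffun b => if b == a then vsval v.1.2 a else 0].
    rewrite vsprojK; last first.
      apply/perp_sumP => b; rewrite ffunE; case: eqP => [->|_]; last exact: mem0v.
      exact: orthproj_mem.
    by apply/ffunP => b; rewrite !ffunE (perp_proj (valP a)).
  under eq_bigr => a _ do rewrite pE.
  apply/ffunP => b; rewrite sum_ffunE (bigD1 b) //= big1 ?addr0 => [|a ab].
    by rewrite ffunE eqxx.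
  by rewrite ffunE eq_sym (negPf ab).
have e3 : rhs.2 = v.2.
  rewrite /rhs /= f2 f2 big1 // !add0r.
  apply/ffunP => b; rewrite sum_ffunE (bigD1 b) //= big1 ?addr0 => [|a ab].
    by rewrite !ffunE eqxx -[_ *: _]/(_ * _) mulr1.
  by rewrite !ffunE eq_sym (negPf ab) scaler0.
case: v rhs e1 e2 e3 {wP} => -[v1 v2] v3 [[r1 r2] r3] /= <- <- <-.
by [].
Qed.

(** An element of [J] is given only as some combination of the [j_a]; induction on the span carries
    a preimage under [Psi] and the value of [theta] along together, and [Psi_inj] makes the preimage
    independent of the combination. *)
Lemma frakJ_lift (j : frakJ kap Phi) :
  exists2 s, s \in SJ & Psi s = vsval j /\ theta (inJ j) = bar s.
Proof.
have jE := vsvalK j; have := subvsP j; rewrite -[in theta _]jE.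
move: (vsval j) => f; move: f {j jE}; apply: span_ind => [|t f g [s sJ [sE tE]] [s' sJ' [sE' tE']]|].
- by exists 0; rewrite ?mem0v // !linear0.
- exists (t *: s + s'); first by rewrite memvD ?memvZ.
  by rewrite PsiP sE sE' !linearP /= tE tE'.
move=> _ /mapP[a aP ->]; exists (smul a a); first exact: smul_rootSJ.
by rewrite Psi_jop; split=> //; apply: (theta_J thetaP).
Qed.

Definition liftH (w : {ffun seq_sub Phi -> L}) : S :=
  \sum_(a : seq_sub Phi) smul (e (val a)) (w a).

Definition liftX (x : {ffun seq_sub (Lambda0 kap Phi) -> F^o}) : S :=
  \sum_(lam : seq_sub (Lambda0 kap Phi))
    x lam *: smul (e (pa (val lam))) (e (pb (val lam))).

Lemma theta_lift (v : fA) : exists2 s, s \in SJ &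
  Psi s = vsval v.1.1 /\ theta v = bar (s + (liftH (vsval v.1.2) + liftX v.2)).
Proof.
have [s sJ [sE tE]] := frakJ_lift v.1.1; exists s => //; split=> //.
have /perp_sumP wP := subvsP v.1.2.
rewrite {1}(frakA_decomp v) !linearD /= tE !linear_sum /=; congr (_ + (_ + _)).
  apply: eq_bigr => a _; apply: (theta_H thetaP).
  by have /(perpP _ (valP a))[] := wP a.
by apply: eq_bigr => lam _; rewrite !linearZ /= (theta_X thetaP).
Qed.

(** * The lifted vectors meet [V] trivially *)

Lemma qformD x y s t : qform x y (s + t) = qform x y s + qform x y t.
Proof. by rewrite -[s]scale1r qform_lin scale1r mul1r. Qed.

Lemma qformZ x y a s : qform x y (a *: s) = a * qform x y s.
Proof. by rewrite -[_ *: _]addr0 qform_lin qform0 addr0. Qed.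

Lemma qform_sum I (r : seq I) (P : pred I) (G : I -> S) x y :
  qform x y (\sum_(i <- r | P i) G i) = \sum_(i <- r | P i) qform x y (G i).
Proof. by apply: (big_morph (qform x y)) => [s t|]; rewrite ?qformD ?qform0. Qed.

Lemma SJ_ind (P : S -> Prop) :
    P 0 -> (forall a s t, P s -> P t -> P (a *: s + t)) ->
    {in Phi, forall a, P (smul a a)} -> {in SJ, forall s, P s}.
Proof.
move=> P0 PD Pa; apply: span_ind => // _ /mapP[a aP ->]; exact: Pa.
Qed.

Lemma kap_eH a h : a \in Phi -> h \in H -> kap (e a) h = 0.
Proof. by move=> aP hH; rewrite kapC kap_He. Qed.

Lemma SJ_form_e s a x : s \in SJ -> a \in Phi -> B s (smul (e a) x) = 0.
Proof.
move=> sJ aP; move: s sJ; apply: SJ_ind => [|t u v uE vE|b bP].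
- by rewrite (form0l bB).
- by rewrite (formPl bB) uE vE mulr0 addr0.
rewrite s2formE //; last exact: kapC.
by rewrite kap_He ?root_H // mul0r mulr0 addr0 mulr0.
Qed.

Lemma SJ_eq0 s : s \in SJ -> {in H &, forall h k, B s (smul h k) = 0} -> s = 0.
Proof.
move=> sJ s0; apply: (s2form_nondeg kB kapC kap_nondeg).
apply: chev_ind => [y|t u v uE vE y|a aP|a aP y].
- by rewrite (bil0l sB) (form0r bB).
- by rewrite (bilPl sB) (formPr bB) uE vE mulr0 addr0.
- apply: chev_ind => [|t u v uE vE|b bP|b bP].
  + by rewrite (bil0r sB) (form0r bB).
  + by rewrite (bilPr sB) (formPr bB) uE vE mulr0 addr0.
  + by rewrite s0 ?root_H.
  + by rewrite smulC SJ_form_e.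
exact: SJ_form_e.
Qed.

Lemma qform_SJ x y s : s \in SJ -> x \in H -> qform x y s = 0.
Proof.
move=> sJ xH; move: s sJ; apply: SJ_ind => [|t u v uE vE|b bP].
- exact: qform0.
- by rewrite qform_lin uE vE mulr0 addr0.
by rewrite qform_smul !(H_comm (root_H bP) xH) !(form0l kB, form0r kB) addr0 mulr0.
Qed.

Lemma qform_SJ_ee a b s : s \in SJ -> a \in Phi -> b \in Phi -> a + b != 0 ->
  qform (e a) (e b) s = 0.
Proof.
move=> sJ aP bP ab; move: s sJ; apply: SJ_ind => [|t u v uE vE|d dP].
- exact: qform0.
- by rewrite qform_lin uE vE mulr0 addr0.
rewrite qform_smul !(H_e (root_H dP)) // !(formZl kB) !(formZr kB).
by rewrite kap_ee // kap_ee 1?addrC // !mulr0 addr0 mulr0.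
Qed.

Lemma Lambda0_neq0 lam : lam \in Lambda0 kap Phi -> lam != 0.
Proof.
move=> /Lambda0P[a [b [aP bP ab ->]]]; rewrite addr_eq0.
by have /andP[] := kap0_neq aP bP ab.
Qed.

Lemma eqPhi_opp a b : (a + - b == 0 :> L) = (a == b).
Proof. exact: subr_eq0. Qed.

(** First of six evaluations, of [liftH] and [liftX] on three kinds of test pairs: [qform] always
    vanishes, and [B] reads off one coordinate or nothing. *)
Lemma liftH_HH w : w \in perp_sum H kap Phi -> {in H &, forall x y,
  qform x y (liftH w) = 0 /\ B (liftH w) (smul x y) = 0}.
Proof.
move=> /perp_sumP wP x y xH yH.
rewrite qform_sum (form_suml bB) !big1 // => a _;
  have /(perpP _ (valP a))[wH _] := wP a; have aP := valP a.
  rewrite s2formE //; last exact: kapC.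
  by rewrite !(kap_eH aP) // !mul0r addr0 mulr0.
by rewrite qform_smul !(H_comm wH) // !(form0r kB) addr0 mulr0.
Qed.

Lemma liftX_HH x0 : {in H &, forall x y,
  qform x y (liftX x0) = 0 /\ B (liftX x0) (smul x y) = 0}.
Proof.
move=> x y xH yH.
rewrite qform_sum (form_suml bB) !big1 // => l _;
  have [paP pbP pab] := pP (valP l); have l0 := Lambda0_neq0 (valP l).
  rewrite (formZl bB) s2formE //; last exact: kapC.
  by rewrite !(kap_eH paP) // !mul0r addr0 !mulr0.
rewrite qformZ qform_smul !lie_eH // !(formZl kB) !(formZr kB).
by rewrite kap_ee ?pab // !mulr0 addr0 !mulr0.
Qed.

Lemma lie_pab lam : lam \in Lambda0 kap Phi -> lie (e (pa lam)) (e (pb lam)) = 0.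
Proof.
by move=> lP; have [paP pbP _] := pP lP; rewrite lie_ee_ge0 // p_kap0.
Qed.

Lemma kap_lie x y z : kap x (lie y z) = - kap (lie y x) z.
Proof. by rewrite kap_inv opprK. Qed.

Lemma liftH_eH w (d : seq_sub Phi) k :
    w \in perp_sum H kap Phi -> k \in perp H kap (val d) ->
  qform (e (- val d)) k (liftH w) = 0 /\
  B (liftH w) (smul (e (- val d)) k) = 2^-1 * kap (w d) k.
Proof.
move=> /perp_sumP wP; have dP := valP d => /(perpP _ dP)[kH dk].
have ndP := rootN dP; rewrite qform_sum (form_suml bB); split.
  rewrite big1 // => a _; have aP := valP a.
  have /(perpP _ (valP a))[wH _] := wP a.
  rewrite qform_smul (H_comm wH kH) (form0r kB) add0r lie_eH // H_e //.
  rewrite (formZl kB) (formZr kB); have [->|ad] := eqVneq a d.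
    by rewrite dk oppr0 mul0r mulr0.
  by rewrite kap_ee ?eqPhi_opp ?mulr0 // (inj_eq val_inj).
rewrite (bigD1 d) //= big1 ?addr0 => [|a ad].
  rewrite s2formE //; last exact: kapC.
  by rewrite kap_eN // (kap_eH dP) // mul1r mul0r addr0.
have aP := valP a; have /(perpP _ (valP a))[wH _] := wP a.
rewrite s2formE //; last exact: kapC.
by rewrite kap_ee ?eqPhi_opp ?(inj_eq val_inj) // (kap_eH aP) // !mul0r addr0 mulr0.
Qed.

Lemma liftX_eH x0 d k : d \in Phi -> k \in H ->
  qform (e (- d)) k (liftX x0) = 0 /\ B (liftX x0) (smul (e (- d)) k) = 0.
Proof.
move=> dP kH; have ndP := rootN dP.
rewrite qform_sum (form_suml bB) !big1 // => l _;
  have [paP pbP pab] := pP (valP l); have lP := valP l.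
  rewrite (formZl bB) s2formE //; last exact: kapC.
  by rewrite !(kap_eH _ kH) // mulr0 mul0r addr0 !mulr0.
rewrite qformZ qform_smul (lie_eH paP kH) (lie_eH pbP kH) (formZl kB) (formZr kB) kap_inv.
rewrite (kap_lie (e (pa _))) [lie (e (pb _)) _]lieC !lie_pab //.
by rewrite oppr0 (form0l kB) (form0r kB) !oppr0 !mulr0 addr0 !mulr0.
Qed.

Lemma liftH_ee w mu : w \in perp_sum H kap Phi -> mu \in Lambda0 kap Phi ->
  qform (e (- pa mu)) (e (- pb mu)) (liftH w) = 0 /\
  B (liftH w) (smul (e (- pa mu)) (e (- pb mu))) = 0.
Proof.
move=> /perp_sumP wP muP; have [paP pbP pab] := pP muP.
have npaP := rootN paP; have npbP := rootN pbP.
have ee0 : lie (e (- pa mu)) (e (- pb mu)) = 0.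
  by rewrite lie_ee_ge0 // (formNl kB) (formNr kB) opprK p_kap0.
rewrite qform_sum (form_suml bB) !big1 // => a _; have aP := valP a;
  have /(perpP _ (valP a))[wH _] := wP a.
  rewrite s2formE //; last exact: kapC.
  by rewrite !(kap_He wH) // !mulr0 addr0 mulr0.
rewrite qform_smul !(H_e wH) // !(formZr kB).
rewrite [lie (e (val a)) (e (- pa _))]lieC [lie (e (val a)) (e (- pb _))]lieC.
rewrite !(formNl kB) !kap_inv ee0 [lie (e (- pb _)) _]lieC ee0.
by rewrite oppr0 (form0r kB) !oppr0 !mulr0 addr0 mulr0.
Qed.

Lemma liftX_ee x0 (mu : seq_sub (Lambda0 kap Phi)) :
  qform (e (- pa (val mu))) (e (- pb (val mu))) (liftX x0) = 0 /\
  B (liftX x0) (smul (e (- pa (val mu))) (e (- pb (val mu)))) = 2^-1 * x0 mu.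
Proof.
have muP := valP mu; have [paP pbP pab] := pP muP.
have npaP := rootN paP; have npbP := rootN pbP.
have pab0 := p_kap0 muP; have /andP[papb _] := kap0_neq paP pbP pab0.
rewrite qform_sum (form_suml bB); split.
  rewrite big1 // => l _; have lP := valP l; have [qaP qbP qab] := pP lP.
  rewrite qformZ qform_smul; have [->|lmu] := eqVneq l mu.
    rewrite !lie_e_opp // pab0 add0r lie_ee_ge0 ?(form0l kB) ?mulr0 //.
    by rewrite (formNr kB) pab0 oppr0.
  have wt x y x' y' : x \in Phi -> y \in Phi -> x' \in Phi -> y' \in Phi ->
      x + x' = val l -> y + y' = val mu ->
      kap (lie (e x) (e (- y))) (lie (e x') (e (- y'))) = 0.
    move=> xP yP xP' yP' xx yy; have nyP := rootN yP; have nyP' := rootN yP'.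
    apply: (@kap_weight _ _ (x - y) (x' - y')).
    - by rewrite memvD ?root_H.
    - by rewrite memvD ?root_H.
    - rewrite addrACA xx -opprD yy subr_eq0; apply: contra lmu => /eqP/val_inj ->.
      by rewrite eqxx.
    - by move=> h hH; apply: lie_ee_vec.
    - by move=> h hH; apply: lie_ee_vec.
  rewrite (wt (pa (val l)) (pa (val mu))) // add0r.
  by rewrite (wt (pa (val l)) (pb (val mu))) ?mulr0 // addrC.
rewrite (bigD1 mu) //= big1 ?addr0 => [|l lmu]; rewrite (formZl bB) s2formE //;
  try exact: kapC.
  rewrite !kap_eN // [kap (e (pa _)) (e (- pb _))]kap_ee ?eqPhi_opp // mul0r addr0 !mulr1.
  by rewrite mulrC.
have lP := valP l; have [qaP qbP qab] := pP lP.
have z x y x' y' : x \in Phi -> y \in Phi -> x' \in Phi -> y' \in Phi ->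
    x + x' = val l -> y + y' = val mu ->
    kap (e x) (e (- y)) * kap (e x') (e (- y')) = 0.
  move=> xP yP xP' yP' xx yy; have nyP := rootN yP; have nyP' := rootN yP'.
  have [xy|xy] := eqVneq x y; last by rewrite kap_ee ?eqPhi_opp // mul0r.
  rewrite [X in _ * X]kap_ee ?mulr0 // eqPhi_opp; apply: contra lmu => /eqP xy'.
  by rewrite -(inj_eq val_inj) -xx -yy xy xy'.
rewrite (z (pa (val l)) (pa (val mu))) // (z (pa (val l)) (pb (val mu))) // 1?addrC //.
by rewrite addr0 !mulr0.
Qed.

(** On each test pair [qform] vanishes on all three summands, so by [qform_calV] the value of [B] on
    their sum is zero. Pairs in [H] then detect [s], pairs of [e (- d)] and a vector orthogonal to
    [d] detect [w d], and pairs of root vectors opposite to the chosen ones detect [x0]. *)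
Lemma lift_kernel s w x0 : s \in SJ -> w \in perp_sum H kap Phi ->
  s + (liftH w + liftX x0) \in V -> [/\ s = 0, w = 0 & x0 = 0].
Proof.
move=> sJ wP mV; have two0 : 2 != 0 :> F by rewrite pnatr_eq0.
have test x y : qform x y s = 0 -> qform x y (liftH w) = 0 -> qform x y (liftX x0) = 0 ->
    B s (smul x y) + (B (liftH w) (smul x y) + B (liftX x0) (smul x y)) = 0.
  move=> q1 q2 q3; have := qform_calV x y mV.
  rewrite !qformD q1 q2 q3 !addr0 !(formDl bB) => /esym/eqP.
  by rewrite mulf_eq0 (negPf two0) => /eqP.
split.
- apply: SJ_eq0 => // h k hH kH.
  have [q2 b2] := liftH_HH wP hH kH; have [q3 b3] := liftX_HH x0 hH kH.
  by have := test h k (qform_SJ _ sJ hH) q2 q3; rewrite b2 b3 !addr0.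
- apply/ffunP => d; rewrite ffunE; have dP := valP d; have ndP := rootN dP.
  have /perp_sumP/(_ d)/(perpP _ dP)[wH dw] := wP.
  have wk k : k \in perp H kap (val d) -> kap (w d) k = 0.
    move=> kP; have /(perpP _ dP)[kH dk] := kP.
    have [q2 b2] := liftH_eH wP kP; have [q3 b3] := liftX_eH x0 dP kH.
    have q1 : qform (e (- val d)) k s = 0.
      move: (s) sJ; apply: SJ_ind => [|t u v uE vE|b bP].
      - exact: qform0.
      - by rewrite qform_lin uE vE mulr0 addr0.
      by rewrite qform_smul !(H_comm (root_H bP) kH) (form0l kB) (form0r kB) addr0 mulr0.
    have := test _ _ q1 q2 q3; rewrite b2 b3 (SJ_form_e _ sJ ndP) add0r addr0 => /eqP.
    by rewrite mulf_eq0 invr_eq0 (negPf two0) => /eqP.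
  apply: kapH_nondeg => // a aP.
  rewrite -[a in kap a _](subrK ((kap (val d) a / 2) *: val d)) (formDl kB) (formZl kB) dw.
  rewrite mulr0 addr0 kapC wk //; apply/(perpP _ dP); split.
    by rewrite memvB ?memvZ ?root_H.
  by rewrite (formBr kB) (formZr kB) kap_root // divfK // subrr.
apply/ffunP => mu; rewrite ffunE; have muP := valP mu; have [paP pbP pab] := pP muP.
have [q2 b2] := liftH_ee wP muP; have [q3 b3] := liftX_ee x0 mu.
have nab : - pa (val mu) + - pb (val mu) != 0.
  by rewrite -opprD oppr_eq0 pab Lambda0_neq0.
have := test _ _ (qform_SJ_ee sJ (rootN paP) (rootN pbP) nab) q2 q3.
rewrite b2 b3 (SJ_form_e _ sJ (rootN paP)) !add0r => /eqP.
by rewrite mulf_eq0 invr_eq0 (negPf two0) => /eqP.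
Qed.

Lemma theta_inj : lker theta == 0%VS.
Proof.
rewrite -subv0; apply/subvP => v; rewrite memv_ker memv0 => /eqP v0.
have [s sJ [sE tE]] := theta_lift v; move/eqP: v0; rewrite tE bar_eq0.
move=> /(lift_kernel sJ (subvsP _))[s0 w0 x0].
rewrite s0 Psi0 in sE.
case: v sE w0 x0 {tE} => -[j w] x /= jE wE ->; apply/eqP.
have -> : j = 0 by apply: val_inj.
by have -> : w = 0 by apply: val_inj.
Qed.

Lemma thetaK : cancel theta (theta^-1)%VF.
Proof. exact: lker0_lfunK theta_inj. Qed.

Lemma thetaVK : cancel (theta^-1)%VF theta.
Proof. by move=> a; rewrite limg_lfunVK // limg_theta memvf. Qed.

(** * Weight zero and the Jordan product *)

(** The zero weight space of the symmetric square ([act_U0], [weight0_U0]); [Psi] carries it onto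
    [S0sp]. *)
Definition U0 : {vspace S} :=
  (SJ + <<[seq smul (e a) (e (- a)) | a <- Phi]>>)%VS.

(** The intersection of [U0] with [V] ([W0_V], [V_U0]); [Psi] carries it onto [Wsp]. *)
Definition W0 : {vspace S} :=
  <<[seq 2 *: smul (e a) (e (- a)) - smul a a | a <- Phi]>>%VS.

Lemma SJ_U0 : (SJ <= U0)%VS. Proof. exact: addvSl. Qed.

Lemma smul_eN_U0 a : a \in Phi -> smul (e a) (e (- a)) \in U0.
Proof.
move=> aP; apply: (subvP (addvSr _ _)); apply/memv_span/mapP.
by exists a.
Qed.

Lemma W0_V : (W0 <= V)%VS.
Proof. by apply/span_subvP => _ /mapP[a aP ->]; apply: calV_eN. Qed.

Lemma U0_split : U0 = (SJ + W0)%VS.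
Proof.
have sJ := smul_rootSJ; apply/eqP; rewrite eqEsubv !subv_add !addvSl /=.
apply/andP; split; apply/span_subvP => _ /mapP[a aP ->]; last first.
  apply: memvB; first by apply/memvZ/smul_eN_U0.
  exact/(subvP SJ_U0)/sJ.
rewrite -[smul (e a) _](scalerK (_ : 2 != 0)) ?pnatr_eq0 //.
rewrite -[2 *: _](subrK (smul a a)) memvZ // memvD //.
  by apply: (subvP (addvSr _ _)); apply/memv_span/mapP; exists a.
by apply: (subvP (addvSl _ _)); apply: sJ.
Qed.

Lemma U0_ind (P : S -> Prop) :
    P 0 -> (forall a s t, P s -> P t -> P (a *: s + t)) ->
    {in Phi, forall a, P (smul a a)} -> {in Phi, forall a, P (smul (e a) (e (- a)))} ->
  {in U0, forall s, P s}.
Proof.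
move=> P0 PD Pa Pe; rewrite /U0 -span_cat; apply: span_ind => // s.
by rewrite mem_cat => /orP[] /mapP[a aP ->]; [apply: Pa|apply: Pe].
Qed.

Lemma act_U0 h s : h \in H -> s \in U0 -> act h s = 0.
Proof.
move=> hH; move: s; apply: U0_ind => [|a s t sE tE|a aP|a aP].
- by rewrite (bil0r aB).
- by rewrite (bilPr aB) sE tE scaler0 addr0.
- by rewrite s2actE (H_comm hH) ?root_H // (bil0l sB) (bil0r sB) addr0.
rewrite s2actE !H_e ?rootN // (bilZl sB) (bilZr sB) -scalerDl (formNl kB) subrr.
by rewrite scale0r.
Qed.

Lemma U0_tau2 s : s \in U0 -> tau2 s \in U0.
Proof.
move: s; apply: U0_ind => [|a s t sE tE|a aP|a aP].
- by rewrite cinv2_0 mem0v.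
- by rewrite cinv2P memvD ?memvZ.
- rewrite cinv2_smul cinv_root // (bilNl sB) (bilNr sB) opprK.
  by rewrite (subvP SJ_U0) // smul_rootSJ.
have naP := rootN aP; rewrite cinv2_smul (cinv_e _ aP) (cinv_e _ naP).
by rewrite (bilNl sB) (bilNr sB) opprK smul_eN_U0.
Qed.

Lemma W0_tau2 s : s \in W0 -> tau2 s \in W0.
Proof.
move: s; apply: span_ind => [|a s t sE tE|_ /mapP[a aP ->]].
- by rewrite cinv2_0 mem0v.
- by rewrite cinv2P memvD ?memvZ.
have naP := rootN aP.
rewrite addrC -scaleN1r cinv2P rmorphN1 scaleN1r -[_ *: smul (e a) _]addr0.
rewrite cinv2P cinv2_0 addr0 rmorph_nat !cinv2_smul (cinv_e _ aP) (cinv_e _ naP).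
rewrite (cinv_root _ aP) !(bilNl sB) !(bilNr sB) !opprK addrC [smul (e _) (e _)]smulC.
by rewrite smulC; apply/memv_span/mapP; exists a; rewrite // smulC.
Qed.

Lemma U0_nondeg : {in U0, forall w, {in U0, forall w', B w' w = 0} -> w = 0}.
Proof.
move=> w wU w0; apply: tau2_anisotropic.
by rewrite (s2formC kB kapC) w0 // U0_tau2.
Qed.

(* [S] is the orthogonal sum of [U0] and its complement, and an element of the
   complement killed by [H] is orthogonal to all products of weight vectors. *)
Lemma weight0_U0 s : {in H, forall h, act h s = 0} -> s \in U0.
Proof.
move=> s0; have : s \in fullv by apply: memvf.
rewrite -(orthc_add bB (subvf U0) U0_nondeg) => /memv_addP[v vO [u uU sE]].
suff v0 : v = 0 by rewrite sE v0 add0r.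
have {}s0 h : h \in H -> act h v = 0.
  by move=> hH; have := s0 h hH; rewrite sE (bilDr aB) (act_U0 hH uU) addr0.
have /(orthcP _ _ _ bB)[_ vU] := vO.
have vSJ t : t \in U0 -> B v t = 0 by rewrite (s2formC kB kapC); apply: vU.
have wt h t k : h \in H -> act h t = k *: t -> k != 0 -> B v t = 0.
  move=> hH tE k0; have := s2form_inv kB kapC kap_inv h v t.
  rewrite s0 // tE (form0l bB) (formZr bB) => /esym/eqP.
  by rewrite oppr_eq0 mulf_eq0 (negPf k0) => /eqP.
have veH a h : a \in Phi -> h \in H -> B v (smul (e a) h) = 0.
  move=> aP hH; apply: (wt a _ 2); rewrite ?pnatr_eq0 ?root_H //.
  by rewrite s2actE H_e ?root_H // (H_comm _ hH) ?root_H // (bil0r sB) addr0 kap_root // (bilZl sB).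
apply: (s2form_nondeg kB kapC kap_nondeg).
apply: chev_ind => [y|t x y xE yE z|a aP|a aP].
- by rewrite (bil0l sB) (form0r bB).
- by rewrite (bilPl sB) (formPr bB) xE yE mulr0 addr0.
- apply: chev_ind => [|t x y xE yE|b bP|b bP].
  + by rewrite (bil0r sB) (form0r bB).
  + by rewrite (bilPr sB) (formPr bB) xE yE mulr0 addr0.
  + by rewrite vSJ // (subvP SJ_U0) // smul_HSJ ?root_H.
  + by rewrite smulC veH ?root_H.
apply: chev_ind => [|t x y xE yE|b bP|b bP].
- by rewrite (bil0r sB) (form0r bB).
- by rewrite (bilPr sB) (formPr bB) xE yE mulr0 addr0.
- by rewrite veH ?root_H.
have [ab|ab] := eqVneq (a + b) 0.
  have -> : b = - a by apply/eqP; rewrite -addr_eq0 addrC ab.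
  by rewrite vSJ // smul_eN_U0.
have abH : a + b \in H by rewrite memvD ?root_H.
have [d dP kd] : exists2 d, d \in Phi & kap d (a + b) != 0.
  apply/hasP; apply/negPn/negP => /hasPn nd; move/eqP: ab; apply.
  by apply: kapH_nondeg => // d dP; have := nd d dP; rewrite negbK => /eqP.
apply: (wt d _ (kap d (a + b))) => //; first exact: root_H.
rewrite s2actE !H_e ?root_H // (bilZl sB) (bilZr sB) -scalerDl (formDr kB).
by rewrite kapC [kap b d]kapC.
Qed.

Lemma V_SJ s : s \in V -> s \in SJ -> s = 0.
Proof.
move=> sV sJ; have h0 : liftH 0 = 0.
  by rewrite /liftH big1 // => a _; rewrite ffunE (bil0r sB).
have x0 : liftX 0 = 0.
  by rewrite /liftX big1 // => a _; rewrite ffunE scale0r.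
have [//|-> //] := @lift_kernel s 0 0 sJ (mem0v _).
by rewrite h0 x0 !addr0.
Qed.

Lemma V_U0 s : s \in V -> s \in U0 -> s \in W0.
Proof.
rewrite U0_split => sV /memv_addP[t tJ [w wW sE]].
suff t0 : t = 0 by rewrite sE t0 add0r.
apply: V_SJ => //; have -> : t = s - w by rewrite sE addrK.
by rewrite memvB // (subvP W0_V).
Qed.

Lemma bar_U0 s : s \in U0 -> vsval (bar s) \in U0.
Proof.
move=> sU; apply: weight0_U0 => h hH.
by rewrite -vsval_act -bar_act (act_U0 hH sU) linear0.
Qed.

Lemma S0spE : S0sp kap Phi e = (linfun Psi @: U0)%VS.
Proof.
have PE : linfun Psi =1 Psi by apply: linfunE; apply: Psi_linear.
rewrite limgD !limg_span /S0sp /Jsp /Zsp; congr (<<_>> + <<_>>)%VS.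
  by rewrite -map_comp; apply: eq_map => a; rewrite /= PE Psi_jop.
by rewrite -map_comp; apply: eq_map => a; rewrite /= PE Psi_zop.
Qed.

Lemma WspE : Wsp kap Phi e = (linfun Psi @: W0)%VS.
Proof.
have PE : linfun Psi =1 Psi by apply: linfunE; apply: Psi_linear.
rewrite limg_span /Wsp; congr <<_>>%VS.
rewrite -map_comp; apply: eq_map => a; rewrite /= PE.
by rewrite PsiB PsiZ Psi_jop Psi_zop.
Qed.

Lemma trform_bilinear : bilinear_for *%R *%R (@trform F L).
Proof.
apply: bilinear_formP => a f g h; rewrite /trform.
  by rewrite comp_lfunDl -comp_lfunZl lftrace_linear.
by rewrite comp_lfunDr -comp_lfunZr lftrace_linear.
Qed.

(** [bar] commutes with [H], so it splits a weight zero element inside [U0], the [V]-part lying in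
    [W0]. As [Psi] preserves the forms and carries [U0] and [W0] to [S0sp] and [Wsp], the image of
    this splitting is the orthogonal one. *)
Lemma piA0_Psi s : s \in U0 -> piA0 kap Phi e (Psi s) = Psi (vsval (bar s)).
Proof.
move=> sU; have PE : linfun Psi =1 Psi by apply: linfunE; apply: Psi_linear.
have bU := bar_U0 sU; set a := vsval (bar s) in bU *.
have sE : Psi s = Psi a + Psi (s - a) by rewrite -[Psi a]scale1r -PsiP scale1r addrC subrK.
have wW : s - a \in W0 by rewrite V_U0 ?barB // memvB.
rewrite sE /piA0 (orthproj_eq trform_bilinear) //.
- rewrite WspE => _ /memv_imgP[w wW' ->] w0; rewrite PE.
  suff -> : w = 0 by rewrite Psi0.
  apply: tau2_anisotropic; rewrite (s2formC kB kapC) -Psi_form -!PE w0 //.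
  by apply: memv_img; apply: W0_tau2.
- apply/(orthcP _ _ _ trform_bilinear); split.
    by rewrite S0spE -PE memv_img.
  rewrite WspE => _ /memv_imgP[w wW' ->]; rewrite PE Psi_form.
  by have /memA := subvsP (bar s); apply; apply: (subvP W0_V).
by rewrite WspE -PE memv_img.
Qed.

Local Notation diamond := (@diamond F L kap Phi e).
Local Notation formJ := (@formJ F L kap Phi e).
Local Notation piJ := (piJ kap Phi e).

Lemma piJE j : piJ j = Psi (vsval (theta (inJ j))).
Proof.
have [s sJ [sE tE]] := frakJ_lift j.
rewrite tE -piA0_Psi ?(subvP SJ_U0) // sE linfunE // => a x y.
by rewrite !linearP.
Qed.

(** By [piJE], [piJ] is [theta] on [J] followed by the injective map [Psi]. *)
Lemma piJK : cancel piJ (piJ^-1)%VF.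
Proof.
apply/lker0_lfunK; rewrite -subv0; apply/subvP => j; rewrite memv_ker memv0 piJE.
rewrite -Psi0 => /eqP/Psi_inj j0.
have : theta (inJ j) = theta 0 by rewrite linear0; apply: val_inj.
by move=> /(can_inj thetaK) -[->].
Qed.

Lemma actA_J h j : h \in H -> actA h (theta (inJ j)) = 0.
Proof.
move=> hH; have [s sJ [_ ->]] := frakJ_lift j.
by rewrite -bar_act (act_U0 hH) ?linear0 // (subvP SJ_U0).
Qed.

(** [U0] is [SJ + W0], and [W0] dies in [calA]. *)
Lemma weight0_J a : {in H, forall h, actA h a = 0} -> exists j, a = theta (inJ j).
Proof.
move=> a0; have : vsval a \in U0.
  by apply: weight0_U0 => h hH; rewrite -vsval_act a0.
rewrite U0_split => /memv_addP[t tJ [w wW aE]].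
have PE : linfun Psi =1 Psi by apply: linfunE; apply: Psi_linear.
have PtJ : Psi t \in Jsp kap Phi.
  move: t tJ {aE}; apply: SJ_ind => [|k u v uE vE|b bP].
  - by rewrite Psi0 mem0v.
  - by rewrite PsiP memvD ?memvZ.
  by rewrite Psi_jop; apply/memv_span/mapP; exists b.
exists (vsproj (Jsp kap Phi) (Psi t)).
have [s sJ [sE ->]] := frakJ_lift (vsproj (Jsp kap Phi) (Psi t)).
have -> : s = t by apply: Psi_inj; rewrite sE vsprojK.
rewrite -[a]bar_val aE; apply: bar_eq.
by rewrite addrAC subrr add0r (subvP W0_V).
Qed.

(** The product in the symmetric square of two weight zero elements stays in [U0], where [piA0]
    corresponds to [bar]; the projected product is some [theta (inJ k)], and [piJ] is inverted on
    it. *)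
Lemma diamond_theta i j :
  theta (inJ (diamond i j)) = mulA (theta (inJ i)) (theta (inJ j)).
Proof.
set a := theta (inJ i); set b := theta (inJ j).
have a0 := fun h hH => actA_J i (h := h) hH; have b0 := fun h hH => actA_J j (h := h) hH.
have U : mul (vsval a) (vsval b) \in U0.
  apply: weight0_U0 => h hH; rewrite (s2mul_der kB kapC kap_inv kap_nondeg).
  by rewrite -!vsval_act a0 // b0 // (bil0l mB) (bil0r mB) addr0.
have [k kE] : exists k, mulA a b = theta (inJ k).
  apply: weight0_J => h hH; rewrite actA_der a0 // b0 //.
  by rewrite (bil0l mulA_bilinear) (bil0r mulA_bilinear) addr0.
rewrite /diamond !piJE -/a -/b -Psi_mul piA0_Psi //.
by rewrite -[bar _]/(mulA a b) kE -piJE piJK.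
Qed.

Lemma formJ_theta i j : formJ i j = formA (theta (inJ i)) (theta (inJ j)).
Proof. by rewrite /formJ !piJE Psi_form. Qed.

(** * The partial product on root weights *)

Let mAB := mulA_bilinear.
Let aAB := actA_bilinear.
Let fAB := formA_bilinear.

Lemma actA_comm x y v : actA x (actA y v) = actA y (actA x v) + actA (lie x y) v.
Proof. by rewrite actA_lie addrC subrK. Qed.

Lemma actA_weight a h k v : a \in Phi -> h \in H -> actA h v = k *: v ->
  actA h (actA (e a) v) = (k + kap a h) *: actA (e a) v.
Proof.
move=> aP hH vE; rewrite actA_comm vE H_e // (bilZr aAB) (bilZl aAB).
by rewrite -scalerDl.
Qed.

Lemma mulA_weight h k l v w : actA h v = k *: v -> actA h w = l *: w ->
  actA h (mulA v w) = (k + l) *: mulA v w.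
Proof.
by move=> vE wE; rewrite actA_der vE wE (bilZl mAB) (bilZr mAB) -scalerDl.
Qed.

(** Applying [e a] twice to a square [b b] gives a multiple of [e_a e_a], which lies in [V]. *)
Lemma actA_ee_weight0 a v : a \in Phi -> {in H, forall h, actA h v = 0} ->
  actA (e a) (actA (e a) v) = 0.
Proof.
move=> aP /weight0_J[j ->]; have [s sJ [_ ->]] := frakJ_lift j.
rewrite -!bar_act; apply/eqP; rewrite bar_eq0.
move: s sJ; apply: SJ_ind => [|t u u' uE uE'|b bP].
- by rewrite !(bil0r aB) mem0v.
- by rewrite !(bilPr aB) memvD ?memvZ.
rewrite s2actE lie_eH ?root_H // (bilZl sB) (bilZr sB) (bilDr aB) !(bilZr aB) !s2actE.
rewrite lie_alt (bil0l sB) (bil0r sB) add0r addr0 lie_eH ?root_H //.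
by rewrite (bilZl sB) (bilZr sB) memvD ?memvZ ?calV_ee.
Qed.

(** The squares [b b] span weight zero in [calA], and on a square the two signs of the involution
    cancel. *)
Lemma sigmaA_weight0 v : {in H, forall h, actA h v = 0} -> sigmaA v = v.
Proof.
move=> /weight0_J[j ->]; have [s sJ [_ ->]] := frakJ_lift j.
rewrite sigmaA_bar; congr bar; move: s sJ; apply: SJ_ind => [|t u u' uE uE'|b bP].
- exact: cinv2_0.
- by rewrite cinv2P uE uE'.
by rewrite cinv2_smul cinv_root // (bilNl sB) (bilNr sB) opprK.
Qed.

(* Up to its [sl_2]-invariant part, [v] is the zero weight vector [v1] of a
   three-dimensional module of the [sl_2]-triple of [a]. Put
   [Y = (e_a v1) * u] and [Y' = (e_a u) * v1]: then [e_a e_a (v1 * u) = 0] gives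
   [Y' = - Y], while the Chevalley involution, which is the identity on weight
   zero, gives [e_-a Y' = e_-a Y]. *)
Lemma mulA_lower a v u : a \in Phi ->
    {in H, forall h, actA h v = 0} -> {in H, forall h, actA h u = 0} ->
    actA (e (- a)) (actA (e a) u) = 2 *: u ->
  mulA (actA (e a) v) u = 0.
Proof.
move=> aP v0 u0 qpu; have naP := rootN aP; have aH := root_H aP.
have two0 : 2 != 0 :> F by rewrite pnatr_eq0.
have w0 x h : {in H, forall h, actA h x = 0} -> h \in H -> actA h x = 0 *: x.
  by move=> x0 hH; rewrite x0 // scale0r.
have wpx x h : {in H, forall h, actA h x = 0} -> h \in H ->
    actA h (actA (e a) x) = kap a h *: actA (e a) x.
  by move=> x0 hH; rewrite (actA_weight aP hH (w0 x h x0 hH)) add0r.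
have wqx x h : {in H, forall h, actA h x = 0} -> h \in H ->
    actA h (actA (e (- a)) x) = - kap a h *: actA (e (- a)) x.
  by move=> x0 hH; rewrite (actA_weight naP hH (w0 x h x0 hH)) add0r (formNl kB).
have pq y : (forall h, h \in H -> actA h y = kap a h *: y) ->
    actA (e a) (actA (e (- a)) y) = actA (e (- a)) (actA (e a) y) + 2 *: y.
  by move=> yE; rewrite actA_comm lie_e_opp // (yE a aH) kap_root.
pose v1 := 2^-1 *: actA (e (- a)) (actA (e a) v).
have v10 : {in H, forall h, actA h v1 = 0}.
  move=> h hH; rewrite /v1 (bilZr aAB) (actA_weight naP hH (wpx v h v0 hH)).
  by rewrite (formNl kB) subrr scale0r scaler0.
have pv1 : actA (e a) v1 = actA (e a) v.
  rewrite /v1 (bilZr aAB) pq; last by move=> h; apply: wpx.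
  by rewrite actA_ee_weight0 // (bil0r aAB) add0r scalerK.
have qpv1 : actA (e (- a)) (actA (e a) v1) = 2 *: v1.
  by rewrite pv1 /v1 scalerKV.
rewrite -pv1; clearbody v1; set Y := mulA _ u; pose Y' := mulA (actA (e a) u) v1.
have vu0 : {in H, forall h, actA h (mulA v1 u) = 0}.
  by move=> h hH; rewrite actA_der v10 // u0 // (bil0l mAB) (bil0r mAB) addr0.
have pp : mulA (actA (e a) v1) (actA (e a) u) = 0.
  have := actA_ee_weight0 aP vu0.
  rewrite !actA_der (bilDr aAB) !actA_der !actA_ee_weight0 // (bil0l mAB) (bil0r mAB).
  by rewrite add0r addr0 -mulr2n -scaler_nat => /eqP; rewrite scaler_eq0 (negPf two0) => /eqP.
have Y'E : Y' = - Y.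
  have := congr1 (actA (e (- a))) pp; rewrite actA_der (bil0r aAB) qpv1 qpu.
  rewrite (bilZl mAB) (bilZr mAB) -scalerDr => /eqP.
  by rewrite scaler_eq0 (negPf two0) /= addr_eq0 mulAC => /eqP.
have qYE : actA (e (- a)) Y' = actA (e (- a)) Y.
  rewrite !actA_der qpv1 qpu !(bilZl mAB) [mulA u v1]mulAC; congr (_ + _).
  have /sigmaA_weight0 <- : {in H, forall h,
      actA h (mulA (actA (e a) v1) (actA (e (- a)) u)) = 0}.
    move=> h hH; rewrite (mulA_weight (wpx v1 h v10 hH) (wqx u h u0 hH)).
    by rewrite subrr scale0r.
  rewrite sigmaA_mul !sigmaA_act (sigmaA_weight0 v10) (sigmaA_weight0 u0) (cinv_e _ aP) (cinv_e _ naP) opprK.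
  by rewrite !(bilNl aAB) (bilNl mAB) (bilNr mAB) opprK mulAC.
have qY0 : actA (e (- a)) Y = 0.
  move: qYE; rewrite Y'E (bilNr aAB) => /esym/eqP; rewrite -addr_eq0 -mulr2n -scaler_nat.
  by rewrite scaler_eq0 (negPf two0) => /eqP.
have Yw h : h \in H -> actA h Y = kap a h *: Y.
  by move=> hH; rewrite (mulA_weight (wpx v1 h v10 hH) (w0 u h u0 hH)) addr0.
have := pq Y Yw; rewrite qY0 (bil0r aAB).
rewrite [actA (e a) Y]actA_der actA_ee_weight0 // (bil0l mAB) add0r pp (bil0r aAB) add0r.
by move=> /esym/eqP; rewrite scaler_eq0 (negPf two0) => /eqP.
Qed.

Lemma thetaH_weight (a : seq_sub Phi) h : h \in perp H kap (val a) ->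
  {in H, forall k, actA k (theta (inH a h)) = kap (val a) k *: theta (inH a h)}.
Proof.
have aP := valP a; move=> /(perpP _ aP)[hH ah] k kH; rewrite (theta_H thetaP) // -bar_act s2actE.
by rewrite H_e // (H_comm kH hH) (bil0r sB) addr0 (bilZl sB) linearZ.
Qed.

Lemma thetaH_e (a : seq_sub Phi) h : h \in perp H kap (val a) ->
  actA (e (val a)) (theta (inH a h)) = 0.
Proof.
have aP := valP a; move=> /(perpP _ aP)[hH ah]; rewrite (theta_H thetaP) // -bar_act s2actE.
by rewrite lie_alt (bil0l sB) add0r lie_eH // ah oppr0 scale0r (bil0r sB) linear0.
Qed.

(** With [W] the image of [[h]_a] and [U = e_-a W], the [sl_2] relations give [e_a U = 2 W]. In the
    Leibniz expansion of [e_a (v * U)] the term [(e_a v) * U] is zero by [mulA_lower], and the other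
    is [2 (v * W)]. *)
Lemma mul_H j (a : seq_sub Phi) h : h \in perp H kap (val a) ->
  mulA (theta (inJ j)) (theta (inH a h)) =
  2^-1 *: actA (e (val a)) (mulA (theta (inJ j))
            (theta (inJ (partJ (frakA_act theta (e (- val a)) (inH a h)))))).
Proof.
move=> hP; have aP := valP a; have naP := rootN aP.
have Ww := thetaH_weight hP; have pW := thetaH_e hP.
set W := theta (inH a h) in Ww pW *; set U := actA (e (- val a)) W.
have U0 : {in H, forall k, actA k U = 0}.
  by move=> k kH; rewrite (actA_weight naP kH (Ww k kH)) (formNl kB) subrr scale0r.
have -> : theta (inJ (partJ (frakA_act theta (e (- val a)) (inH a h)))) = U.
  by rewrite /frakA_act -/W -/U; have [i ->] := weight0_J U0; rewrite thetaK.
have two0 : 2 != 0 :> F by rewrite pnatr_eq0.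
have pU : actA (e (val a)) U = 2 *: W.
  by rewrite actA_comm pW (bil0r aAB) add0r lie_e_opp // (Ww _ (root_H aP)) kap_root.
have J0 : {in H, forall k, actA k (theta (inJ j)) = 0} by move=> k; apply: actA_J.
rewrite actA_der mulA_lower // ?pU ?(bilZr aAB) // add0r (bilZr mAB).
by rewrite scalerK.
Qed.

Lemma form_weight v w h k l : actA h v = k *: v -> actA h w = l *: w -> k + l != 0 ->
  formA v w = 0.
Proof.
move=> vE wE kl; have := formA_inv h v w.
rewrite vE wE (formZl fAB) (formZr fAB) -mulrDl => /eqP.
by rewrite mulf_eq0 (negPf kl) => /eqP.
Qed.

Lemma form_H j (a : seq_sub Phi) h : h \in perp H kap (val a) ->
  formA (theta (inJ j)) (theta (inH a h)) = 0.
Proof.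
move=> hP; have aP := valP a; have aH := root_H aP.
apply: (@form_weight _ _ (val a) 0 2).
- by rewrite actA_J // scale0r.
- by rewrite (thetaH_weight hP) // kap_root.
by rewrite add0r pnatr_eq0.
Qed.

Lemma thetaX_weight (lam : seq_sub (Lambda0 kap Phi)) :
  {in H, forall k, actA k (theta (inX lam)) = kap (val lam) k *: theta (inX lam)}.
Proof.
move=> k kH; have [paP pbP pab] := pP (valP lam).
rewrite (theta_X thetaP) -bar_act s2actE !H_e // (bilZl sB) (bilZr sB) -scalerDl linearZ.
by rewrite -(formDl kB) pab.
Qed.

Lemma Lambda0_H lam : lam \in Lambda0 kap Phi -> lam \in H.
Proof. by move=> /Lambda0P[a [b [aP bP _ ->]]]; rewrite memvD ?root_H. Qed.

Lemma kap_Lambda0 lam : lam \in Lambda0 kap Phi -> kap lam lam = 4.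
Proof.
move=> /Lambda0P[a [b [aP bP ab ->]]].
rewrite !(formDl kB) !(formDr kB) !kap_root // [kap b a]kapC ab; ring.
Qed.

Lemma form_X j lam t : formA (theta (inJ j)) (theta (t *: inX lam)) = 0.
Proof.
have lP := valP lam; have lH := Lambda0_H lP; rewrite linearZ (formZr fAB).
rewrite (@form_weight _ _ (val lam) 0 4) ?mulr0 //.
- by rewrite actA_J // scale0r.
- by rewrite thetaX_weight // kap_Lambda0.
by rewrite add0r pnatr_eq0.
Qed.

(** * The partial product on sums of orthogonal roots *)

Lemma Lambda0_root lam g : lam \in Lambda0 kap Phi -> g \in Phi -> kap g lam = 2 ->
  lam - g \in Phi.
Proof.
move=> /Lambda0P[a [b [aP bP ab ->]]] gP; rewrite (formDr kB) => gs.
have [->|ga] := eqVneq g a; first by rewrite addrC addKr.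
have [->|gb] := eqVneq g b; first by rewrite addrK.
have ga1 := kap_sum2 aP bP gP gs ga gb.
have gb1 : kap g b = 1 by apply: kap_sum2 gb ga; rewrite // addrC.
rewrite addrAC; apply: rootD => //; first by apply: rootB; rewrite // kapC.
by rewrite (formBl kB) ab gb1 sub0r.
Qed.

Lemma Lambda0_kap2 lam g : lam \in Lambda0 kap Phi -> g \in Phi -> lam - g \in Phi ->
  kap g lam = 2.
Proof.
move=> /Lambda0P[a [b [aP bP ab lE]]] gP dP.
have gd : g + (lam - g) = a + b by rewrite addrC subrK.
have gd0 := root_sum_kap0 aP bP gP dP ab gd.
by rewrite -[lam](subrK g) (formDr kB) gd0 add0r kap_root.
Qed.

Lemma kap_weight0 u m : m \in H -> m \notin Phi -> m != 0 ->
  {in H, forall h, lie h u = kap m h *: u} -> u = 0.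
Proof.
move=> pH mP p0 uE; apply/eqP; apply: contraR mP => u0.
exact: root_vec pH p0 u0 uE.
Qed.

Lemma root_weight u m : m \in Phi ->
  {in H, forall h, lie h u = kap m h *: u} -> u = kap u (e (- m)) *: e m.
Proof.
move=> mP uE; have pH := root_H mP; apply/eqP; rewrite -subr_eq0; apply/eqP/kap_nondeg.
apply: chev_ind => [|t x y xE yE|b bP|b bP].
- by rewrite (form0r kB).
- by rewrite (formPr kB) xE yE mulr0 addr0.
- rewrite (formBl kB) (formZl kB) (kap_eH mP (root_H bP)) mulr0 subr0.
  apply: (@kap_weight _ _ m 0) => //; rewrite ?mem0v ?addr0 ?root_neq0 // => h hH.
  by rewrite (H_comm hH (root_H bP)) (form0l kB) scale0r.
rewrite (formBl kB) (formZl kB); have [mb|mb] := eqVneq (m + b) 0.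
  have -> : b = - m by apply/eqP; rewrite -addr_eq0 addrC mb.
  by rewrite kap_eN // mulr1 subrr.
rewrite kap_ee // mulr0 subr0; apply: (@kap_weight _ _ m b) => //; first exact: root_H.
by move=> h hH; apply: H_e.
Qed.

Lemma Psi_weight s y m q : {in H, forall h, act h s = kap m h *: s} ->
    {in H, forall h, lie h y = kap q h *: y} ->
  {in H, forall h, lie h (Psi s y) = kap (m + q) h *: Psi s y}.
Proof.
move=> sE yE h hH; apply/eqP; rewrite -subr_eq0; apply/eqP/kap_nondeg => z.
rewrite (formBl kB) (formZl kB) kap_inv !kap_Psi (formDl kB).
have := s2form_inv kB kapC kap_inv h s (smul y z).
rewrite s2actE sE // yE // (bilZl sB) (formDr bB) (formZl bB) (formZr bB) => sz.
rewrite mulrDl sz; ring.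
Qed.

(** Applying [Psi s] to one half of the dual families of [chev_frame] and multiplying by the other
    half recovers [s] from its operator. *)
Lemma symsq_Psi s : exists c0, s = \sum_(a <- Phi) c0 *: smul a (Psi s a) +
  \sum_(a <- Phi) smul (e a) (Psi s (e (- a))).
Proof.
have [c0 _ fE] := chev_frame; exists c0.
have two0 : 2 != 0 :> F by rewrite pnatr_eq0.
have expand u v : smul u v = \sum_(a <- Phi) (c0 * kap u a) *: smul a v +
    \sum_(a <- Phi) kap u (e (- a)) *: smul (e a) v.
  rewrite {1}(fE u) (bilDl sB) !(bil_suml sB).
  by congr (_ + _); apply: eq_bigr => a _; rewrite (bilZl sB).
elim/symsq_ind: s => [|t s s' sE sE'|u v].
- by rewrite !big1 ?addr0 // => a _; rewrite Psi0 zero_lfunE (bil0r sB) ?scaler0.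
- rewrite {1}sE {1}sE' scalerDr !scaler_sumr addrACA -!big_split /=.
  apply: eq_bigr => a _; rewrite !PsiP !add_lfunE !scale_lfunE !(bilPr sB).
  by rewrite scalerDr !scalerA [t * c0]mulrC.
apply: (scalerI two0); rewrite [LHS]scaler_nat mulr2n [X in _ + X = _]smulC.
rewrite [X in X + _ = _]expand [X in _ + X = _]expand addrACA -!big_split.
rewrite scaler_sumr; apply: eq_bigr => a _ /=.
rewrite !Psi_smul !(bilZr sB) scalerDr [2 *: (c0 *: _)]scalerA [2 * c0]mulrC.
rewrite !(scalerKV two0) !(bilDr sB) !(bilZr sB) scalerDr !scalerA.
rewrite ![kap a _]kapC ![kap (e _) _]kapC scalerDr !scalerA.
have h t : c0 * 2 * (2^-1 * t) = c0 * t by rewrite -mulrA mulVKf.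
by rewrite !h.
Qed.

Section Mul_X.
Variable lam : seq_sub (Lambda0 kap Phi).

Let lP : val lam \in Lambda0 kap Phi := valP lam.
Let paP : pa (val lam) \in Phi := let: And3 h _ _ := pP lP in h.
Let pbP : pb (val lam) \in Phi := let: And3 _ h _ := pP lP in h.
Let pab : pa (val lam) + pb (val lam) = val lam := let: And3 _ _ h := pP lP in h.

Local Notation G := [seq g <- Phi | kap g (val lam) == 2].

Lemma memG g : (g \in G) = (g \in Phi) && (val lam - g \in Phi).
Proof.
rewrite mem_filter andbC; apply/andP/andP => -[gP]; split=> //.
  by apply: Lambda0_root => //; apply/eqP.
by apply/eqP/Lambda0_kap2.
Qed.

Lemma uniqG : uniq G. Proof. by rewrite filter_uniq // uniqPhi. Qed.

Lemma subG g : g \in G -> val lam - g \in G.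
Proof. by rewrite !memG => /andP[gP dP]; rewrite dP opprB addrC subrK. Qed.

Lemma reindexG (W : nmodType) (f : L -> W) :
  \sum_(g <- G) f (val lam - g) = \sum_(g <- G) f g.
Proof.
rewrite -(big_map (fun g => val lam - g) predT f); apply: perm_big.
have mapG : {subset [seq val lam - g | g <- G] <= G}.
  by move=> _ /mapP[g gG ->]; apply: subG.
have um : uniq [seq val lam - g | g <- G].
  by rewrite map_inj_uniq ?uniqG // => g d /addrI/oppr_inj.
apply: uniq_perm => //; first exact: uniqG.
by apply: (uniq_min_size um mapG _).2; rewrite size_map.
Qed.

(** [Psi x] raises weights by [lam]. In [symsq_Psi] the terms from [H] vanish, because [lam] has
    square length 4 and is not a root; a term from [e a] survives only if [lam - a] is a root. *)
Lemma Lambda0_expand x : {in H, forall h, act h x = kap (val lam) h *: x} ->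
  x = \sum_(g <- G) B x (smul (e (- g)) (e (- (val lam - g)))) *:
         smul (e g) (e (val lam - g)).
Proof.
move=> xE; have lH := Lambda0_H lP; have l0 := Lambda0_neq0 lP.
have lnP : val lam \notin Phi.
  apply/negP => /kap_root; rewrite kap_Lambda0 // => /eqP.
  by rewrite (eqr_nat F 4 2).
have [c0 xE'] := symsq_Psi x; rewrite {1}xE' big_seq big1 ?add0r => [|a aP]; last first.
  rewrite (@kap_weight0 (Psi x a) (val lam)) ?(bil0r sB) ?scaler0 //.
  move=> h hH; rewrite -[val lam]addr0; apply: Psi_weight => // k kH.
  by rewrite (H_comm kH) ?root_H // (form0l kB) scale0r.
rewrite big_filter [RHS]big_mkcond big_seq [RHS]big_seq; apply: eq_bigr => a aP.
have naP := rootN aP.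
have Pw : {in H, forall h, lie h (Psi x (e (- a))) =
    kap (val lam - a) h *: Psi x (e (- a))}.
  by apply: Psi_weight => // h hH; apply: H_e.
have := memG a; rewrite mem_filter aP andbT /= => ->; case: ifP => dP.
  by rewrite {1}(root_weight dP Pw) (bilZr sB) kap_Psi.
rewrite (@kap_weight0 (Psi x (e (- a))) (val lam - a)) ?(bil0r sB) ?dP //.
  by rewrite memvB // root_H.
by rewrite subr_eq0; apply: contraNneq lnP => ->.
Qed.

(** Stated for squares because the signs given by [calV_ee0] are not controlled. *)
Lemma Lambda0_coef (x : calA) g : g \in G ->
  B (vsval x) (smul (e (- g)) (e (- (val lam - g)))) ^+ 2 =
  B (vsval x) (smul (e (- pa (val lam))) (e (- pb (val lam)))) ^+ 2.
Proof.
rewrite memG => /andP[gP dP].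
have npq : kap (- pa (val lam)) (- pb (val lam)) = 0.
  by rewrite (formNl kB) (formNr kB) opprK p_kap0.
have sumE : - g + - (val lam - g) = - pa (val lam) + - pb (val lam).
  by rewrite -!opprD pab addrC subrK.
have [s ss sV] := calV_ee0 (rootN paP) (rootN pbP) (rootN gP) (rootN dP) npq sumE.
have /memA/(_ _ sV) := subvsP x; rewrite (s2formC kB kapC) (formBr bB) (formZr bB).
by move=> /eqP; rewrite subr_eq0 => /eqP ->; rewrite exprMn [s ^+ 2]expr2 ss mul1r.
Qed.

(** By [Lambda0_coef] one vanishing pairing kills all coefficients in [Lambda0_expand], so this
    weight space of [calA] is at most a line. *)
Lemma weightX_eq0 z : {in H, forall h, actA h z = kap (val lam) h *: z} ->
  formA z (bar (smul (e (- pa (val lam))) (e (- pb (val lam))))) = 0 -> z = 0.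
Proof.
rewrite form_bar => zE z0; apply: val_inj; rewrite /=.
rewrite (@Lambda0_expand (vsval z)) => [|h hH]; last by rewrite -vsval_act zE.
rewrite big_seq big1 // => g gG; have := Lambda0_coef z gG.
by rewrite z0 expr0n /= => /eqP; rewrite expf_eq0 => /eqP ->; rewrite scale0r.
Qed.

(** Reduces the product [X * X'] below to the values of one operator on root vectors. *)
Lemma s2mul_Psi a b t : mul (smul a b) t = 2^-1 *: (smul b (Psi t a) + smul a (Psi t b)).
Proof.
elim/symsq_ind: t => [|k t t' tE tE'|u v].
- by rewrite (bil0r mB) Psi0 !zero_lfunE !(bil0r sB) addr0 scaler0.
- rewrite (bilPr mB) tE tE' PsiP !add_lfunE !scale_lfunE !(bilPr sB).
  by rewrite addrACA -scalerDr [RHS]scalerDr !scalerA [k * _]mulrC.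
apply: (s2form_ext kB kapC kap_nondeg) => x y; rewrite (s2mul_formE kB kapC).
rewrite (formZl bB) (formDl bB) !Psi_smul !(bilZr sB) !(bilDr sB) !(bilZr sB).
rewrite !(formZl bB) !(formDl bB) !(formZl bB) !s2formE; try exact: kapC; try exact: kap_bilinear.
by field.
Qed.

Let X := theta (inX lam).
Let X' := bar (smul (e (- pa (val lam))) (e (- pb (val lam)))).
(** The coefficients of [X] in [X_expand]; by [kf_sqr] each of them is [k] up to sign. *)
Let kf g := B (vsval X) (smul (e (- g)) (e (- (val lam - g)))).

Lemma sigmaX : X' = sigmaA X.
Proof.
by rewrite /X (theta_X thetaP) sigmaA_bar cinv2_smul !cinv_e // (bilNl sB) (bilNr sB) opprK.
Qed.

(** By weights the value is a multiple of the stated root vector. Since [X'] is the image of [X]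
    under the linear involution, the factor is a coefficient of [X] itself. *)
Lemma Psi_sigmaX g : g \in G -> Psi (vsval X') (e g) = kf g *: e (- (val lam - g)).
Proof.
rewrite memG => /andP[gP dP]; have ndP := rootN dP.
have wX' : {in H, forall h, act h (vsval X') = kap (- val lam) h *: vsval X'}.
  move=> h hH; rewrite -vsval_act -bar_act s2actE !H_e ?rootN //.
  by rewrite (bilZl sB) (bilZr sB) -scalerDl -(formDl kB) -opprD pab linearZ.
have Pw : {in H, forall h, lie h (Psi (vsval X') (e g)) =
    kap (- (val lam - g)) h *: Psi (vsval X') (e g)}.
  have -> : - (val lam - g) = - val lam + g by rewrite opprD opprK.
  by apply: Psi_weight => // h hH; apply: H_e.
apply: etrans (root_weight ndP Pw) _; rewrite opprK kap_Psi; congr (_ *: _).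
have idK : involutive idF by [].
rewrite sigmaX vsval_sigmaA -[smul (e g) _](cinv2K idK) cinv2_form cinv2_smul.
by rewrite (cinv_e _ gP) (cinv_e _ dP) (bilNl sB) (bilNr sB) opprK.
Qed.

Lemma kf_sub g : kf (val lam - g) = kf g.
Proof.
rewrite /kf smulC (_ : val lam - (val lam - g) = g) //.
by rewrite opprB addrC subrK.
Qed.

Let k := formA X X'.

Lemma kf_sqr g : g \in G -> kf g * kf g = k ^+ 2.
Proof. by move=> gG; rewrite -expr2 /kf Lambda0_coef // /k form_bar. Qed.

Lemma X_expand : vsval X = \sum_(g <- G) kf g *: smul (e g) (e (val lam - g)).
Proof.
apply: Lambda0_expand => h hH.
by rewrite -vsval_act thetaX_weight.
Qed.

(** Pairing [X_expand] with [X'] makes every [g] contribute [kf g * kf g], in which the unknown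
    signs cancel. *)
Lemma form_XX : k = (size G)%:R * k ^+ 2.
Proof.
rewrite {1}/k /calA_form X_expand (form_suml bB) big_seq.
transitivity (\sum_(g <- G) k ^+ 2); last first.
  by rewrite big_const_seq count_predT iter_addr_0 mulr_natl.
rewrite [RHS]big_seq; apply: eq_bigr => g gG; rewrite (formZl bB) -(kf_sqr gG).
congr (_ * _); rewrite (s2formC kB kapC) -kap_Psi Psi_sigmaX // (formZl kB) kapC.
by move: gG; rewrite memG => /andP[gP dP]; rewrite kap_eN // mulr1.
Qed.

Lemma quarter (W : lmodType F) (t q : F) (u v : W) : t * t = q ->
  t *: (2^-1 *: (t *: (2^-1 *: u + 2^-1 *: v))) = (q / 4) *: v + (q / 4) *: u.
Proof.
move=> tq; rewrite -!scalerDr [v + u]addrC !scalerA.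
by congr (_ *: _); rewrite -tq; field.
Qed.

(** Since [e_g e_-g] is half of [g g] modulo [V], the term of [g] contributes [k^2 / 4] times the
    squares of [g] and of [lam - g]; the symmetry [g -> lam - g] of the index set merges the two
    sums. *)
Lemma mul_XX : mulA X X' = (k ^+ 2 / 2) *: \sum_(g <- G) bar (smul g g).
Proof.
have two0 : 2 != 0 :> F by rewrite pnatr_eq0.
have bareN g : g \in Phi -> bar (smul (e g) (e (- g))) = 2^-1 *: bar (smul g g).
  move=> gP; rewrite -linearZ; apply: bar_eq.
  rewrite -[smul (e g) _](scalerK two0) -scalerBr memvZ //; exact: calV_eN.
rewrite /calA_mul X_expand (bil_suml mB) linear_sum /=.
transitivity (\sum_(g <- G) ((k ^+ 2 / 4) *: bar (smul g g) +
    (k ^+ 2 / 4) *: bar (smul (val lam - g) (val lam - g)))); last first.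
  rewrite big_split /= -!scaler_sumr [X in _ + _ *: X = _](reindexG (fun g => bar (smul g g))).
  rewrite -scalerDl.
  by congr (_ *: _); field.
rewrite big_seq [RHS]big_seq; apply: eq_bigr => g gG.
have dG := subG gG; have := gG; rewrite memG => /andP[gP dP].
rewrite (bilZl mB) s2mul_Psi Psi_sigmaX // Psi_sigmaX // kf_sub !(bilZr sB) -scalerDr.
rewrite (_ : val lam - (val lam - g) = g); last by rewrite opprB addrC subrK.
move: (kf_sqr gG); move: (kf g) (k ^+ 2) => t q tq.
rewrite barZ; rewrite barZ; rewrite barZ; rewrite barD; rewrite (bareN _ gP) (bareN _ dP).
exact: quarter.
Qed.

(** The sets [{g, lam - g}] partition the roots in question; each has two elements, because its
    members are orthogonal and hence distinct. *)
Lemma num_pairsG : size G = (num_pairs Phi (val lam) * 2)%N.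
Proof.
pose D := [set g : seq_sub Phi | val g \in G].
have cardD : #|D| = size G.
  rewrite cardE -(size_map val); apply: perm_size; apply: uniq_perm.
  - by rewrite (map_inj_uniq val_inj) enum_uniq.
  - exact: uniqG.
  move=> g; apply/mapP/idP => [[d]|gG]; first by rewrite mem_enum inE => dG ->.
  have gP : g \in Phi by move: gG; rewrite memG => /andP[].
  by exists (SeqSub gP) => //; rewrite mem_enum inE.
rewrite -cardD /num_pairs; set P := [set _ | _].
have PP (A : {set seq_sub Phi}) : A \in P ->
    exists a b, [/\ A = [set a; b], val a + val b = val lam & a != b].
  rewrite inE => /existsP[a /existsP[b /andP[/eqP -> /eqP ab]]]; exists a, b; split=> //.
  have aG := valP a; have bG := valP b.
  have ab0 := root_sum_kap0 paP pbP aG bG (p_kap0 lP) (etrans ab (esym pab)).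
  by have /andP[+ _] := kap0_neq aG bG ab0; apply: contraNneq => ->.
apply: card_uniform_partition => [A /PP[a [b [-> _ ab]]]|]; first by rewrite cards2 ab.
apply/and3P; split.
- apply/eqP/setP => g; rewrite inE; apply/bigcupP/idP => [[A AP gA]|gG].
    have [a [b [AE ab _]]] := PP A AP; rewrite memG (valP g) /=.
    move: gA; rewrite AE !inE => /orP[/eqP ->|/eqP ->].
      by rewrite -ab addrC addKr (valP b).
    by rewrite -ab addrK (valP a).
  have dP : val lam - val g \in Phi by move: gG; rewrite memG => /andP[].
  exists [set g; SeqSub dP]; last by rewrite !inE eqxx.
  rewrite inE; apply/existsP; exists g; apply/existsP; exists (SeqSub dP).
  by rewrite eqxx /= addrC subrK eqxx.
- apply/trivIsetP => A A' AP AP'; apply: contraNT => /pred0Pn[x /andP[/= xA xA']].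
  have memP (C : {set seq_sub Phi}) y : C \in P -> x \in C ->
      (y \in C) = (y == x) || (val x + val y == val lam).
    move=> CP; have [a [b [-> ab _]]] := PP C CP; rewrite !inE => /orP[] /eqP ->.
      by rewrite -ab (inj_eq (addrI _)) (inj_eq val_inj).
    by rewrite orbC -ab addrC (inj_eq (addIr _)) (inj_eq val_inj).
  by apply/eqP/setP => y; rewrite (memP A y AP xA) (memP A' y AP' xA').
by apply/negP => /PP[a [b [/esym/eqP]]]; rewrite -subset0 subUset sub1set inE.
Qed.

(** Origin of the constant in [e_frak]: with [n] pairs, [form_XX] reads [k = 2 n k^2], so the factor
    [k^2 / 2] of [mul_XX] equals [k / (4 n)]. *)
Lemma theta_efrak : mulA X X' = k *: theta (inJ (e_frak kap Phi (val lam))).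
Proof.
rewrite mul_XX /e_frak; set u := \sum_(a <- Phi | _) _.
have -> : theta (inJ ((4 * (num_pairs Phi (val lam))%:R)^-1 *: u)) =
    (4 * (num_pairs Phi (val lam))%:R)^-1 *: theta (inJ u) by rewrite !linearZ.
have -> : theta (inJ u) = \sum_(g <- G) bar (smul g g).
  rewrite /u !linear_sum big_filter big_seq_cond [RHS]big_seq_cond.
  by apply: eq_bigr => a /andP[aP _]; apply: (theta_J thetaP).
rewrite scalerA; congr (_ *: _); have := form_XX; rewrite num_pairsG natrM => kE.
have n0 : (num_pairs Phi (val lam))%:R != 0 :> F.
  rewrite pnatr_eq0 -lt0n -(ltn_pmul2r (m := 2)) // mul0n -num_pairsG -has_predT.
  apply/hasP; exists (pa (val lam)) => //; rewrite memG paP -{1}pab addrC addKr.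
  exact: pbP.
by rewrite [in RHS]kE; field.
Qed.

(** Associativity moves [X] to the other side, so the pairing of [v * X] with [X'] is that of [v]
    with [X * X'], which [theta_efrak] evaluates. The difference of both sides has weight [lam] and
    pairs to zero with [X']. *)
Lemma mul_X j : mulA (theta (inJ j)) X =
  formJ j (e_frak kap Phi (val lam)) *: X.
Proof.
have J0 : {in H, forall h, actA h (theta (inJ j)) = 0 *: theta (inJ j)}.
  by move=> h hH; rewrite actA_J // scale0r.
have Xw := @thetaX_weight lam.
apply/eqP; rewrite -subr_eq0; apply/eqP/weightX_eq0 => [h hH|].
  rewrite (bilBr aAB) (bilZr aAB) (mulA_weight (J0 h hH) (Xw h hH)) add0r Xw //.
  by rewrite scalerBr !scalerA mulrC.
rewrite (formBl fAB) (formZl fAB) -/X' -/k formA_assoc theta_efrak (formZr fAB) formJ_theta.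
by rewrite mulrC subrr.
Qed.

End Mul_X.

(** * Transport along theta and uniqueness *)

Local Notation actF := (frakA_act theta).

Lemma theta_act x v : theta (actF x v) = actA x (theta v).
Proof. exact: thetaVK. Qed.

Lemma theta_lin a u v : theta (a *: u + v) = a *: theta u + theta v.
Proof. exact: linearP. Qed.

Lemma thetaB u v : theta (u - v) = theta u - theta v.
Proof. exact: linearB. Qed.

Let tmul (v w : fA) : fA := (theta^-1)%VF (mulA (theta v) (theta w)).
Let tform (v w : fA) : F := formA (theta v) (theta w).

Lemma theta_mul v w : theta (tmul v w) = mulA (theta v) (theta w).
Proof. exact: thetaVK. Qed.

Lemma transport_extends : extends_partial theta tmul tform.
Proof.
split=> [v w|v a h hP|v lam t|v w|v a h hP|v lam t].
- by apply: (can_inj thetaK); rewrite theta_mul diamond_theta.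
- apply: (can_inj thetaK); rewrite theta_mul (mul_H v hP).
  by rewrite linearZ /= theta_act diamond_theta.
- apply: (can_inj thetaK); rewrite theta_mul !linearZ /= (bilZr mAB) mul_X.
  by rewrite !scalerA mulrC.
- by rewrite /tform formJ_theta.
- exact: form_H.
- exact: form_X.
Qed.

Lemma transport_frobenius : frobenius_algebra_for actF tmul tform.
Proof.
have [[_ actL] [_ mC _ fC fN fAs] der inv] := calA_frobenius.
have tK := can_inj thetaK.
split; [split|split|..].
- apply: bilinear_mapP => a x y z; apply: tK; apply: etrans (theta_act _ _) _.
    by rewrite (bilPl aAB) [RHS]theta_lin; congr (_ *: _ + _); rewrite theta_act.
  by rewrite [RHS]theta_lin theta_lin (bilPr aAB); congr (_ *: _ + _); rewrite theta_act.
- move=> x y v; apply: tK; apply: etrans (theta_act _ _) _.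
  by rewrite actL [RHS]thetaB; congr (_ - _); rewrite 2!theta_act.
- apply: bilinear_mapP => a x y z; apply: tK; rewrite [RHS]theta_lin !theta_mul theta_lin.
    exact: (bilPl mAB).
  exact: (bilPr mAB).
- by move=> u v; apply: tK; rewrite !theta_mul mC.
- by apply: bilinear_formP => a x y z; rewrite /tform linearP ?(formPl fAB) ?(formPr fAB).
- by move=> u v; apply: fC.
- move=> u u0; apply: tK; rewrite linear0; apply: fN => v.
  by rewrite -[v]thetaVK; apply: u0.
- by move=> u v w; rewrite /tform !theta_mul fAs.
- by move=> x v w; apply: tK; rewrite linearD /= !theta_mul !theta_act theta_mul der.
- by move=> x v w; rewrite /tform !theta_act inv.
Qed.

(** [J] generates the module: [e_a] sends the class of [h a], with [h] orthogonal to [a], to [-2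
    [h]_a], and for the chosen roots [a + b = lam], [e_a] sends [[a]_b] to [-2 x_lam]. *)
Lemma frakA_ind (P : fA -> Prop) :
    P 0 -> (forall a u v, P u -> P v -> P (a *: u + v)) ->
    (forall x u, P u -> P (actF x u)) -> (forall j, P (inJ j)) -> forall u, P u.
Proof.
move=> P0 PD Pa PJ; have tK := can_inj thetaK.
have PZ a u : P u -> P (a *: u) by move=> Pu; rewrite -[a *: u]addr0; apply: PD.
have PA u v : P u -> P v -> P (u + v) by move=> Pu Pv; rewrite -[u]scale1r; apply: PD.
have n20 : -2 != 0 :> F by rewrite oppr_eq0 pnatr_eq0.
have eaa a : a \in Phi -> lie (e a) a = -2 *: e a.
  by move=> aP; rewrite lie_eH ?root_H // kap_root.
have PH (a : seq_sub Phi) h : h \in perp H kap (val a) -> P (inH a h).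
  move=> hP; have aP := valP a; have /(perpP _ aP)[hH ah] := hP.
  have [j jE] : exists j, bar (smul h (val a)) = theta (inJ j).
    apply: weight0_J => k kH; rewrite -bar_act s2actE (H_comm kH hH).
    by rewrite (H_comm kH (root_H aP)) (bil0l sB) (bil0r sB) addr0 linear0.
  have -> : inH a h = (-2)^-1 *: actF (e (val a)) (inJ j).
    apply: tK; rewrite linearZ /= theta_act -jE -bar_act s2actE lie_eH // ah oppr0 scale0r.
    rewrite (bil0l sB) add0r eaa // (bilZr sB) barZ scalerK // smulC.
    exact: (theta_H thetaP).
  exact/PZ/Pa/PJ.
have PX lam : P (inX lam).
  have lP := valP lam; have [paP pbP pab] := pP lP.
  have ab0 := p_kap0 lP.
  have aP : pa (val lam) \in perp H kap (val (SeqSub pbP)).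
    by apply/(perpP _ pbP); rewrite root_H // kapC.
  have -> : inX lam = (-2)^-1 *: actF (e (pa (val lam))) (inH (SeqSub pbP) (pa (val lam))).
    apply: tK; rewrite linearZ /= theta_act (theta_H thetaP) ?root_H // -bar_act s2actE.
    rewrite lie_pab // (bil0l sB) add0r eaa // (bilZr sB) barZ scalerK // smulC.
    exact: (theta_X thetaP).
  exact/PZ/Pa/PH.
move=> u; rewrite (frakA_decomp u); have /perp_sumP wP := subvsP u.1.2.
apply/PA => //; apply/PA; apply: (big_ind P) => // i _; first exact: PH.
exact: PZ.
Qed.

Lemma extends_unique m b : extends_partial theta m b ->
  frobenius_algebra_for actF m b -> m =2 tmul /\ b =2 tform.
Proof.
move=> mbE [_ [mB' _ bB' _ _ _] der inv].
have [_ [tmB _ tbB _ _ _] tder tinv] := transport_frobenius.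
have tE := transport_extends.
suff P u : forall w, m u w = tmul u w /\ b u w = tform u w.
  by split=> u w; have [] := P u w.
move: u; apply: frakA_ind => [w|a u v uE vE w|x u uE w|j w].
- by rewrite (bil0l mB') (bil0l tmB) (form0l bB') (form0l tbB).
- rewrite (bilPl mB') (bilPl tmB) (formPl bB') (formPl tbB).
  by have [-> ->] := uE w; have [-> ->] := vE w.
- split.
    apply: (addIr (m u (actF x w))); rewrite -der.
    have [-> _] := uE w; have [-> _] := uE (actF x w); exact: tder.
  apply: (addIr (b u (actF x w))); rewrite inv.
  by have [_ ->] := uE (actF x w); rewrite tinv.
rewrite (frakA_decomp w); have /perp_sumP wP := subvsP w.1.2; split.
  rewrite !(bilDr mB') !(bilDr tmB) !(bil_sumr mB') !(bil_sumr tmB).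
  rewrite (ext_mul_J mbE) (ext_mul_J tE); congr (_ + (_ + _)); apply: eq_bigr => i _.
    by rewrite (ext_mul_H mbE) // (ext_mul_H tE).
  by rewrite (ext_mul_X mbE) (ext_mul_X tE).
rewrite !(formDr bB') !(formDr tbB) !(form_sumr bB') !(form_sumr tbB).
rewrite (ext_form_J mbE) (ext_form_J tE); congr (_ + (_ + _)); apply: eq_bigr => i _.
  by rewrite (ext_form_H mbE) // (ext_form_H tE).
by rewrite (ext_form_X mbE) (ext_form_X tE).
Qed.

Lemma frakA_frobenius : exists (m : fA -> fA -> fA) (b : fA -> fA -> F),
  [/\ extends_partial theta m b, frobenius_algebra_for actF m b,
      forall m' b', extends_partial theta m' b' ->
        frobenius_algebra_for actF m' b' -> m' =2 m /\ b' =2 b &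
      frobenius_iso_for actF m b actA mulA formA theta].
Proof.
exists tmul, tform; split.
- exact: transport_extends.
- exact: transport_frobenius.
- exact: extends_unique.
split.
- exact: linearP.
- by exists (theta^-1)%VF; [apply: thetaK|apply: thetaVK].
- exact: theta_act.
- exact: theta_mul.
- by [].
Qed.

End Theta.
End Roots.

Theorem theorem4p9 (R : realType) (L : lieAlgType R[i])
    (H : {vspace L}) (kap : L -> L -> R[i]) (Phi Delta : seq L)
    (T : simply_laced) (omega : L)
    (e : L -> L) (c : L -> L -> R[i]) (pa pb : L -> L)
    (theta : 'Hom(frakA H kap Phi, calA kap e omega)) :
  simple_lie L ->
  cartan_subalgebra H ->
  rescaled_killing H kap ->
  root_system H kap Phi ->
  admissible T ->
  has_type kap Phi T ->
  is_base Phi Delta ->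
  highest_root Phi Delta omega ->
  chevalley_basis kap Phi Delta e c ->
  {in Lambda0 kap Phi, forall lam,
    [/\ pa lam \in Phi, pb lam \in Phi & pa lam + pb lam = lam]} ->
  theta_spec pa pb theta ->
  exists (m : frakA H kap Phi -> frakA H kap Phi -> frakA H kap Phi)
         (b : frakA H kap Phi -> frakA H kap Phi -> R[i]),
    [/\ extends_partial theta m b,
        frobenius_algebra_for (frakA_act theta) m b,
        forall m' b', extends_partial theta m' b' ->
          frobenius_algebra_for (frakA_act theta) m' b' ->
          m' =2 m /\ b' =2 b &
        frobenius_iso_for (frakA_act theta) m b
          (@calA_act _ L kap e omega) (@calA_mul _ L kap e omega)
          (@calA_form _ L kap e omega) theta].
Proof.
move=> simpleL cartanH kapK PhiR _ PhiT DeltaB omegaP chev pP thetaP.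
exact: (frakA_frobenius simpleL cartanH kapK PhiR PhiT DeltaB omegaP chev pP thetaP).
Qed.
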